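(* Let $d\in\mathbb{N}$ and let $V$ be one of the spaces $H^1(\mathbb{R}^d)$, $L^2_{1+|x|}(\mathbb{R}^d)$, $\mathbb{H}^1(\mathbb{R}^d)$. Let $g\in V$ and let $\Lambda\subset\mathbb{R}^{2d}$ be a lattice such that the Gabor system $(g,\Lambda)$ is a frame for $L^2(\mathbb{R}^d)$ with frame operator $S$. Then the canonical dual window $S^{-1}g$ belongs to $V$. Furthermore, $(S^{-1/2}g,\Lambda)$ is a Parseval frame for $L^2(\mathbb{R}^d)$ with $S^{-1/2}g\in V$.
   Context: Function spaces (all consisting of complex-valued functions): $H^1(\mathbb{R}^d)=W^{1,2}(\mathbb{R}^d)$ is the space of $f\in L^2(\mathbb{R}^d)$ whose distributional partial derivatives $\partial_j f$, $j=1,\dots,d$, all belong to $L^2(\mathbb{R}^d)$; $L^2_{1+|x|}(\mathbb{R}^d)=\{f:\mathbb{R}^d\to\mathbb{C} : (1+|x|)f(x)\in L^2\}$; and $\mathbb{H}^1(\mathbb{R}^d)=H^1(\mathbb{R}^d)\cap L^2_{1+|x|}(\mathbb{R}^d)$. A lattice in $\mathbb{R}^{2d}$ is a set $\Lambda=A\mathbb{Z}^{2d}$ with $A\in\mathbb{R}^{2d\times 2d}$ invertible. For $a,b\in\mathbb{R}^d$ and $f\in L^2(\mathbb{R}^d)$: $T_af(x)=f(x-a)$, $M_bf(x)=e^{2\pi i b\cdot x}f(x)$, $\pi(a,b)=T_aM_b$. The Gabor system is $(g,\Lambda)=\{\pi(\lambda)g:\lambda\in\Lambda\}$. Its frame operator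 is $Sf=\sum_{\lambda\in\Lambda}\langle f,\pi(\lambda)g\rangle\,\pi(\lambda)g$, with the $L^2$ inner product linear in the first argument. The system $(g,\Lambda)$ is a frame for $L^2(\mathbb{R}^d)$ if there are constants $0<A\le B<\infty$ with $A\|f\|_{L^2}^2\le\sum_{\lambda\in\Lambda}|\langle f,\pi(\lambda)g\rangle|^2\le B\|f\|_{L^2}^2$ for all $f\in L^2(\mathbb{R}^d)$; equivalently, $S$ is bounded and boundedly invertible on $L^2(\mathbb{R}^d)$. A Parseval frame is a frame with $A=B=1$. $S^{-1/2}$ is the positive square root of the positive operator $S^{-1}$. *)

(* Defs.v *)
From HB Require Import structures.
From mathcomp Require Import all_boot all_order all_algebra finmap.
From mathcomp Require Import generic_quotient ring_quotient complex.
From mathcomp Require Import all_classical all_reals all_analysis.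
From mathcomp Require Import measurable_realfun.
From mathcomp Require summability.
Set Implicit Arguments.
Unset Strict Implicit.
Unset Printing Implicit Defensive.
Import Order.TTheory GRing.Theory Num.Theory.
Import numFieldNormedType.Exports.
Local Open Scope classical_set_scope.
Local Open Scope ring_scope.
Local Open Scope complex_scope.
Local Open Scope quotient_scope.

Local Notation Re := (@complex.Re _).
Local Notation normc := (@Normc.normc _).
Local Notation Im := (@complex.Im _).

Section ComplexL2fun.
Context {d : measure_display} {T : measurableType d} {R : realType}.
Variable mu : {measure set T -> \bar R}.
Local Notation C := R[i].
Implicit Types f g : T -> C.

Definition cmeasurable f :=
  measurable_fun setT (Re \o f) /\
  measurable_fun setT (Im \o f).

Definition cintegral f : C :=
  (\int[mu]_x Re (f x)) +i* (\int[mu]_x Im (f x)).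

Definition cabs f : T -> R := normc \o f.

Definition square_integrable : {pred (T -> C)} :=
  mem [set f | cmeasurable f /\ finite_norm mu 2%:E (cabs f)].

Lemma cabsE f x :
  cabs f x = Num.sqrt (Re (f x) ^+ 2 + Im (f x) ^+ 2).
Proof. by rewrite /cabs /=; case: (f x). Qed.

Lemma normc_normr (z : C) : `|z| = (normc z)%:C.
Proof. by case: z. Qed.

Lemma cabs_ge0 f x : 0 <= cabs f x.
Proof. by rewrite cabsE sqrtr_ge0. Qed.

Lemma cabsD f g x : cabs (f + g) x <= cabs f x + cabs g x.
Proof.
have := ler_normD (f x) (g x).
by rewrite !normc_normr -rmorphD/= lecR.
Qed.

Lemma cmeasurable_cabs f : cmeasurable f -> measurable_fun setT (cabs f).
Proof.
move=> [mr mi]; rewrite (_ : cabs f = Num.sqrt \o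
  (fun x => Re (f x) ^+ 2 + Im (f x) ^+ 2)); last first.
  by apply/funext => x; rewrite cabsE.
apply: measurableT_comp; first exact: (continuous_measurable_fun (@sqrt_continuous R)).
by apply: measurable_funD; apply: measurable_funX.
Qed.

Lemma ReD (x y : C) : Re (x + y) = Re x + Re y.
Proof. by case: x; case: y. Qed.

Lemma ImD (x y : C) : Im (x + y) = Im x + Im y.
Proof. by case: x; case: y. Qed.

Lemma cmeasurableD f g : cmeasurable f -> cmeasurable g -> cmeasurable (f + g).
Proof.
move=> [fr fi] [gr gi]; split.
- rewrite (_ : _ \o _ = (Re \o f) \+ (Re \o g)).
    exact: measurable_funD.
  by apply/funext => x /=; rewrite ReD.
- rewrite (_ : _ \o _ = (Im \o f) \+ (Im \o g)).
    exact: measurable_funD.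
  by apply/funext => x /=; rewrite ImD.
Qed.

Lemma cmeasurableZ (a : C) f : cmeasurable f -> cmeasurable (a *: f).
Proof.
case: a => a b [fr fi]; split.
- rewrite (_ : _ \o _ =
    (cst a \* (Re \o f)) \- (cst b \* (Im \o f))).
    by apply: measurable_funB; apply: measurable_funM.
  by apply/funext => x /=; rewrite /GRing.scale/= /GRing.scale/=; case: (f x).
- rewrite (_ : _ \o _ =
    (cst a \* (Im \o f)) \+ (cst b \* (Re \o f))).
    by apply: measurable_funD; apply: measurable_funM.
  by apply/funext => x /=; rewrite /GRing.scale/= /GRing.scale/=; case: (f x).
Qed.

Lemma cabsZ (a : C) f : cabs (a *: f) = normc a \o* cabs f.
Proof.
by apply/funext => x /=; rewrite /cabs/= /GRing.scale/= Normc.normcM mulrC.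
Qed.

Let LnormZ (a : R) (f : T -> R) : measurable_fun setT f ->
  finite_norm mu 2%:E f ->
  ('N[mu]_2%:E[EFin \o (a \o* f)] = `|a|%:E * 'N[mu]_2%:E[EFin \o f])%E.
Proof.
move=> mf ff.
pose F : T -> R := f.
have fP : F \in Lfun mu 2%:E by apply/andP; split; rewrite inE.
have p1 : (1 <= 2%:E :> \bar R)%E by rewrite lee_fin ler1n.
have := LnormZ (Lfun_Sub p1 fP) a.
rewrite /= => <-; congr (Lnorm _ _ _).
by apply/funext => x /=; rewrite mulrC.
Qed.

Let measurable_sq (f : T -> R) : measurable_fun setT f ->
  measurable_fun setT (fun x => (`|(f x)%:E| `^ 2%R)%E).
Proof.
move=> mf; apply/measurable_EFinP.
apply: (@measurableT_comp _ _ _ _ _ _ (fun x : R => x `^ 2)%R) => //.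
exact: measurableT_comp.
Qed.

Let LnormD_cabs f g : cmeasurable f -> cmeasurable g ->
  ('N[mu]_2%:E[EFin \o cabs (f + g)%R] <=
   'N[mu]_2%:E[EFin \o cabs f] + 'N[mu]_2%:E[EFin \o cabs g])%E.
Proof.
move=> mf mg; have maf := cmeasurable_cabs mf; have mag := cmeasurable_cabs mg.
apply: (@le_trans _ _ 'N[mu]_2%:E[EFin \o (cabs f \+ cabs g)%R]%E); last first.
  by apply: minkowski_EFin => //; rewrite ler1n.
rewrite unlock gt0_ler_poweR ?invr_ge0//.
- by rewrite in_itv/= leey integral_ge0// => x _; exact: poweR_ge0.
- by rewrite in_itv/= leey integral_ge0// => x _; exact: poweR_ge0.
apply: ge0_le_integral => //.
- by move=> x _; exact: poweR_ge0.
- exact/measurable_sq/cmeasurable_cabs/cmeasurableD/mg.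
- exact/measurable_sq/measurable_funD.
move=> x _ /=; rewrite lee_fin; apply: ge0_ler_powR => //; rewrite ?nnegrE//.
rewrite !ger0_norm ?addr_ge0 ?cabs_ge0//.
exact: cabsD.
Qed.

Lemma square_integrable_submod_closed : submod_closed square_integrable.
Proof.
split.
  rewrite inE /=; split.
    by split; exact: measurable_cst.
  rewrite /finite_norm (_ : _ \o _ = cst 0%E) ?Lnorm0// ?gt_eqF ?lte_fin//.
  by apply/funext => x /=; rewrite cabsE/= expr0n/= addr0 sqrtr0.
move=> a f g; rewrite !inE /= => -[mf ff] [mg fg].
have mza := cmeasurableZ a mf.
split; first exact: cmeasurableD.
apply: (le_lt_trans (LnormD_cabs mza mg)).
rewrite lte_add_pinfty// cabsZ LnormZ//; last exact: cmeasurable_cabs.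
by rewrite lte_mul_pinfty// ?lee_fin.
Qed.

HB.instance Definition _ := GRing.isSubmodClosed.Build _ _ square_integrable
  square_integrable_submod_closed.

Definition L2fun := {f : T -> C | f \in square_integrable}.
HB.instance Definition _ := SubType.on L2fun.
HB.instance Definition _ := [Choice of L2fun by <:].
HB.instance Definition _ := [SubChoice_isSubLmodule of L2fun by <:].

Definition ae_zero : {pred L2fun} :=
  mem [set f : L2fun | val f = cst 0 %[ae mu]].

Lemma ae_zero_zmod_closed : zmod_closed ae_zero.
Proof.
split; first by rewrite inE /=; apply: aeW.
move=> f g; rewrite !inE /=; apply: filterS2 => x /= h1 h2 xT.
by rewrite -[LHS]/(sval f x - sval g x) h1// h2// subrr.
Qed.

HB.instance Definition _ := GRing.isZmodClosed.Build _ ae_zero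
  ae_zero_zmod_closed.

Definition L2 : Type := Quotient.quot ae_zero.
HB.instance Definition _ := Choice.on L2.
HB.instance Definition _ := GRing.Zmodule.on L2.
HB.instance Definition _ := EqQuotient.on L2.

Definition fun_of_L2 (f : L2) : T -> C := val (repr f).
Coercion fun_of_L2 : L2 >-> Funclass.

Lemma L2_eqP (f g : L2fun) :
  \pi_L2 f = \pi_L2 g <-> val f = val g %[ae mu].
Proof.
split=> [/eqP|fg].
  rewrite -Quotient.idealrBE inE /=; apply: filterS => x /= + xT => /(_ xT).
  rewrite -[LHS]/(sval f x - sval g x) => /eqP.
  by rewrite subr_eq0 => /eqP.
apply/eqP; rewrite -Quotient.idealrBE inE /=.
apply: filterS fg => x /= + xT => /(_ xT) fg.
by rewrite -[LHS]/(sval f x - sval g x) fg subrr.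
Qed.

Lemma L2_repr (f : L2fun) : (\pi_L2 f : L2) = val f %[ae mu].
Proof. by apply/L2_eqP; rewrite reprK. Qed.

Definition L2scale (a : C) : L2 -> L2 := lift_op1 L2 ( *:%R a).

Lemma pi_L2scale a : {morph \pi_L2 : f / a *: f >-> L2scale a f}.
Proof.
move=> f; unlock L2scale; apply/L2_eqP.
apply: filterS (L2_repr f) => x /= + xT => /(_ xT) fx.
by rewrite -[LHS]/(a * sval f x) -fx.
Qed.
Canonical pi_L2scale_morph a := PiMorph1 (pi_L2scale a).

Lemma L2scaleA a b (f : L2) : L2scale a (L2scale b f) = L2scale (a * b) f.
Proof. by rewrite -[f]reprK !piE scalerA. Qed.

Lemma L2scale1 : left_id 1 L2scale.
Proof. by move=> f; rewrite -[f]reprK !piE scale1r. Qed.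

Lemma L2scaleDr : right_distributive L2scale +%R.
Proof. by move=> a f g; rewrite -[f]reprK -[g]reprK !piE scalerDr. Qed.

Lemma L2scaleDl (f : L2) : {morph L2scale^~ f : a b / a + b}.
Proof. by move=> a b; rewrite -[f]reprK !piE scalerDl. Qed.

HB.instance Definition _ := GRing.Zmodule_isLmodule.Build C L2
  L2scaleA L2scale1 L2scaleDr L2scaleDl.

Definition L2norm (f : L2) : R := fine 'N[mu]_2%:E[EFin \o cabs f]%E.

Lemma L2_square_integrable (f : L2) :
  cmeasurable f /\ finite_norm mu 2%:E (cabs f).
Proof. by have := valP (repr f); rewrite inE. Qed.

Let LnormE (f : L2) : (L2norm f)%:E = 'N[mu]_2%:E[EFin \o cabs f]%E.
Proof.
have [_ ?] := L2_square_integrable f.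
by rewrite fineK// ge0_fin_numE ?Lnorm_ge0.
Qed.

Let Lnorm_ae (f g : T -> C) : cmeasurable f -> cmeasurable g ->
  f = g %[ae mu] ->
  'N[mu]_2%:E[EFin \o cabs f]%E = 'N[mu]_2%:E[EFin \o cabs g]%E.
Proof.
move=> mf mg fg; rewrite unlock; congr (_ `^ _)%E.
apply: ae_eq_integral => //.
- exact/measurable_sq/cmeasurable_cabs.
- exact/measurable_sq/cmeasurable_cabs.
- by apply: filterS fg => x /= + xT => /(_ xT); rewrite /cabs /= => ->.
Qed.

Let L2D (f g : L2) : (f + g : L2) = (f : T -> C) + (g : T -> C) %[ae mu].
Proof.
rewrite (_ : f + g = \pi_L2 (repr f + repr g)); first exact: L2_repr.
by rewrite [RHS]Quotient.pi_add !reprK.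
Qed.

Let L2Z (a : C) (f : L2) : (a *: f : L2) = a *: (f : T -> C) %[ae mu].
Proof.
rewrite (_ : a *: f = \pi_L2 (a *: repr f)); first exact: L2_repr.
by rewrite pi_L2scale reprK.
Qed.

Lemma L2normD (f g : L2) :
  (L2norm (f + g))%:C <= (L2norm f)%:C + (L2norm g)%:C.
Proof.
rewrite -rmorphD/= lecR.
have [mf ff] := L2_square_integrable f.
have [mg fg] := L2_square_integrable g.
rewrite -lee_fin EFinD !LnormE.
rewrite (Lnorm_ae _ _ (L2D f g)); last 2 first.
- by have [] := L2_square_integrable (f + g).
- exact: cmeasurableD.
exact: LnormD_cabs.
Qed.

Lemma L2normZ (a : C) (f : L2) : (L2norm (a *: f))%:C = `|a| * (L2norm f)%:C.
Proof.
rewrite normc_normr -rmorphM/=; congr (_ %:C).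
have [mf ff] := L2_square_integrable f.
apply: EFin_inj; rewrite EFinM !LnormE (Lnorm_ae _ _ (L2Z a f)); last 2 first.
- by have [] := L2_square_integrable (a *: f).
- exact: cmeasurableZ.
rewrite cabsZ LnormZ//; last exact: cmeasurable_cabs.
by rewrite ger0_norm//; case: a => x y; exact: sqrtr_ge0.
Qed.

Lemma L2norm_eq0 (f : L2) : (L2norm f)%:C = 0 -> f = 0.
Proof.
have [mf ff] := L2_square_integrable f; move=> [f0].
have pi0 : \pi_L2 (0 : L2fun) = 0 :> L2.
  by rewrite -(scaler0 _ 0) pi_L2scale; exact: scale0r.
rewrite -[f]reprK -pi0; apply/L2_eqP.
have : (EFin \o cabs f)%E = (\0)%E %[ae mu].
  apply: (@Lnorm_eq0_eq0 _ _ _ _ _ 2%:E); last by rewrite -LnormE f0.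
  - exact/measurable_EFinP/cmeasurable_cabs.
  - by rewrite lte_fin.
by apply: filterS => x /= + xT => /(_ xT) [] /Normc.eq0_normc.
Qed.

HB.instance Definition _ := Lmodule_isNormed.Build C L2
  L2normD L2normZ L2norm_eq0.

End ComplexL2fun.

Section HilbertSpace.
Context {d : measure_display} {T : measurableType d} {R : realType}.
Variable mu : {measure set T -> \bar R}.
Local Notation C := R[i].
Local Notation H := (L2 mu).

(* The class of [h], or 0 if [h] is not square integrable. *)
Definition L2_class (h : T -> C) : H := \pi_H (insubd 0 h).

Definition inner (f g : H) : C := cintegral mu (fun x => f x * (g x)^*).

Definition bounded_operator (A : H -> H) : Prop :=
  linear A /\ exists M : R, forall f, L2norm (A f) <= M * L2norm f.

(* In [R[i]], [0 <= z] says that [z] is real and nonnegative. *)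
Definition positive_operator (A : H -> H) : Prop :=
  forall f, 0 <= inner (A f) f.

(* [get] returns the witness if there is one, the zero map otherwise; an inverse
   is unique, and so is the square root of a bounded positive operator. *)
Definition inverse_operator (A : H -> H) : H -> H :=
  get [set B | [/\ bounded_operator B, cancel A B & cancel B A]].

Definition sqrt_operator (A : H -> H) : H -> H :=
  get [set B | [/\ bounded_operator B, positive_operator B
                & forall f, B (B f) = A f]].

End HilbertSpace.

Fact rV_display : measure_display. Proof. exact. Qed.

Section MeasurableRowVector.
Context {R : realType} (n : nat).

Definition rV_coord (i : 'I_n) (x : 'rV[R]_n) : measurableTypeR R := x ord0 i.

Let rV_set0 : g_sigma_preimage rV_coord set0.
Proof. exact: sigma_algebra0. Qed.

Let rV_setC A : g_sigma_preimage rV_coord A -> g_sigma_preimage rV_coord (~` A).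
Proof. exact: sigma_algebraC. Qed.

Let rV_bigcup (F : _^nat) : (forall i, g_sigma_preimage rV_coord (F i)) ->
  g_sigma_preimage rV_coord (\bigcup_i (F i)).
Proof. exact: sigma_algebra_bigcup. Qed.

HB.instance Definition _ := @isMeasurable.Build rV_display
  'rV[R]_n (g_sigma_preimage rV_coord) rV_set0 rV_setC rV_bigcup.

Lemma measurable_rV_coord (i : 'I_n) : measurable_fun setT (rV_coord i).
Proof.
move=> _ Y mY; rewrite setTI; apply: sub_sigma_algebra => /=.
rewrite -bigcup_seq/=; exists i => /=; first by rewrite mem_index_enum.
by exists Y => //; rewrite setTI.
Qed.

Lemma measurable_fun_rVP d (T : measurableType d) (f : T -> 'rV[R]_n) :
  (forall i, measurable_fun setT (rV_coord i \o f)) -> measurable_fun setT f.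
Proof.
move=> mf _ A mA; rewrite setTI.
suff : g_sigma_preimage (fun i => rV_coord i \o f) `<=` measurable.
  apply; rewrite g_sigma_preimage_comp; exists A => //.
  by rewrite setTI.
apply: smallest_sub; first exact: sigma_algebra_measurable.
rewrite -bigcup_seq; apply: bigcup_sub => i _ B [C mC <-].
exact: mf.
Qed.

End MeasurableRowVector.

Section LebesgueRowVector.
Context {R : realType}.

Definition rV_cons n (p : measurableTypeR R * 'rV[R]_n) : 'rV[R]_n.+1 :=
  row_mx p.1%:M p.2.

Definition rV_uncons n (x : 'rV[R]_n.+1) : measurableTypeR R * 'rV[R]_n :=
  (x ord0 ord0, rsubmx (x : 'rV[R]_(1 + n))).

Lemma rV_cons0 n p : @rV_cons n p ord0 ord0 = p.1.
Proof.
transitivity (lsubmx (row_mx p.1%:M p.2) ord0 ord0).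
  by rewrite [RHS]mxE (_ : lshift n ord0 = ord0) //; exact: val_inj.
by rewrite row_mxKl mxE eqxx.
Qed.

Lemma rV_consS n p i : @rV_cons n p ord0 (lift ord0 i) = p.2 ord0 i.
Proof.
transitivity (rsubmx (row_mx p.1%:M p.2) ord0 i).
  by rewrite [RHS]mxE (_ : rshift 1 i = lift ord0 i) //; exact: val_inj.
by rewrite row_mxKr.
Qed.

Lemma rV_consK n : cancel (@rV_cons n) (@rV_uncons n).
Proof.
move=> [x v]; rewrite /rV_uncons rV_cons0 /rV_cons/=; congr pair.
exact: row_mxKr.
Qed.

Lemma rV_unconsK n : cancel (@rV_uncons n) (@rV_cons n).
Proof.
move=> x; apply/rowP => i.
have [j ->|->] := unliftP ord0 i; last by rewrite rV_cons0.
by rewrite rV_consS mxE; congr (x _ _); exact: val_inj.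
Qed.

Lemma measurable_rV_cons n : measurable_fun setT (@rV_cons n).
Proof.
apply: measurable_fun_rVP => i; have [j ->|->] := unliftP ord0 i.
  rewrite (_ : _ \o _ = rV_coord j \o snd).
    exact: measurableT_comp (measurable_rV_coord j) measurable_snd.
  by apply/funext => p; exact: rV_consS.
rewrite (_ : _ \o _ = fst); first exact: measurable_fst.
by apply/funext => p; exact: rV_cons0.
Qed.

Lemma measurable_rV_uncons n : measurable_fun setT (@rV_uncons n).
Proof.
apply/measurable_fun_pairP; split.
  exact: (measurable_rV_coord ord0).
apply: measurable_fun_rVP => i.
rewrite (_ : _ \o _ = rV_coord (lift ord0 i)); first exact: measurable_rV_coord.
apply/funext => x; rewrite /rV_coord/= !mxE; congr (x _ _); exact/val_inj.
Qed.

Section step.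
Context n (m : {sigma_finite_measure set 'rV[R]_n -> \bar R}).

Definition lebesgue_rV_step : set 'rV[R]_n.+1 -> \bar R :=
  pushforward (lebesgue_measure \x m)%E (@rV_cons n).

Let step0 : lebesgue_rV_step set0 = 0%E.
Proof. by rewrite /lebesgue_rV_step /pushforward preimage_set0 measure0. Qed.

Let step_ge0 A : (0 <= lebesgue_rV_step A)%E.
Proof. exact: (measure_ge0 (lebesgue_measure \x m)%E). Qed.

Let step_sigma_additive : semi_sigma_additive lebesgue_rV_step.
Proof.
pose push := measure_function_pushforward__canonical__measure_function_Measure
  (lebesgue_measure \x m)%E (@measurable_rV_cons n).
exact: (@measure_semi_sigma_additive _ _ _ push).
Qed.

HB.instance Definition _ := isMeasure.Build _ _ _ lebesgue_rV_step
  step0 step_ge0 step_sigma_additive.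

Let step_sigma_finite : sigma_finite setT lebesgue_rV_step.
Proof.
have /sigma_finiteP[F [TF ndF Foo]] := sigma_finiteT (@lebesgue_measure R).
have /sigma_finiteP[G [TG ndG Goo]] := sigma_finiteT m.
exists (fun k => @rV_uncons n @^-1` (F k `*` G k)).
  apply/esym/seteqP; split => // x _.
  have [i _ Fi] : (\bigcup_i F i) (rV_uncons x).1 by rewrite -TF.
  have [j _ Gj] : (\bigcup_j G j) (rV_uncons x).2 by rewrite -TG.
  exists (maxn i j) => //; split.
    by move: Fi; exact/subsetPset/ndF/leq_maxl.
  by move: Gj; exact/subsetPset/ndG/leq_maxr.
move=> k; have [mFk Fk] := Foo k; have [mGk Gk] := Goo k; split.
  by rewrite -[X in measurable X]setTI; apply: measurable_rV_uncons => //;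
    exact: measurableX.
rewrite /lebesgue_rV_step /pushforward -comp_preimage.
rewrite (_ : _ \o _ = id); last by apply/funext => p; exact: rV_consK.
by rewrite product_measure1E// lte_mul_pinfty// ge0_fin_numE.
Qed.

HB.instance Definition _ := Measure_isSigmaFinite.Build _ _ _ lebesgue_rV_step
  step_sigma_finite.

End step.

Fixpoint lebesgue_rV n : {sigma_finite_measure set 'rV[R]_n -> \bar R} :=
  match n with
  | 0 => \d_(0 : 'rV[R]_0)
  | n.+1 => lebesgue_rV_step (lebesgue_rV n)
  end.

Lemma measurable_box n (A : 'I_n -> set (measurableTypeR R)) :
  (forall i, measurable (A i)) ->
  measurable [set x : 'rV[R]_n | forall i, A i (x ord0 i)].
Proof.
move=> mA.
rewrite (_ : mkset _ = \big[setI/setT]_(i < n) (rV_coord i @^-1` A i)).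
  apply: bigsetI_measurable => i _.
  by rewrite -[X in measurable X]setTI; exact: measurable_rV_coord.
rewrite -bigcap_seq; apply/seteqP; split => [x Ax i _|x Ax i]; first exact: Ax.
by have := Ax i; apply; rewrite /= mem_index_enum.
Qed.

Lemma lebesgue_rV_box n (A : 'I_n -> set (measurableTypeR R)) :
  (forall i, measurable (A i)) ->
  lebesgue_rV n [set x | forall i, A i (x ord0 i)] =
  (\prod_(i < n) lebesgue_measure (A i))%E.
Proof.
elim: n A => [A _|n IH A mA].
  by rewrite big_ord0 /= diracE mem_set// => -[].
have mB : measurable [set x : 'rV[R]_n | forall i, A (lift ord0 i) (x ord0 i)].
  by apply: (measurable_box (A := A \o lift ord0)) => i; exact: mA.
rewrite big_ord_recl -(IH (A \o lift ord0)); last by move=> i; exact: mA.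
rewrite -product_measure1E//=.
rewrite /lebesgue_rV_step /pushforward; congr product_measure1.
apply/seteqP; split => [p /= Ap|p /= [A0 Ap] i].
  split=> [|i]; first by have := Ap ord0; rewrite rV_cons0.
  by have := Ap (lift ord0 i); rewrite rV_consS.
have [j ->|->] := unliftP ord0 i; last by rewrite rV_cons0.
by rewrite rV_consS; exact: Ap.
Qed.

End LebesgueRowVector.

Notation L2Rd R d := (L2 (@lebesgue_rV R d)).

Section FunctionSpaces.
Context {R : realType} {d : nat}.
Local Notation C := R[i].
Local Notation lambda := (@lebesgue_rV R d).
Local Notation H := (L2Rd R d).
Implicit Types (x : 'rV[R]_d) (f g h : H).

Definition dot (x y : 'rV[R]_d) : R := \sum_i x ord0 i * y ord0 i.

(* The norm that the library puts on ['rV[R]_d] is the maximum norm. *)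
Definition euclidean_norm x : R := Num.sqrt (dot x x).

Definition partial (i : 'I_d) (u : 'rV[R]_d -> R) : 'rV[R]_d -> R :=
  'D_(delta_mx ord0 i) u.

Definition smooth (u : 'rV[R]_d -> R) : Prop :=
  forall s : seq 'I_d, continuous (foldr partial u s) /\
    forall i x, derivable (foldr partial u s) x (delta_mx ord0 i).

Definition test_function (phi : 'rV[R]_d -> C) : Prop :=
  [/\ smooth (Re \o phi), smooth (Im \o phi) &
      compact (closure [set x | phi x != 0])].

Definition cpartial (i : 'I_d) (phi : 'rV[R]_d -> C) : 'rV[R]_d -> C :=
  fun x => partial i (Re \o phi) x +i* partial i (Im \o phi) x.

Definition distributional_partial (i : 'I_d) f h : Prop :=
  forall phi, test_function phi ->
    cintegral lambda (fun x => f x * cpartial i phi x) =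
    - cintegral lambda (fun x => h x * phi x).

Definition H1 : set H :=
  [set f | forall i, exists h, distributional_partial i f h].

(* A member of the weighted space is automatically in L^2: the weight is at
   least 1. *)
Definition L2_weighted : set H :=
  [set f | (fun x => (1 + euclidean_norm x)%:C * f x)
             \in square_integrable lambda].

Definition HH1 : set H := H1 `&` L2_weighted.

End FunctionSpaces.

Section Gabor.
Context {R : realType} {d : nat}.
Local Notation C := R[i].
Local Notation H := (L2Rd R d).
Implicit Types (f g : H) (l : 'rV[R]_(d + d)) (L : set 'rV[R]_(d + d)).

Definition expi (t : R) : C := cos t +i* sin t.

Definition translation (a : 'rV[R]_d) (u : 'rV[R]_d -> C) : 'rV[R]_d -> C :=
  fun x => u (x - a).

Definition modulation (b : 'rV[R]_d) (u : 'rV[R]_d -> C) : 'rV[R]_d -> C :=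
  fun x => expi (2 * pi * dot b x) * u x.

Definition tf_shift l f : H :=
  L2_class _ (translation (lsubmx l) (modulation (rsubmx l) f)).

Definition is_lattice L : Prop :=
  exists2 A : 'M[R]_(d + d), A \in unitmx &
    L = [set (A *m map_mx intr z)^T | z in [set: 'cV[int]_(d + d)]].

Definition frame_bounds g L (A B : R) : Prop :=
  forall f, ((A * L2norm f ^+ 2)%:E <=
             \esum_(l in L) (normc (inner f (tf_shift l g)) ^+ 2)%:E <=
             (B * L2norm f ^+ 2)%:E)%E.

Definition gabor_frame g L : Prop :=
  exists A B : R, [/\ 0 < A, A <= B & frame_bounds g L A B].

Definition parseval_gabor_frame g L : Prop := frame_bounds g L 1 1.

(* [summability.sum] is the unconditional sum in norm: the limit of the partial
   sums along the finite subsets of the index type. *)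
Definition frame_operator g L : H -> H := fun f =>
  summability.sum (fun l =>
    if l \in L then inner f (tf_shift l g) *: tf_shift l g else 0).

End Gabor.

(* Main.v *)
(* For every time-frequency shift rho and for gamma = S^-1 g or S^(-1/2) g one has
   |rho gamma - gamma| <= K |rho g - g| with K independent of rho. This yields the
   theorem, because f lies in H^1 (in the weighted space) exactly when the
   translates (modulates) of f along every axis depend on the shift in a Lipschitz
   way.

   To compare, write gamma as a power series in T = 1 - S/B applied to g, where
   |T| <= q = 1 - A/B < 1. Let S_{g,h} f be the sum of <f, pi(l) g> pi(l) h. Since
   rho S_{g,h} f = S_{rho g,rho h} rho f, the vector rho T f - T f differs from
   T (rho f - f) by operators S_{u,v} applied to f in which one of the windows is
   rho g - g; the norm of such a vector is controlled by |rho g - g| and the square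
   root of the Bessel bound of (f, Lambda). That bound is at most q^(2n) B for
   f = T^n g, so |rho T^n g - T^n g| decays geometrically in n relative to
   |rho g - g|. *)
Require Import Defs.
From mathcomp Require Import all_boot all_order all_algebra finmap.
From mathcomp Require Import generic_quotient complex.
From mathcomp Require Import all_classical all_reals all_analysis.
From mathcomp Require Import measurable_realfun.
From mathcomp Require Import ring lra.
Set Implicit Arguments.
Unset Strict Implicit.
Unset Printing Implicit Defensive.
Import Order.TTheory GRing.Theory Num.Theory.
Import numFieldNormedType.Exports.
Local Open Scope classical_set_scope.
Local Open Scope ring_scope.
Local Open Scope complex_scope.
Local Open Scope quotient_scope.

(** A shift rho commutes with S only up to an error, unless it belongs to the lattice. With D = rho
    g - g, the commutator is rho S f - S rho f = S_{D,rho g} rho f + S_{g,D} rho f. The obstacle is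
    that a small norm of D says nothing about the Bessel bound of the Gabor system of D, so the
    usual operator norm estimate for S_{D,h} is useless. What helps is that only vectors f with a
    Bessel orbit of their own are fed in: up to a phase, <f, pi(l) D> is <D, pi(-l) f>, so vector
    and window exchange roles and D enters through its norm alone. This settles S_{D,h}. In S_{g,D}
    the difference sits on the synthesis side; there the lower frame bound converts the norm into
    coefficients against the orbit of g, to which the same exchange applies. This is why the powers
    T^n g are followed one by one: each has an explicit Bessel bound, whereas a direct estimate of
    S^-1 g would require the bound sought. *)

Local Notation Re := (@complex.Re _).
Local Notation Im := (@complex.Im _).
Local Notation normc := (@Normc.normc _).

(** * Modulus, real and imaginary part of complex numbers *)

Section ComplexModulus.
Context {R : realType}.
Implicit Types z w : R[i].

Lemma complexP z w : Re z = Re w -> Im z = Im w -> z = w.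
Proof. by case: z => a b; case: w => c e /= -> ->. Qed.

Lemma sqr_normcE z : normc z ^+ 2 = Re z ^+ 2 + Im z ^+ 2.
Proof. by case: z => a b /=; rewrite sqr_sqrtr// addr_ge0// sqr_ge0. Qed.

Lemma normc_ge0 z : 0 <= normc z.
Proof. by case: z => a b /=; exact: sqrtr_ge0. Qed.

Lemma normc_conj z : normc z^* = normc z.
Proof. by case: z => a b /=; rewrite sqrrN. Qed.

Lemma normc_real (x : R) : normc x%:C = `|x|.
Proof. by rewrite /= expr0n/= addr0 sqrtr_sqr. Qed.

Lemma normc_ge_absRe z : `|Re z| <= normc z.
Proof.
case: z => a b /=; rewrite -sqrtr_sqr ler_wsqrtr// lerDl sqr_ge0//.
Qed.

Lemma normc_ge_absIm z : `|Im z| <= normc z.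
Proof.
case: z => a b /=; rewrite -sqrtr_sqr ler_wsqrtr// lerDr sqr_ge0//.
Qed.

Lemma normc_le_ReIm z : normc z <= `|Re z| + `|Im z|.
Proof.
rewrite -(@ler_pXn2r _ 2) ?nnegrE ?normc_ge0 ?addr_ge0//.
rewrite sqr_normcE -(real_normK (num_real (Re z))).
rewrite -(real_normK (num_real (Im z))).
have := normr_ge0 (Re z); have := normr_ge0 (Im z); nra.
Qed.

Lemma mul_conjcE z : z * z^* = (normc z ^+ 2)%:C.
Proof.
by rewrite sqr_normcE; case: z => a b; apply: complexP => /=; ring.
Qed.

Lemma normc_opp z : normc (- z) = normc z.
Proof. by case: z => a b /=; rewrite !sqrrN. Qed.

Lemma ReM z w : Re (z * w) = Re z * Re w - Im z * Im w.
Proof. by case: z; case: w. Qed.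

Lemma ImM z w : Im (z * w) = Re z * Im w + Im z * Re w.
Proof. by case: z => a b; case: w. Qed.

Lemma conjc_realE (x : R) : (x%:C)^* = x%:C.
Proof. by apply: complexP; rewrite /= ?oppr0. Qed.

Lemma Re_conj z : Re z^* = Re z. Proof. by case: z. Qed.

Lemma Im_conj z : Im z^* = - Im z. Proof. by case: z. Qed.

End ComplexModulus.

(** * Complex integrals and square integrable functions *)

Section ComplexIntegral.
Context {d : measure_display} {T : measurableType d} {R : realType}.
Variable mu : {measure set T -> \bar R}.
Local Notation C := R[i].
Local Notation sqi := (square_integrable mu).
Local Notation cint := (cintegral mu).
Implicit Types u v w : T -> C.

Definition cintegrable u :=
  mu.-integrable setT (EFin \o (Re \o u)) /\
  mu.-integrable setT (EFin \o (Im \o u)).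

Lemma Lnorm2_lty (f : T -> R) :
  ('N[mu]_2%:E[EFin \o f] < +oo)%E =
  (\int[mu]_x ((f x) ^+ 2)%:E < +oo)%E.
Proof.
rewrite unlock.
have -> : (\int[mu]_x (`|(EFin \o f) x| `^ 2) = \int[mu]_x ((f x) ^+ 2)%:E)%E.
  apply: eq_integral => x _ /=.
  by rewrite powR_mulrn// -normrX ger0_norm ?sqr_ge0.
apply/idP/idP; last exact: poweR_lty.
by apply: lty_poweRy; rewrite invr_eq0.
Qed.

Lemma sqiP u : u \in sqi <->
  cmeasurable u /\ (\int[mu]_x ((normc (u x)) ^+ 2)%:E < +oo)%E.
Proof.
by rewrite inE /= /finite_norm Lnorm2_lty.
Qed.

Lemma sqi_measurable u : u \in sqi -> cmeasurable u.
Proof. by case/sqiP. Qed.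

Lemma measurable_normc u : cmeasurable u ->
  measurable_fun setT (fun x => normc (u x)).
Proof. exact: cmeasurable_cabs. Qed.

Lemma sqi_normc_integrable u : u \in sqi ->
  mu.-integrable setT (fun x => ((normc (u x)) ^+ 2)%:E).
Proof.
move=> /sqiP[mu_ iu]; apply/integrableP; split.
  by apply/measurable_EFinP; apply: measurable_funX; exact: measurable_normc.
apply: le_lt_trans iu; apply: ge0_le_integral => //.
- by apply/measurable_EFinP; apply: measurableT_comp => //; apply: measurable_funX;
    exact: measurable_normc.
- by apply/measurable_EFinP; apply: measurable_funX; exact: measurable_normc.
- by move=> x _; rewrite /= ger0_norm ?sqr_ge0.
Qed.

Lemma cmeasurableM u v : cmeasurable u -> cmeasurable v ->
  cmeasurable (fun x => u x * v x).
Proof.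
move=> [ur ui] [vr vi]; split.
- rewrite (_ : _ \o _ = (Re \o u) \* (Re \o v) \- (Im \o u) \* (Im \o v)).
    by apply: measurable_funB; apply: measurable_funM.
  by apply/funext => x /=; rewrite ReM.
- rewrite (_ : _ \o _ = (Re \o u) \* (Im \o v) \+ (Im \o u) \* (Re \o v)).
    by apply: measurable_funD; apply: measurable_funM.
  by apply/funext => x /=; rewrite ImM.
Qed.

Lemma cmeasurable_conj u : cmeasurable u -> cmeasurable (fun x => (u x)^*).
Proof.
move=> [ur ui]; split.
- by rewrite (_ : _ \o _ = Re \o u)//; apply/funext => x /=; rewrite Re_conj.
- rewrite (_ : _ \o _ = \- (Im \o u)); first exact: measurable_funN.
  by apply/funext => x /=; rewrite Im_conj.
Qed.

Lemma cintegrable_le u (g : T -> R) : cmeasurable u ->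
  mu.-integrable setT (EFin \o g) -> (forall x, normc (u x) <= g x) ->
  cintegrable u.
Proof.
move=> [ur ui] ig ug; split; apply: (le_integrable _ _ _ ig) => //.
- exact/measurable_EFinP.
- move=> x _ /=; rewrite lee_fin (le_trans (normc_ge_absRe _))//.
  by rewrite (le_trans (ug x))// ler_norm.
- exact/measurable_EFinP.
- move=> x _ /=; rewrite lee_fin (le_trans (normc_ge_absIm _))//.
  by rewrite (le_trans (ug x))// ler_norm.
Qed.

Lemma sqi_mul_integrable u v : u \in sqi -> v \in sqi ->
  cintegrable (fun x => u x * v x).
Proof.
move=> su sv; pose g x := normc (u x) ^+ 2 + normc (v x) ^+ 2.
apply: (@cintegrable_le _ g).
- by apply: cmeasurableM; exact: sqi_measurable.
- rewrite (_ : _ \o _ = (fun x => (normc (u x) ^+ 2)%:E) \+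
                        (fun x => (normc (v x) ^+ 2)%:E))%E//.
  by apply: integrableD => //; exact: sqi_normc_integrable.
- move=> x; rewrite Normc.normcM /g.
  have := sqr_ge0 (normc (u x) - normc (v x)).
  have := normc_ge0 (u x); have := normc_ge0 (v x); nra.
Qed.

Lemma sqi_conj u : u \in sqi -> (fun x => (u x)^*) \in sqi.
Proof.
move=> /sqiP[mu_ iu]; apply/sqiP; split; first exact: cmeasurable_conj.
by under eq_integral do rewrite normc_conj.
Qed.

Lemma sqiD u v : u \in sqi -> v \in sqi -> (fun x => u x + v x) \in sqi.
Proof.
move=> su sv.
have [_ h] := square_integrable_submod_closed mu.
rewrite (_ : (fun _ => _) = 1 *: u + v); first exact: h.
by apply/funext => x; rewrite /GRing.scale/= /GRing.add/= /GRing.scale/= mul1r.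
Qed.

Lemma sqiZ a u : u \in sqi -> (fun x => a * u x) \in sqi.
Proof.
move=> su.
have [h0 h] := square_integrable_submod_closed mu.
rewrite (_ : (fun _ => _) = a *: u + 0); first exact: h.
by rewrite addr0.
Qed.

Lemma sqiB u v : u \in sqi -> v \in sqi -> (fun x => u x - v x) \in sqi.
Proof.
move=> su sv; rewrite (_ : (fun _ => _) = (fun x => u x + (-1) * v x)).
  by apply: sqiD => //; exact: sqiZ.
by apply/funext => x; rewrite mulN1r.
Qed.

Lemma sqi_le u v : cmeasurable u -> v \in sqi ->
  (forall x, normc (u x) <= normc (v x)) -> u \in sqi.
Proof.
move=> mu_ /sqiP[mv iv] uv; apply/sqiP; split => //.
apply: le_lt_trans iv; apply: ge0_le_integral => //.
- by move=> x _; rewrite lee_fin sqr_ge0.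
- by apply/measurable_EFinP; apply: measurable_funX; exact: measurable_normc.
- by apply/measurable_EFinP; apply: measurable_funX; exact: measurable_normc.
- move=> x _; rewrite lee_fin ler_pXn2r ?nnegrE ?normc_ge0//.
Qed.

Lemma eq_cintegral u v : (forall x, u x = v x) -> cint u = cint v.
Proof. by move=> uv; congr cintegral; apply/funext. Qed.

Lemma cintegralD u v : cintegrable u -> cintegrable v ->
  cint (fun x => u x + v x) = cint u + cint v.
Proof.
move=> [ur ui] [vr vi]; apply: complexP; rewrite ?ReD ?ImD /=.
- rewrite -RintegralD//; apply: eq_Rintegral => x _; exact: ReD.
- rewrite -RintegralD//; apply: eq_Rintegral => x _; exact: ImD.
Qed.

Lemma cintegralZ a u : cintegrable u -> cint (fun x => a * u x) = a * cint u.
Proof.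
move=> [ur ui]; apply: complexP; rewrite ?ReM ?ImM /=.
- rewrite -!RintegralZl// -RintegralB//; first last.
  - by apply: (integrableZl measurableT (Im a) ui).
  - by apply: (integrableZl measurableT (Re a) ur).
  by apply: eq_Rintegral => x _; exact: ReM.
- rewrite -!RintegralZl// -RintegralD//; first last.
  - by apply: (integrableZl measurableT (Im a) ur).
  - by apply: (integrableZl measurableT (Re a) ui).
  by apply: eq_Rintegral => x _; exact: ImM.
Qed.

Lemma cintegral_conj u : cintegrable u ->
  cint (fun x => (u x)^*) = (cint u)^*.
Proof.
move=> [ur ui]; apply: complexP; rewrite ?Re_conj ?Im_conj /=.
- by apply: eq_Rintegral => x _; exact: Re_conj.
- rewrite -mulN1r -RintegralZl//.
  by apply: eq_Rintegral => x _; rewrite mulN1r; exact: Im_conj.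
Qed.

Lemma cintegral_ae u v : cmeasurable u -> cmeasurable v -> u = v %[ae mu] ->
  cint u = cint v.
Proof.
move=> [ur ui] [vr vi] uv; apply: complexP => /=; congr fine.
- apply: ae_eq_integral => //; [exact/measurable_EFinP|exact/measurable_EFinP|].
  by apply: filterS uv => x /= + xT => /(_ xT) ->.
- apply: ae_eq_integral => //; [exact/measurable_EFinP|exact/measurable_EFinP|].
  by apply: filterS uv => x /= + xT => /(_ xT) ->.
Qed.

End ComplexIntegral.

(** * The inner product on classes of functions *)

Section HilbertStructure.
Context {d : measure_display} {T : measurableType d} {R : realType}.
Variable mu : {measure set T -> \bar R}.
Local Notation C := R[i].
Local Notation sqi := (square_integrable mu).
Local Notation H := (L2 mu).
Implicit Types (f g h : H) (a : C).

Lemma L2_sqi f : (f : T -> C) \in sqi.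
Proof. exact: valP (repr f). Qed.

Lemma L2_classE (u : T -> C) : u \in sqi -> L2_class mu u = u %[ae mu].
Proof.
move=> su; rewrite /L2_class; apply: (ae_eq_trans (L2_repr _)).
by rewrite val_insubd su; exact: ae_eq_refl.
Qed.

Lemma L2_extP f g : f = g <-> (f : T -> C) = g %[ae mu].
Proof.
split=> [->|fg]; first exact: ae_eq_refl.
have /L2_eqP : val (repr f) = val (repr g) %[ae mu] by [].
by rewrite !reprK.
Qed.

Lemma L2_classP (u : T -> C) f : u \in sqi -> u = f %[ae mu] -> L2_class mu u = f.
Proof.
move=> su uf; apply/L2_extP; exact: ae_eq_trans (L2_classE su) uf.
Qed.

Lemma L2_addE f g : (f + g : H) = (fun x => f x + g x) %[ae mu].
Proof.
rewrite (_ : f + g = \pi_H (repr f + repr g)); first exact: L2_repr.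
by rewrite [RHS]Quotient.pi_add !reprK.
Qed.

Lemma L2_scaleE a f : (a *: f : H) = (fun x => a * f x) %[ae mu].
Proof.
rewrite (_ : a *: f = \pi_H (a *: repr f)); first exact: L2_repr.
by rewrite pi_L2scale reprK.
Qed.

Lemma L2_subE f g : (f - g : H) = (fun x => f x - g x) %[ae mu].
Proof.
rewrite -scaleN1r.
apply: filterS2 (L2_addE f (-1 *: g)) (L2_scaleE (-1) g) => x /= h1 h2 xT.
by rewrite h1// h2// mulN1r.
Qed.

Lemma L2_classD (u v : T -> C) : u \in sqi -> v \in sqi ->
  L2_class mu (fun x => u x + v x) = L2_class mu u + L2_class mu v.
Proof.
move=> su sv; apply: L2_classP; first exact: sqiD.
apply: ae_eq_sym; apply: ae_eq_trans (L2_addE _ _) _.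
by apply: filterS2 (L2_classE su) (L2_classE sv) => x /= h1 h2 xT; rewrite h1// h2.
Qed.

Lemma L2_classB (u v : T -> C) : u \in sqi -> v \in sqi ->
  L2_class mu (fun x => u x - v x) = L2_class mu u - L2_class mu v.
Proof.
move=> su sv; apply: L2_classP; first exact: sqiB.
apply: ae_eq_sym; apply: ae_eq_trans (L2_subE _ _) _.
by apply: filterS2 (L2_classE su) (L2_classE sv) => x /= h1 h2 xT; rewrite h1// h2.
Qed.

Lemma L2_classZ a (u : T -> C) : u \in sqi ->
  L2_class mu (fun x => a * u x) = a *: L2_class mu u.
Proof.
move=> su; apply: L2_classP; first exact: sqiZ.
apply: ae_eq_sym; apply: ae_eq_trans (L2_scaleE _ _) _.
by apply: filterS (L2_classE su) => x /= h1 xT; rewrite h1.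
Qed.

Lemma inner_ae f g (u v : T -> C) : u \in sqi -> v \in sqi ->
  (f : T -> C) = u %[ae mu] -> (g : T -> C) = v %[ae mu] ->
  inner f g = cintegral mu (fun x => u x * (v x)^*).
Proof.
move=> su sv fu gv; apply: cintegral_ae.
- by apply: cmeasurableM; last apply: cmeasurable_conj; apply: sqi_measurable (L2_sqi _).
- apply: cmeasurableM; first exact: sqi_measurable su.
  exact: cmeasurable_conj (sqi_measurable sv).
- by apply: filterS2 fu gv => x /= h1 h2 xT; rewrite h1// h2.
Qed.

Lemma inner_integrable (u v : T -> C) : u \in sqi -> v \in sqi ->
  cintegrable mu (fun x => u x * (v x)^*).
Proof. by move=> su sv; apply: sqi_mul_integrable => //; exact: sqi_conj. Qed.

Lemma innerDl f g h : inner (f + g) h = inner f h + inner g h.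
Proof.
rewrite (@inner_ae _ _ (fun x => f x + g x) h _ _ (L2_addE f g))//; first last.
- exact: ae_eq_refl.
- exact: L2_sqi.
- by apply: sqiD; exact: L2_sqi.
rewrite -cintegralD; try by apply: inner_integrable; exact: L2_sqi.
by apply: eq_cintegral => x; rewrite mulrDl.
Qed.

Lemma innerZl a f h : inner (a *: f) h = a * inner f h.
Proof.
rewrite (@inner_ae _ _ (fun x => a * f x) h _ _ (L2_scaleE a f))//; first last.
- exact: ae_eq_refl.
- exact: L2_sqi.
- by apply: sqiZ; exact: L2_sqi.
rewrite -cintegralZ; last by apply: inner_integrable; exact: L2_sqi.
by apply: eq_cintegral => x; rewrite mulrA.
Qed.

Lemma innerC f g : inner g f = (inner f g)^*.
Proof.
rewrite -cintegral_conj; last by apply: inner_integrable; exact: L2_sqi.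
by apply: eq_cintegral => x; rewrite rmorphM /= conjcK mulrC.
Qed.

Lemma innerDr f g h : inner h (f + g) = inner h f + inner h g.
Proof. by rewrite innerC innerDl rmorphD; congr (_ + _); exact/esym/innerC. Qed.

Lemma innerZr a f h : inner h (a *: f) = conjc a * inner h f.
Proof. by rewrite innerC innerZl rmorphM; congr (_ * _); exact/esym/innerC. Qed.

Lemma L2norm_ge0 f : 0 <= L2norm f.
Proof. by rewrite fine_ge0// Lnorm_ge0. Qed.

Lemma sqr_L2normE f :
  ((L2norm f ^+ 2)%:E = \int[mu]_x ((normc (f x)) ^+ 2)%:E)%E.
Proof.
have /sqiP[mf ff] := L2_sqi f.
have : finite_norm mu 2%:E (cabs f) by rewrite /finite_norm Lnorm2_lty.
rewrite /finite_norm => fN.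
rewrite /L2norm EFin_expe fineK ?ge0_fin_numE ?Lnorm_ge0//.
have N0 := Lnorm_ge0 mu 2%:E (EFin \o cabs f).
have Nf : 'N[mu]_2%:E[EFin \o cabs f]%E \is a fin_num by rewrite ge0_fin_numE.
rewrite -(fineK Nf) -EFin_expe -powR_mulrn ?fine_ge0// -poweR_EFin fineK//.
rewrite poweR_Lnorm//.
apply: eq_integral => x _ /=.
by rewrite powR_mulrn// -normrX ger0_norm ?sqr_ge0.
Qed.

Lemma inner_norm f : inner f f = (L2norm f ^+ 2)%:C.
Proof.
apply: complexP => /=.
- apply: EFin_inj; rewrite sqr_L2normE -[LHS]/((fine _)%:E) fineK.
    apply: eq_integral => x _; congr EFin.
    by rewrite /= mul_conjcE.
  have [+ _] := inner_integrable (L2_sqi f) (L2_sqi f).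
  by move=> /integrable_fin_num; apply.
- rewrite -[RHS](@Rintegral_set0 _ _ _ mu (fun=> 0)).
  rewrite -[LHS]/(Rintegral mu setT (fun x => Im (f x * (f x)^*))).
  under eq_Rintegral do rewrite mul_conjcE /=.
  by rewrite Rintegral_set0 /Rintegral integral0.
Qed.

Lemma L2norm_class_lte (u : T -> C) (M : R) : 0 <= M -> u \in sqi ->
  (\int[mu]_x ((normc (u x)) ^+ 2)%:E <= (M ^+ 2)%:E)%E ->
  L2norm (L2_class mu u) <= M.
Proof.
move=> M0 su uM; rewrite -(@ler_pXn2r _ 2) ?nnegrE ?L2norm_ge0// -lee_fin.
rewrite sqr_L2normE; apply: le_trans uM; rewrite le_eqVlt; apply/orP; left.
apply/eqP; apply: ae_eq_integral => //.
- by apply/measurable_EFinP; apply: measurable_funX; apply: measurable_normc;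
    apply: sqi_measurable (L2_sqi _).
- by apply/measurable_EFinP; apply: measurable_funX; apply: measurable_normc;
    apply: sqi_measurable su.
- by apply: filterS (L2_classE su) => x /= + xT => /(_ xT) ->.
Qed.

Lemma L2norm_class (u : T -> C) : u \in sqi ->
  ((L2norm (L2_class mu u) ^+ 2)%:E = \int[mu]_x ((normc (u x)) ^+ 2)%:E)%E.
Proof.
move=> su; rewrite sqr_L2normE; apply: ae_eq_integral => //.
- by apply/measurable_EFinP; apply: measurable_funX; apply: measurable_normc;
    apply: sqi_measurable (L2_sqi _).
- by apply/measurable_EFinP; apply: measurable_funX; apply: measurable_normc;
    apply: sqi_measurable su.
- by apply: filterS (L2_classE su) => x /= + xT => /(_ xT) ->.
Qed.

End HilbertStructure.

(** * Cauchy-Schwarz and the norm of L^2 *)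

Section HilbertNorm.
Context {d : measure_display} {T : measurableType d} {R : realType}.
Variable mu : {measure set T -> \bar R}.
Local Notation C := R[i].
Local Notation H := (L2 mu).
Implicit Types (f g h : H) (a : C).

Lemma inner0l f : inner 0 f = 0 :> C.
Proof. by rewrite -(scale0r 0) innerZl mul0r. Qed.

Lemma inner0r f : inner f 0 = 0 :> C.
Proof. by rewrite innerC inner0l conjc0. Qed.

Lemma innerNl f g : inner (- f) g = - inner f g.
Proof. by rewrite -scaleN1r innerZl mulN1r. Qed.

Lemma innerNr f g : inner f (- g) = - inner f g.
Proof. by rewrite innerC innerNl rmorphN; congr (- _); exact/esym/innerC. Qed.

Lemma innerBl f g h : inner (f - g) h = inner f h - inner g h.
Proof. by rewrite innerDl innerNl. Qed.

Lemma innerBr f g h : inner h (f - g) = inner h f - inner h g.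
Proof. by rewrite innerDr innerNr. Qed.

Lemma inner_suml (I : Type) (r : seq I) (F : I -> H) g :
  inner (\sum_(i <- r) F i) g = \sum_(i <- r) inner (F i) g.
Proof.
apply: (big_morph (fun f => inner f g)); last exact: inner0l.
by move=> ? ?; exact: innerDl.
Qed.

Lemma inner_sumr (I : Type) (r : seq I) (F : I -> H) g :
  inner g (\sum_(i <- r) F i) = \sum_(i <- r) inner g (F i).
Proof.
apply: (big_morph (fun f => inner g f)); last exact: inner0r.
by move=> ? ?; exact: innerDr.
Qed.

Lemma sqr_L2norm f : L2norm f ^+ 2 = Re (inner f f).
Proof. by rewrite inner_norm. Qed.

Lemma normc_innerC f g : normc (inner g f) = normc (inner f g).
Proof. by rewrite innerC normc_conj. Qed.

Lemma L2norm_triangle f g : L2norm (f + g) <= L2norm f + L2norm g.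
Proof. by have := L2normD f g; rewrite -rmorphD lecR. Qed.

Lemma L2norm_scale a f : L2norm (a *: f) = normc a * L2norm f.
Proof.
by have := L2normZ a f; rewrite normc_normr -rmorphM => /complexI.
Qed.

Lemma L2norm0 : L2norm (0 : H) = 0.
Proof. by rewrite -(scale0r 0) L2norm_scale Normc.normc0 mul0r. Qed.

Lemma L2norm_opp f : L2norm (- f) = L2norm f.
Proof. by rewrite -scaleN1r L2norm_scale normc_opp Normc.normc1 mul1r. Qed.

Lemma L2norm_distC f g : L2norm (f - g) = L2norm (g - f).
Proof. by rewrite -L2norm_opp opprB. Qed.

Lemma L2norm_triangleB f g : L2norm (f - g) <= L2norm f + L2norm g.
Proof. by rewrite (le_trans (L2norm_triangle _ _))// L2norm_opp. Qed.

Lemma L2norm_dist_trans f g h :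
  L2norm (f - h) <= L2norm (f - g) + L2norm (g - h).
Proof. by rewrite (le_trans _ (L2norm_triangle _ _))// addrA subrK. Qed.

Lemma L2norm_sum (I : Type) (r : seq I) (F : I -> H) :
  L2norm (\sum_(i <- r) F i) <= \sum_(i <- r) L2norm (F i).
Proof.
elim: r => [|i r IH]; first by rewrite !big_nil L2norm0.
rewrite !big_cons; apply: le_trans (L2norm_triangle _ _) _.
by rewrite lerD2l.
Qed.

Lemma L2norm_eq0P f : L2norm f = 0 -> f = 0.
Proof. by move=> f0; apply: L2norm_eq0; rewrite f0. Qed.

Lemma L2norm_small_eq0 f : (forall e, 0 < e -> L2norm f <= e) -> f = 0.
Proof.
move=> fe; apply: L2norm_eq0P; apply/eqP; rewrite eq_le L2norm_ge0 andbT.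
by apply/ler_addgt0Pr => e e0; rewrite add0r; exact: fe.
Qed.

(** An arbitrary nonnegative hermitian form is allowed because the inequality is needed twice: for
    the inner product, and for the form <T f, g> in [relaxation_contraction]. *)
Lemma form_cauchy_schwarz (s : H -> H -> C) :
  (forall f g h, s (f + g) h = s f h + s g h) ->
  (forall a f h, s (a *: f) h = a * s f h) ->
  (forall f g, s g f = (s f g)^*) -> (forall f, 0 <= s f f) ->
  forall f g, normc (s f g) ^+ 2 <= Re (s f f) * Re (s g g).
Proof.
move=> sD sZ sC s0 f g.
have sDr u v w : s w (u + v) = s w u + s w v.
  by rewrite sC sD rmorphD; congr (_ + _); exact/esym/sC.
have sZr a u w : s w (a *: u) = conjc a * s w u.
  by rewrite sC sZ rmorphM; congr (_ * _); exact/esym/sC.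
set z := s f g; set p := Re (s f f); set q := Re (s g g).
have sre u : 0 <= Re (s u u) /\ Im (s u u) = 0.
  by move: (s0 u); rewrite lecE => /andP[/eqP/= <- ->].
have key (t : R) : 0 <= p - 2 * t * normc z ^+ 2 + t ^+ 2 * normc z ^+ 2 * q.
  have [+ _] := sre (f + (- (t%:C * z)) *: g).
  rewrite !(sD, sDr, sZ, sZr) [s g f]sC -/z.
  have [_ gi] := sre g.
  rewrite sqr_normcE /p /q; move: gi; case: z => a b; case: (s f f) => x y.
  case: (s g g) => v w /= -> h; apply: le_trans h _; rewrite le_eqVlt.
  by apply/orP; left; apply/eqP; ring.
have p0 : 0 <= p by have [] := sre f.
have : 0 <= q by have [] := sre g.
have n0 := sqr_ge0 (normc z).
(* If q > 0, the value t = 1/q gives the claim. If q = 0 and z is nonzero, t is chosen so that [key]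
   would read 0 <= p - (p + 1). *)
rewrite le_eqVlt => /orP[/eqP q0|q0].
  rewrite -q0 mulr0; rewrite leNgt; apply/negP => z0.
  have zn0 : normc z != 0 by apply: contraTneq z0 => ->; rewrite expr0n ltxx.
  have := key ((p + 1) / (2 * normc z ^+ 2)).
  rewrite -q0 mulr0 addr0.
  rewrite (_ : 2 * _ * _ = p + 1); last by field.
  by rewrite opprD addrA subrr add0r oppr_ge0 ler10.
have := key q^-1.
rewrite (_ : _ + _ = p - normc z ^+ 2 / q); last by field; rewrite gt_eqF.
by rewrite subr_ge0 ler_pdivrMr.
Qed.

Lemma cauchy_schwarz f g : normc (inner f g) <= L2norm f * L2norm g.
Proof.
rewrite -(@ler_pXn2r _ 2) ?nnegrE ?normc_ge0 ?mulr_ge0 ?L2norm_ge0//.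
rewrite exprMn !sqr_L2norm.
apply: (form_cauchy_schwarz (s := @inner _ _ _ mu)).
- by move=> *; exact: innerDl.
- by move=> *; exact: innerZl.
- by move=> *; exact: innerC.
- by move=> k; rewrite inner_norm ler0c sqr_ge0.
Qed.

Lemma parallelogram f g :
  L2norm (f + g) ^+ 2 + L2norm (f - g) ^+ 2 =
  2 * (L2norm f ^+ 2 + L2norm g ^+ 2).
Proof.
rewrite !sqr_L2norm !(innerDl, innerDr, innerNl, innerNr) !(ReD).
by case: (inner f f) (inner g g) (inner f g) (inner g f)
  => [a b] [a1 b1] [a2 b2] [a3 b3] /=; ring.
Qed.

End HilbertNorm.

(** * Completeness of L^2 *)

Lemma geometric_step_cvg {R : realType} (a : nat -> R) (C : R) :
  (forall n, `|a n.+1 - a n| <= C * (2^-1) ^+ n) -> cvgn a.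
Proof.
move=> aC.
have -> : a = (fun n => a 0%N + series (telescope a) n).
  by apply/funext => n; rewrite telescopeK/= addrC subrK.
apply: is_cvgD; first exact: is_cvg_cst.
apply: normed_cvg.
apply: (@series_le_cvg _ _ (geometric C 2^-1)) => //.
- by move=> n /=.
- by move=> n; exact: le_trans (aC n).
- by apply: is_cvg_geometric_series; rewrite ger0_norm ?invf_lt1 ?ltr1n.
Qed.

Section Completeness.
Context {d : measure_display} {T : measurableType d} {R : realType}.
Variable mu : {measure set T -> \bar R}.
Local Notation C := R[i].
Local Notation sqi := (square_integrable mu).
Local Notation H := (L2 mu).

(** Fatou's lemma for the squared moduli: a uniform L^2 bound survives pointwise limits without a
    dominating function. It serves completeness, and later the limit of difference quotients of
    modulations. *)
Lemma sqi_fatou (v_ : nat -> T -> C) (v : T -> C) (M : R) :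
  (forall n, cmeasurable (v_ n)) -> 
  (forall x, (fun n => Re (v_ n x)) @ \oo --> Re (v x)) ->
  (forall x, (fun n => Im (v_ n x)) @ \oo --> Im (v x)) ->
  (forall n, (\int[mu]_x ((normc (v_ n x)) ^+ 2)%:E <= M%:E)%E) ->
  cmeasurable v /\ (\int[mu]_x ((normc (v x)) ^+ 2)%:E <= M%:E)%E.
Proof.
move=> mv vr vi vM; split.
  split.
  - apply: (@measurable_fun_cvg _ _ _ setT (fun n => Re \o v_ n)) => [n|x _];
      by [case: (mv n)|exact: vr].
  - apply: (@measurable_fun_cvg _ _ _ setT (fun n => Im \o v_ n)) => [n|x _];
      by [case: (mv n)|exact: vi].
have cv x : (fun n => ((normc (v_ n x)) ^+ 2)%:E) @ \oo --> ((normc (v x)) ^+ 2)%:E.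
  apply: cvg_EFin; first by apply: nearW.
  rewrite [fine \o _](_ : _ = (fun n => Re (v_ n x) ^+ 2 + Im (v_ n x) ^+ 2)); last first.
    by apply/funext => n /=; rewrite sqr_normcE.
  rewrite sqr_normcE; apply: cvgD.
  - by rewrite expr2; apply: cvgM.
  - by rewrite expr2; apply: cvgM.
have -> : (\int[mu]_x ((normc (v x)) ^+ 2)%:E =
  \int[mu]_x limn_einf (fun n => ((normc (v_ n x)) ^+ 2)%:E))%E.
  apply: eq_integral => x _; rewrite is_cvg_limn_einfE; last first.
    by apply/cvg_ex; eexists; exact: cv.
  by apply/esym/cvg_lim => //; exact: cv.
apply: le_trans.
  apply: fatou => //.
  - move=> n; apply/measurable_EFinP; apply: measurable_funX.
    exact: measurable_normc.
  - by move=> n x _; rewrite lee_fin sqr_ge0.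
rewrite limn_einf_lim; apply: lime_le.
  exact: is_cvg_einfs.
apply: nearW => n; rewrite /einfs/=; apply: le_trans (vM n).
by apply: ereal_inf_lbound; exists n => /=.
Qed.

Lemma L2_limit_of_pointwise (v_ : nat -> T -> C) (v : T -> C) (e : R^nat) :
  (forall n, v_ n \in sqi) -> 
  (forall x, (fun n => Re (v_ n x)) @ \oo --> Re (v x)) ->
  (forall x, (fun n => Im (v_ n x)) @ \oo --> Im (v x)) ->
  (forall n, 0 <= e n) ->
  (forall n m, (n <= m)%N -> L2norm (L2_class mu (v_ m) - L2_class mu (v_ n)) <= e n) ->
  exists f : H, forall n, L2norm (f - L2_class mu (v_ n)) <= e n.
Proof.
move=> sv vr vi e0 ve.
(* Fatou in m for fixed n; the index m + n makes the hypothesis on ordered pairs available for every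
   m. *)
have main n : cmeasurable (fun x => v x - v_ n x) /\
    (\int[mu]_x ((normc (v x - v_ n x)) ^+ 2)%:E <= (e n ^+ 2)%:E)%E.
  apply: (@sqi_fatou (fun m x => v_ (m + n)%N x - v_ n x)).
  - by move=> m; apply: (sqi_measurable (sqiB (sv _) (sv _))).
  - move=> x; rewrite ReD; under eq_fun do rewrite ReD.
    by apply: cvgD; [rewrite (cvg_shiftn n (fun m => Re (v_ m x)))|exact: cvg_cst].
  - move=> x; rewrite ImD; under eq_fun do rewrite ImD.
    by apply: cvgD; [rewrite (cvg_shiftn n (fun m => Im (v_ m x)))|exact: cvg_cst].
  - move=> m; have /(ve _ _) := leq_addl m n.
    have sB := sqiB (sv (m + n)%N) (sv n).
    rewrite -L2norm_class//.
    rewrite L2_classB// => h.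
    by rewrite lee_fin ler_pXn2r ?nnegrE ?L2norm_ge0.
have svB n : (fun x => v x - v_ n x) \in sqi.
  by have [? h] := main n; apply/sqiP; split => //; apply: le_lt_trans h _; rewrite ltry.
have sv0 : v \in sqi.
  rewrite (_ : v = (fun x => (v x - v_ 0%N x) + v_ 0%N x)).
    by apply: sqiD.
  by apply/funext => x; rewrite subrK.
exists (L2_class mu v) => n.
rewrite -L2_classB//; apply: L2norm_class_lte => //.
by have [] := main n.
Qed.

(** With [D n] the squared step, the weighted sum G of 4^n [D n] has integral at most the sum of 4^n
    16^-n, which is finite. Where G is finite, each step is at most sqrt(G) 2^-n, so the sequence
    converges pointwise. The rate 1/4 is what leaves room for the weight 4^n. *)
Lemma L2_geometric_cauchy (f_ : nat -> H) :
  (forall n, L2norm (f_ n.+1 - f_ n) <= (4^-1) ^+ n) ->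
  exists f : H, forall n, L2norm (f - f_ n) <= 2 * (4^-1) ^+ n.
Proof.
move=> fd.
pose D n x := normc (f_ n.+1 x - f_ n x) ^+ 2.
have sD n : (fun x => f_ n.+1 x - f_ n x) \in sqi.
  by apply: sqiB; exact: L2_sqi.
have D0 n x : 0 <= D n x by exact: sqr_ge0.
have mD n : measurable_fun setT (D n).
  by apply: measurable_funX; apply: measurable_normc; apply: (sqi_measurable (sD n)).
have iD n : (\int[mu]_x (D n x)%:E <= ((4^-1) ^+ n ^+ 2)%:E)%E.
  rewrite -L2norm_class// (_ : L2_class mu _ = f_ n.+1 - f_ n).
    by rewrite lee_fin ler_pXn2r ?nnegrE ?L2norm_ge0 ?exprn_ge0.
  by apply: L2_classP => //; apply: ae_eq_sym; exact: L2_subE.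
pose G x := (\sum_(n <oo) (4 ^+ n * D n x)%:E)%E.
have m4D n : measurable_fun setT (fun x => (4 ^+ n * D n x)%:E).
  by apply/measurable_EFinP; apply: measurable_funM.
have G0 x : (0 <= G x)%E by apply: nneseries_ge0 => n _ _; rewrite lee_fin mulr_ge0.
have mG : measurable_fun setT G.
  apply: (ge0_emeasurable_sum (P := predT)) => // n x _ _.
  by rewrite lee_fin mulr_ge0.
have iG : mu.-integrable setT G.
  apply/integrableP; split => //.
  under eq_integral do rewrite gee0_abs//.
  rewrite integral_nneseries//; last by move=> n x _; rewrite lee_fin mulr_ge0.
  apply: (@le_lt_trans _ _ (\sum_(n <oo) (geometric 1 4^-1 n)%:E)%E).
    apply: lee_nneseries => [n _ _|n _].
      by apply: integral_ge0 => x _; rewrite lee_fin mulr_ge0.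
    under eq_integral do rewrite EFinM.
    rewrite ge0_integralZl_EFin//; last 2 first.
    - by move=> x _; rewrite lee_fin.
    - exact/measurable_EFinP.
    apply: le_trans (lee_wpmul2l _ (iD n)) _; first by rewrite lee_fin exprn_ge0.
    rewrite -EFinM lee_fin /geometric/= mul1r -exprM mulnC exprM -exprMn.
    by rewrite (_ : 4 * 4^-1 ^+ 2 = 4^-1)//; field.
  have cg : cvgn (series (geometric 1 (4^-1 : R))).
    by apply: is_cvg_geometric_series; rewrite ger0_norm ?invf_lt1 ?ltr1n.
  rewrite (_ : (\sum_(n <oo) _)%E = (limn (series (geometric 1 (4^-1 : R))))%:E).
    exact: ltry.
  rewrite -EFin_lim//; congr (limn _); apply/funext => n /=.
  by rewrite -sumEFin.
pose E := [set x | (G x < +oo)%E].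
have mE : measurable E.
  rewrite (_ : E = setT `&` [set x | (G x < +oo)%E]); last by rewrite setTI.
  exact: emeasurable_fun_infty_o.
have aeE : {ae mu, forall x, E x}.
  apply: filterS (integrable_ae measurableT iG) => x /= /(_ Logic.I).
  by rewrite /E /= ge0_fin_numE.
(* Cutting off outside E makes convergence hold at every point, as [L2_limit_of_pointwise] asks, and
   does not change the classes. *)
pose v_ n x : C := (\1_E x)%:C * f_ n x.
have step x n : normc (v_ n.+1 x - v_ n x) <= 
    Num.sqrt (\1_E x * fine (G x)) * (2^-1) ^+ n.
  rewrite /v_ -mulrBr Normc.normcM normc_real ger0_norm ?indicE//.
  have [xE|xE] := boolP (x \in E); last by rewrite mul0r mulr_ge0 ?sqrtr_ge0 ?exprn_ge0.
  rewrite !mul1r -(@ler_pXn2r _ 2) ?nnegrE ?normc_ge0 ?mulr_ge0 ?sqrtr_ge0 ?exprn_ge0//.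
  rewrite exprMn sqr_sqrtr ?fine_ge0// -exprM mulnC exprM -ler_pdivrMr ?exprn_gt0 ?exprn_gt0//.
  rewrite (_ : _ / _ = 4 ^+ n * D n x); last first.
    by rewrite mulrC -exprVn (_ : (2^-1 ^+ 2)^-1 = 4)//; field.
  have Gfin : G x \is a fin_num by rewrite ge0_fin_numE//; move: xE; rewrite inE.
  rewrite -lee_fin fineK//.
  rewrite /G (nneseriesD1 (n := n))//; last by move=> k _; rewrite lee_fin mulr_ge0.
  by rewrite leeDl// nneseries_ge0// => k _ _; rewrite lee_fin mulr_ge0.
have cr x : cvgn (fun n => Re (v_ n x)).
  apply: (@geometric_step_cvg _ _ (Num.sqrt (\1_E x * fine (G x)))) => n.
  apply: le_trans (step x n).
  by have := normc_ge_absRe (v_ n.+1 x - v_ n x); rewrite ReD; case: (v_ n x).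
have ci x : cvgn (fun n => Im (v_ n x)).
  apply: (@geometric_step_cvg _ _ (Num.sqrt (\1_E x * fine (G x)))) => n.
  apply: le_trans (step x n).
  by have := normc_ge_absIm (v_ n.+1 x - v_ n x); rewrite ImD; case: (v_ n x).
have sv n : v_ n \in sqi.
  apply: (@sqi_le _ _ _ _ _ (f_ n)); last 2 first.
  - exact: L2_sqi.
  - move=> x; rewrite /v_ Normc.normcM normc_real indicE.
    by case: (x \in E); rewrite ?normr1 ?mul1r// normr0 mul0r normc_ge0.
  apply: cmeasurableM; last exact: sqi_measurable (L2_sqi _).
  by split; [exact: measurable_indic|exact: measurable_cst].
have cE n : L2_class mu (v_ n) = f_ n.
  apply: L2_classP => //; apply: filterS aeE => x Ex _.
  by rewrite /v_ indicE mem_set// mul1r.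
pose v x := limn (fun n => Re (v_ n x)) +i* limn (fun n => Im (v_ n x)).
have [||||f hf] := @L2_limit_of_pointwise v_ v (fun n => 2 * (4^-1) ^+ n) sv.
- by move=> x; exact: cr.
- by move=> x; exact: ci.
- by move=> n; rewrite mulr_ge0// exprn_ge0.
- move=> n m nm; rewrite !cE -(subnK nm).
  (* The factor 4/3 times (1 - 4^-k) is the exact geometric partial sum, which closes the induction;
     it is below the 2 of the statement. *)
  have main k : L2norm (f_ (k + n)%N - f_ n) <=
      (4 / 3 * (1 - (4^-1) ^+ k)) * 4^-1 ^+ n.
    elim: k => [|k IH].
      by rewrite add0n subrr L2norm0 expr0 subrr mulr0 mul0r.
    rewrite addSn; apply: le_trans (L2norm_dist_trans _ (f_ (k + n)%N) _) _.
    apply: le_trans (lerD (fd _) IH) _.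
    rewrite exprD -mulrDl ler_wpM2r ?exprn_ge0// exprS.
    by rewrite le_eqVlt; apply/orP; left; apply/eqP; field.
  apply: le_trans (main _) _; rewrite ler_wpM2r ?exprn_ge0//.
  have : 0 <= (4^-1 : R) ^+ (m - n) by rewrite exprn_ge0.
  by lra.
by exists f => n; rewrite -(cE n).
Qed.

(** Filters rather than sequences, because three kinds of limits are taken: along finite index sets
    for frame sums, along n for power series, and along minimizing vectors in the Riesz
    representation. *)
Lemma L2_complete (F : set_system H) : ProperFilter F ->
  (forall e : R, 0 < e -> exists f, F [set g | L2norm (f - g) < e]) ->
  exists f, forall e : R, 0 < e -> F [set g | L2norm (f - g) < e].
Proof.
move=> PF cF.
pose r n : R := (4^-1) ^+ n / 4.
have r0 n : 0 < r n by rewrite divr_gt0 ?exprn_gt0 ?invr_gt0.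
pose f_ n := projT1 (cid (cF _ (r0 n))).
have fF n : F [set g | L2norm (f_ n - g) < r n] by rewrite /f_; case: cid.
have [n|f hf] := @L2_geometric_cauchy f_.
  have [g [/= h1 h2]] := filter_ex (filterI (fF n.+1) (fF n)).
  apply: le_trans (L2norm_dist_trans _ g _) _.
  rewrite [L2norm (g - _)]L2norm_distC; apply: le_trans (lerD (ltW h1) (ltW h2)) _.
  rewrite /r exprS; have : 0 < (4^-1 : R) ^+ n by rewrite exprn_gt0 ?invr_gt0.
  by lra.
exists f => e e0.
have [n ne] : exists n, 3 * (4^-1 : R) ^+ n < e.
  have : (fun n => 3 * (4^-1 : R) ^+ n) @ \oo --> 0.
    rewrite -(mulr0 3); apply: cvgM; first exact: cvg_cst.
    by apply: cvg_expr; rewrite ger0_norm ?invf_lt1 ?ltr1n.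
  move=> /cvgrPdist_lt/(_ e e0) [n _ /(_ n (leqnn n))] /=.
  by rewrite sub0r normrN ger0_norm ?mulr_ge0 ?exprn_ge0// => h; exists n.
apply: filterS (fF n) => g /= h.
apply: le_lt_trans (L2norm_dist_trans _ (f_ n) _) _.
apply: le_lt_trans (lerD (hf n) (ltW h)) _; apply: le_lt_trans ne.
rewrite /r; have : 0 < (4^-1 : R) ^+ n by rewrite exprn_gt0 ?invr_gt0.
by lra.
Qed.

End Completeness.

Local Opaque inner.

(** * Unconditional sums *)

Section UnconditionalSums.
Context {R : realType} {I : choiceType}.

Lemma fset_sum_split (V : zmodType) (x : I -> V) (A B : {fset I}) :
  (A `<=` B)%fset ->
  \sum_(i <- B) x i = \sum_(i <- A) x i + \sum_(i <- (B `\` A)%fset) x i.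
Proof.
move=> AB; rewrite (big_fsetID _ (mem A))/=; congr (_ + _).
  congr bigop; congr (enum_fset _); apply/fsetP => i; rewrite !inE /=.
  by apply/andP/idP => [[]//|iA]; split => //; exact: (fsubsetP AB).
congr bigop; congr (enum_fset _); apply/fsetP => i; rewrite !inE /=.
by rewrite andbC.
Qed.

(* Unconditional summability with respect to a real-valued norm [nm], so that
   it applies both to [L2norm] and to the complex modulus. *)
Definition usum (V : zmodType) (nm : V -> R) (x : I -> V) (s : V) :=
  forall e : R, 0 < e -> exists A : {fset I}, forall B : {fset I},
    (A `<=` B)%fset -> nm (s - \sum_(i <- B) x i) < e.

Lemma usum_unique (V : zmodType) (nm : V -> R) (x : I -> V) (s t : V) :
  (forall u v, nm (u + v) <= nm u + nm v) -> (forall u, nm (- u) = nm u) ->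
  (forall u, nm u = 0 -> u = 0) -> (forall u, 0 <= nm u) ->
  usum nm x s -> usum nm x t -> s = t.
Proof.
move=> nmD nmN nm0 nmge0 xs xt; apply/eqP; rewrite -subr_eq0; apply/eqP/nm0.
apply/eqP; rewrite eq_le nmge0 andbT; apply/ler_addgt0Pr => e e0; rewrite add0r.
have e2 : 0 < e / 2 by rewrite divr_gt0.
have [A hA] := xs _ e2; have [B hB] := xt _ e2.
have hA' := hA (A `|` B)%fset (fsubsetUl _ _).
have hB' := hB (A `|` B)%fset (fsubsetUr _ _).
set u := \sum_(i <- _) _ in hA' hB'.
rewrite (_ : s - t = (s - u) + - (t - u)); last by rewrite opprB addrA subrK.
apply: le_trans (nmD _ _) _; rewrite nmN (splitr e).
exact: lerD (ltW _) (ltW _).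
Qed.

Lemma usum_map (V W : zmodType) (nmV : V -> R) (nmW : W -> R) (phi : V -> W)
    (K : R) (x : I -> V) (s : V) :
  (forall u v, phi (u - v) = phi u - phi v) ->
  (forall v, nmW (phi v) <= K * nmV v) -> (forall v, 0 <= nmV v) ->
  usum nmV x s -> usum nmW (fun i => phi (x i)) (phi s).
Proof.
move=> phiB phiK nm0 xs e e0.
have p0 : phi 0 = 0 by rewrite -(subrr 0) phiB subrr.
have pN u : phi (- u) = - phi u by rewrite -[- u]add0r phiB p0 add0r.
have pD u v : phi (u + v) = phi u + phi v by rewrite -[v]opprK phiB pN !opprK.
(* [K] carries no sign, and the tolerance is divided by it. *)
have K1 : 0 < Num.max K 1 by rewrite lt_max ltr01 orbT.
have [A hA] := xs _ (divr_gt0 e0 K1).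
exists A => B AB; rewrite -(big_morph _ pD p0) -phiB.
apply: le_lt_trans (phiK _) _.
apply: (@le_lt_trans _ _ (Num.max K 1 * nmV (s - \sum_(i <- B) x i))).
  by rewrite ler_wpM2r// le_max lexx.
by rewrite mulrC -ltr_pdivlMr//; exact: hA.
Qed.

Lemma usumD (V : zmodType) (nm : V -> R) (x y : I -> V) (s t : V) :
  (forall u v, nm (u + v) <= nm u + nm v) ->
  usum nm x s -> usum nm y t -> usum nm (fun i => x i + y i) (s + t).
Proof.
move=> nmD xs yt e e0; have e2 : 0 < e / 2 by rewrite divr_gt0.
have [A hA] := xs _ e2; have [B hB] := yt _ e2.
exists (A `|` B)%fset => D; rewrite fsubUset => /andP[AD BD].
rewrite big_split/= opprD addrACA; apply: le_lt_trans (nmD _ _) _.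
by rewrite [ltRHS]splitr ltrD ?hA ?hB.
Qed.

Lemma usum_le (V : zmodType) (nm : V -> R) (x : I -> V) (s : V) (M : R) :
  (forall u v, nm (u + v) <= nm u + nm v) ->
  (forall F : {fset I}, nm (\sum_(i <- F) x i) <= M) -> usum nm x s -> nm s <= M.
Proof.
move=> nmD xM xs; apply/ler_addgt0Pl => e e0.
have [A /(_ A (fsubset_refl A)) hA] := xs _ e0.
rewrite -(subrK (\sum_(i <- A) x i) s); apply: le_trans (nmD _ _) _.
by rewrite lerD// ltW.
Qed.

Lemma eq_usum (V : zmodType) (nm : V -> R) (x y : I -> V) (s : V) :
  (forall i, x i = y i) -> usum nm x s -> usum nm y s.
Proof. by move=> /funext ->. Qed.

Lemma usum_reindex (V : zmodType) (nm : V -> R) (x : I -> V) (s : V)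
    (p q : I -> I) : cancel p q -> cancel q p ->
  usum nm x s -> usum nm (fun i => x (p i)) s.
Proof.
move=> pq qp xs e e0; have [A hA] := xs _ e0.
exists [fset q i | i in A]%fset => B /fsubsetP AB.
have -> : \sum_(i <- B) x (p i) = \sum_(i <- [fset p i | i in B]%fset) x i.
  by rewrite big_imfset//= => i j _ _; exact: (can_inj pq).
apply: hA; apply/fsubsetP => i iA; apply/imfsetP; exists (q i) => //=.
by apply: AB; apply/imfsetP; exists i.
Qed.

Lemma fset_sum_le_subset (c : I -> R) (A B : {fset I}) :
  (forall i, 0 <= c i) -> (A `<=` B)%fset ->
  \sum_(i <- A) c i <= \sum_(i <- B) c i.
Proof.
by move=> c0 AB; rewrite (fset_sum_split _ AB) lerDl sumr_ge0.
Qed.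

Lemma esum_le_fset (c : I -> R) (M : R) :
  (forall F : {fset I}, \sum_(i <- F) c i <= M) ->
  ((\esum_(i in [set: I]) (c i)%:E)%R <= M%:E)%E.
Proof.
move=> cM; apply: ge_ereal_sup => _ /= [A [fA _] <-].
by rewrite fsbig_finite//= sumEFin lee_fin.
Qed.

Lemma fset_le_esum (c : I -> R) (F : {fset I}) :
  ((\sum_(i <- F) c i)%:E <= (\esum_(i in [set: I]) (c i)%:E)%R)%E.
Proof.
apply: esum_ge; exists [set` F].
  by split => //; exact: finite_fset.
by rewrite fsbig_finite ?finite_fset//= set_fsetK sumEFin.
Qed.

Lemma esum_usum (c : I -> R) (s : R) : (forall i, 0 <= c i) ->
  usum Num.norm c s -> (\esum_(i in [set: I]) (c i)%:E)%R = s%:E.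
Proof.
move=> c0 cs; apply/eqP; rewrite eq_le; apply/andP; split.
  apply: esum_le_fset => F; apply/ler_addgt0Pr => e e0.
  have [A hA] := cs _ e0.
  have := hA (A `|` F)%fset (fsubsetUl _ _).
  have := fset_sum_le_subset c0 (fsubsetUr A F).
  by rewrite ltr_norml => h /andP[h1 h2]; rewrite (le_trans h)//; lra.
apply/lee_addgt0Pr => e e0; have [A /(_ A (fsubset_refl _)) hA] := cs _ e0.
apply: le_trans (leeD (fset_le_esum c A) (lexx _)).
by rewrite -EFinD lee_fin; move: hA; rewrite ltr_norml => /andP[h1 h2]; lra.
Qed.

End UnconditionalSums.

(** * Bessel families and their mixed frame operators *)

Section BesselFamilies.
Context {d : measure_display} {T : measurableType d} {R : realType}.
Variable mu : {measure set T -> \bar R}.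
Context {I : choiceType}.
Local Notation C := R[i].
Local Notation H := (L2 mu).
Implicit Types (f g h : H) (e : I -> H) (c : I -> C).
Local Notation nrm := (@L2norm _ _ _ mu).

Definition bessel e (b : R) := 0 < b /\ forall f (F : {fset I}),
  \sum_(i <- F) normc (inner f (e i)) ^+ 2 <= b * nrm f ^+ 2.

Definition l2_bounded c (m : R) :=
  forall F : {fset I}, \sum_(i <- F) normc (c i) ^+ 2 <= m.

(** The norm square of u is at most the sum of |c_i| |<u, e_i>|. Splitting each product with weights
    b/2 and 1/(2b), the Bessel bound turns the second part into half the norm square of u, which is
    absorbed on the left. *)
Lemma synthesis_fset_le e b c (F : {fset I}) : bessel e b ->
  nrm (\sum_(i <- F) c i *: e i) ^+ 2 <= b * \sum_(i <- F) normc (c i) ^+ 2.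
Proof.
move=> [b0 eb]; set u := \sum_(i <- F) _.
have h1 : nrm u ^+ 2 <= \sum_(i <- F) normc (c i) * normc (inner u (e i)).
  rewrite sqr_L2norm {1}/u inner_suml; apply: le_trans (ler_norm _) _.
  apply: le_trans (normc_ge_absRe _) _.
  elim/big_rec2: _ => [|i x y _ xy]; first by rewrite Normc.normc0.
  apply: le_trans (le_normcD _ _) _; rewrite lerD//.
  by rewrite innerZl Normc.normcM normc_innerC.
have h2 : \sum_(i <- F) normc (c i) * normc (inner u (e i)) <=
   \sum_(i <- F) (b / 2 * normc (c i) ^+ 2 + (2 * b)^-1 * normc (inner u (e i)) ^+ 2).
  apply: ler_sum => i _; rewrite -subr_ge0.
  set x := normc (c i); set y := normc _.
  rewrite (_ : _ - _ = (2 * b)^-1 * (b * x - y) ^+ 2); last by field; rewrite gt_eqF.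
  by rewrite mulr_ge0 ?sqr_ge0// invr_ge0 mulr_ge0// ltW.
have := le_trans h1 h2; rewrite big_split/= -!mulr_sumr.
have := eb u F; set p := \sum_(i <- F) _; set q := \sum_(i <- F) _ => h3 h4.
have h5 : (2 * b)^-1 * p <= nrm u ^+ 2 / 2.
  rewrite [leRHS](_ : _ = (2 * b)^-1 * (b * nrm u ^+ 2)); last first.
    by field; rewrite gt_eqF.
  by rewrite ler_wpM2l// invr_ge0 mulr_ge0// ltW.
lra.
Qed.

(** A finite set whose sum comes within r of the supremum leaves less than r to any larger set. *)
Lemma l2_bounded_tail c m : l2_bounded c m -> forall r : R, 0 < r ->
  exists A : {fset I}, forall B : {fset I}, (A `<=` B)%fset ->
    \sum_(i <- (B `\` A)%fset) normc (c i) ^+ 2 < r.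
Proof.
move=> cm r r0; pose E := [set \sum_(i <- F) normc (c i) ^+ 2 | F in [set: {fset I}]].
have hE : has_sup E.
  split; first by exists (\sum_(i <- fset0) normc (c i) ^+ 2); exists fset0.
  by exists m => _ [F _ <-].
have [_ [A _ <-] hA] := sup_adherent r0 hE.
exists A => B AB.
have : \sum_(i <- B) normc (c i) ^+ 2 <= sup E.
  by apply: ub_le_sup; [case: hE|exists B].
by rewrite (fset_sum_split _ AB); move: hA; lra.
Qed.

Lemma usum_sumE (x : I -> H) (s : H) : usum nrm x s -> summability.sum x = s.
Proof.
move=> xs; have FF : ProperFilter (@summability.totally I).
  exact: summability.totally_filter.
apply: cvg_lim; first exact: norm_hausdorff.
apply/cvgrPdist_lt => e e0.
(* The norm of the library takes values in [R[i]], where a positive element is real. *)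
have e0' : 0 < Re e by move: e0; rewrite ltcE => /andP[].
have eE : e = (Re e)%:C by move: e0; case: (e) => a b; rewrite ltcE/= => /andP[/eqP ->].
have [A hA] := xs _ e0'.
exists A => // B /= AB; rewrite eE.
rewrite (_ : summability.partial_sum x B = \sum_(i <- B) x i); last first.
  by rewrite big_seq_fsetE.
by rewrite [X in X < _](_ : _ = (nrm (s - \sum_(i <- B) x i))%:C)// ltcR hA.
Qed.

Lemma synthesis_usum e b c m : bessel e b -> l2_bounded c m ->
  usum nrm (fun i => c i *: e i) (summability.sum (fun i => c i *: e i)).
Proof.
move=> be cm; have [b0 _] := be.
pose F := (fun A : {fset I} => \sum_(i <- A) c i *: e i) @ summability.totally.
have FF : ProperFilter (@summability.totally I).
  exact: summability.totally_filter.
have tail (r : R) : 0 < r -> exists A : {fset I}, forall B : {fset I},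
    (A `<=` B)%fset -> nrm (\sum_(i <- A) c i *: e i - \sum_(i <- B) c i *: e i) < r.
  move=> r0; have r2 : 0 < r ^+ 2 / b by rewrite divr_gt0 ?exprn_gt0.
  have [A hA] := l2_bounded_tail cm r2; exists A => B AB.
  rewrite (fset_sum_split _ AB) opprD addrA subrr add0r L2norm_opp.
  rewrite -(@ltr_pXn2r _ 2) ?nnegrE ?L2norm_ge0 ?(ltW r0)//.
  apply: le_lt_trans (synthesis_fset_le _ _ be) _.
  by rewrite mulrC -ltr_pdivlMr//; exact: hA.
have [s hs] : exists s, forall r : R, 0 < r -> F [set g | nrm (s - g) < r].
  apply: L2_complete => r r0; have [A hA] := tail r r0.
  by exists (\sum_(i <- A) c i *: e i); exists A.
suff us : usum nrm (fun i => c i *: e i) s by rewrite (usum_sumE us).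
by move=> r r0; have [A _ hA] := hs r r0; exists A => B AB; exact: hA.
Qed.

(** Analysis with [e], synthesis with [e']: the operator S_{g,h} when these are the orbits of g and
    h. *)
Definition mixed (e e' : I -> H) (f : H) : H :=
  summability.sum (fun i => inner f (e i) *: e' i).

Lemma bessel_l2_bounded e b f : bessel e b ->
  l2_bounded (fun i => inner f (e i)) (b * nrm f ^+ 2).
Proof. by move=> [_ eb] F; exact: eb. Qed.

Lemma mixed_usum e b e' b' f : bessel e b -> bessel e' b' ->
  usum nrm (fun i => inner f (e i) *: e' i) (mixed e e' f).
Proof. by move=> eb eb'; exact: synthesis_usum eb' (bessel_l2_bounded f eb). Qed.

Lemma usum_nrm_unique (x : I -> H) s t : usum nrm x s -> usum nrm x t -> s = t.
Proof.
apply: usum_unique; [exact: L2norm_triangle|exact: L2norm_opp|exact: L2norm_eq0P|].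
exact: L2norm_ge0.
Qed.

Lemma usum_normc_unique (x : I -> C) s t :
  usum (@Normc.normc R) x s -> usum (@Normc.normc R) x t -> s = t.
Proof.
apply: usum_unique; [exact: le_normcD|exact: normc_opp|exact: Normc.eq0_normc|].
exact: normc_ge0.
Qed.

Lemma usum_innerl (x : I -> H) s g : usum nrm x s ->
  usum (@Normc.normc R) (fun i => inner (x i) g) (inner s g).
Proof.
apply: (@usum_map _ _ _ _ _ _ (fun u => inner u g) (nrm g)).
- by move=> u v; exact: innerBl.
- by move=> v; rewrite mulrC; exact: cauchy_schwarz.
- exact: L2norm_ge0.
Qed.

Lemma usum_innerr (x : I -> H) s g : usum nrm x s ->
  usum (@Normc.normc R) (fun i => inner g (x i)) (inner g s).
Proof.
apply: (@usum_map _ _ _ _ _ _ (fun u => inner g u) (nrm g)).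
- by move=> u v; exact: innerBr.
- by move=> v; exact: cauchy_schwarz.
- exact: L2norm_ge0.
Qed.

Lemma usum_Re (x : I -> C) s : usum (@Normc.normc R) x s ->
  usum Num.norm (fun i => Re (x i)) (Re s).
Proof.
apply: (@usum_map _ _ _ _ _ _ Re 1).
- by move=> u v; rewrite ReD; case: v.
- by move=> v; rewrite mul1r normc_ge_absRe.
- exact: normc_ge0.
Qed.

Lemma mixed_adjoint e b e' b' f g : bessel e b -> bessel e' b' ->
  inner (mixed e e' f) g = inner f (mixed e' e g).
Proof.
move=> eb eb'.
apply: usum_normc_unique (usum_innerl g (mixed_usum f eb eb')) _.
apply: eq_usum (usum_innerr f (mixed_usum g eb' eb)) => i /=.
by rewrite innerZr innerZl mulrC; congr (_ * _); exact/esym/innerC.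
Qed.

(** The number [m] bounds the coefficients of this particular f. The Bessel bound [b] serves only
    convergence; it would give too weak an estimate when [e] is the orbit of a window difference. *)
Lemma mixed_norm_le e b e' b' f m : bessel e b -> bessel e' b' ->
  l2_bounded (fun i => inner f (e i)) m -> nrm (mixed e e' f) ^+ 2 <= b' * m.
Proof.
move=> eb eb' fm; have [b'0 _] := eb'.
have m0 : 0 <= m by have := fm fset0; rewrite big_seq_fset0.
rewrite -[leRHS]sqr_sqrtr ?mulr_ge0// ?(ltW b'0)//.
rewrite ler_pXn2r ?nnegrE ?L2norm_ge0 ?sqrtr_ge0//.
apply: usum_le (mixed_usum f eb eb'); first exact: L2norm_triangle.
move=> F; rewrite -(@ler_pXn2r _ 2) ?nnegrE ?L2norm_ge0 ?sqrtr_ge0//.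
rewrite sqr_sqrtr ?mulr_ge0// ?(ltW b'0)//.
apply: le_trans (synthesis_fset_le _ _ eb') _.
by rewrite ler_pM2l//; exact: fm.
Qed.

Lemma usum_scale (x : I -> H) s (a : C) : usum nrm x s ->
  usum nrm (fun i => a *: x i) (a *: s).
Proof.
apply: (@usum_map _ _ _ _ _ _ (fun u => a *: u) (normc a)).
- by move=> u v; exact: scalerBr.
- by move=> v; rewrite L2norm_scale.
- exact: L2norm_ge0.
Qed.

Lemma mixed_linear e b e' b' : bessel e b -> bessel e' b' ->
  linear (mixed e e').
Proof.
move=> eb eb' a f g; apply: (usum_nrm_unique (mixed_usum _ eb eb')).
apply: eq_usum (usumD (@L2norm_triangle _ _ _ mu)
  (usum_scale a (mixed_usum f eb eb')) (mixed_usum g eb eb')) => i /=.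
by rewrite innerDl innerZl scalerDl scalerA.
Qed.

Lemma mixed_subl e1 b1 e2 b2 e12 b12 e' b' f :
  bessel e1 b1 -> bessel e2 b2 -> bessel e12 b12 -> bessel e' b' ->
  (forall i, e12 i = e1 i - e2 i) ->
  mixed e12 e' f = mixed e1 e' f - mixed e2 e' f.
Proof.
move=> h1 h2 h12 h' E; apply: (usum_nrm_unique (mixed_usum f h12 h')).
rewrite -[X in _ + X]scaleN1r.
apply: eq_usum (usumD (@L2norm_triangle _ _ _ mu)
  (mixed_usum f h1 h') (usum_scale (-1) (mixed_usum f h2 h'))) => i /=.
by rewrite E innerBr scalerBl scaleN1r.
Qed.

Lemma mixed_subr e1 b1 e2 b2 e12 b12 e b f :
  bessel e1 b1 -> bessel e2 b2 -> bessel e12 b12 -> bessel e b ->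
  (forall i, e12 i = e1 i - e2 i) ->
  mixed e e12 f = mixed e e1 f - mixed e e2 f.
Proof.
move=> h1 h2 h12 h' E; apply: (usum_nrm_unique (mixed_usum f h' h12)).
rewrite -[X in _ + X]scaleN1r.
apply: eq_usum (usumD (@L2norm_triangle _ _ _ mu)
  (mixed_usum f h' h1) (usum_scale (-1) (mixed_usum f h' h2))) => i /=.
by rewrite E scalerBr scaleN1r.
Qed.

(** This crude constant suffices: it guarantees that the sums for a window difference converge, and
    never enters a final estimate. *)
Lemma bessel_sub e1 b1 e2 b2 : bessel e1 b1 -> bessel e2 b2 ->
  bessel (fun i => e1 i - e2 i) (2 * (b1 + b2)).
Proof.
move=> [b10 h1] [b20 h2]; split; first by rewrite mulr_gt0 ?addr_gt0.
move=> f F; have := h1 f F; have := h2 f F => q2 q1.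
apply: (@le_trans _ _ (\sum_(i <- F) 2 * (normc (inner f (e1 i)) ^+ 2 +
    normc (inner f (e2 i)) ^+ 2))).
  apply: ler_sum => i _; rewrite innerBr.
  have := le_normcD (inner f (e1 i)) (- inner f (e2 i)); rewrite normc_opp.
  have := normc_ge0 (inner f (e1 i) - inner f (e2 i)).
  have := sqr_ge0 (normc (inner f (e1 i)) - normc (inner f (e2 i))); nra.
by rewrite -mulr_sumr big_split/=; nra.
Qed.

Lemma mixed_diag_usum e b f : bessel e b ->
  usum Num.norm (fun i => normc (inner f (e i)) ^+ 2) (Re (inner (mixed e e f) f)).
Proof.
move=> eb; apply: eq_usum (usum_Re (usum_innerl f (mixed_usum f eb eb))) => i.
cbv beta.
by rewrite innerZl [inner (e i) f]innerC mul_conjcE.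
Qed.

Lemma mixed_diag_esum e b f : bessel e b ->
  (\esum_(i in [set: I]) (normc (inner f (e i)) ^+ 2)%:E)%R =
  (Re (inner (mixed e e f) f))%:E.
Proof.
move=> eb; apply: esum_usum; last exact: mixed_diag_usum eb.
by move=> i; exact: sqr_ge0.
Qed.

End BesselFamilies.

(** * Coefficients of the inverse square root and auxiliary sums *)

Section InverseSquareRootSeries.
Context {R : realType}.

(* The Taylor coefficients of [(1 - x)^(-1/2)], i.e. ['C(2n, n) / 4^n]. *)
Fixpoint isqrt_coef (n : nat) : R :=
  if n is k.+1 then isqrt_coef k * ((2 * k%:R + 1) / (2 * k%:R + 2)) else 1.

Lemma isqrt_coef_step k :
  (2 * k%:R + 2) * isqrt_coef k.+1 = (2 * k%:R + 1) * isqrt_coef k.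
Proof.
rewrite /=; field.
by rewrite -natrM -natrD pnatr_eq0 addn2.
Qed.

Lemma isqrt_coef_bounds n : 0 <= isqrt_coef n <= 1.
Proof.
elim: n => [|n /andP[h0 h1]] /=; first by rewrite ler01 lexx.
have d0 : 0 < 2 * n%:R + 2 :> R by rewrite -natrM -natrD ltr0n addn2.
have n0 : 0 <= n%:R :> R by rewrite ler0n.
apply/andP; split; first by rewrite mulr_ge0// divr_ge0//; lra.
apply: mulr_ile1 => //; by rewrite ler_pdivrMr//; lra.
Qed.

(* With [c n] the self-convolution, symmetry gives
   [n * c n = 2 * \sum k a_k a_(n - k) = n * c (n - 1)]. *)
Lemma isqrt_coef_conv n : \sum_(i < n.+1) isqrt_coef i * isqrt_coef (n - i)%N = 1.
Proof.
set a := isqrt_coef; pose c n := \sum_(i < n.+1) a i * a (n - i)%N.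
rewrite -/(c n); elim: n => [|n IH]; first by rewrite /c big_ord1 /= mulr1.
have sym m : \sum_(i < m.+1) (2 * i%:R) * (a i * a (m - i)%N) = m%:R * c m.
  have E : \sum_(i < m.+1) i%:R * (a i * a (m - i)%N) =
      \sum_(i < m.+1) (m - i)%:R * (a i * a (m - i)%N).
    rewrite (reindex_inj rev_ord_inj)/=; apply: eq_bigr => i _.
    rewrite subSS [a (m - i)%N * _]mulrC; congr (_ * (_ * a _)).
    by rewrite subKn// -ltnS.
  rewrite /c mulr_sumr -[RHS]/(\sum_(i < m.+1) m%:R * (a i * a (m - i)%N)).
  transitivity (\sum_(i < m.+1) (i%:R * (a i * a (m - i)%N)) +
     \sum_(i < m.+1) (i%:R * (a i * a (m - i)%N))).
    by rewrite -big_split; apply: eq_bigr => i _; rewrite /=; ring.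
  rewrite {2}E -big_split; apply: eq_bigr => i _ /=.
  by rewrite -mulrDl -natrD subnKC// -ltnS.
have n1 : n.+1%:R != 0 :> R by rewrite pnatr_eq0.
apply: (mulfI n1); rewrite mulr1 -sym big_ord_recl/= mulr0 mul0r add0r.
transitivity (\sum_(i < n.+1) (2 * i%:R) * (a i * a (n - i)%N) + c n); last first.
  by rewrite sym IH mulr1 -natr1.
rewrite /c -big_split; apply: eq_bigr => i _ /=.
rewrite /bump/= add1n subSS.
have := isqrt_coef_step i; rewrite -/a => st.
rewrite mulrA [2 * _](_ : _ = 2 * i%:R + 2); last by rewrite -natr1; ring.
by rewrite st; ring.
Qed.

End InverseSquareRootSeries.

Lemma triangle_sum (V : zmodType) (F : nat -> nat -> V) N :
  \sum_(m < N) \sum_(i < m.+1) F i (m - i)%N =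
  \sum_(i < N) \sum_(j < N - i) F i j.
Proof.
elim: N => [|N IH]; first by rewrite !big_ord0.
rewrite big_ord_recr/= IH.
rewrite [RHS](eq_bigr (fun i : 'I_N.+1 => \sum_(j < N - i) F i j + F i (N - i)%N)).
  rewrite big_split/=; congr (_ + _).
  by rewrite [RHS]big_ord_recr/= subnn big_ord0 addr0.
by move=> i _; rewrite subSn ?big_ord_recr// -ltnS.
Qed.

(** The constant K = q / (r - q) solves q (K + 1) = K r, which is the induction step. The lemma
    absorbs the factor n that a Cauchy product produces. *)
Lemma natmul_geometric_le {R : realType} (q r : R) n : 0 <= q -> q < r ->
  n%:R * q ^+ n <= q / (r - q) * r ^+ n.
Proof.
move=> q0 qr; have rq : 0 < r - q by rewrite subr_gt0.
have r0 : 0 <= r by rewrite (le_trans q0)// ltW.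
elim: n => [|n IH]; first by rewrite mul0r mulr_ge0// divr_ge0// ltW.
rewrite -natr1 mulrDl mul1r.
have h1 : n%:R * q ^+ n.+1 <= q * (q / (r - q) * r ^+ n).
  by rewrite exprS mulrCA ler_wpM2l.
have h2 : q ^+ n.+1 <= q * r ^+ n.
  by rewrite exprS ler_wpM2l//; apply: lerXn2r; rewrite ?nnegrE// ltW.
apply: le_trans (lerD h1 h2) _; rewrite le_eqVlt; apply/orP; left; apply/eqP.
by rewrite exprS; field; rewrite gt_eqF.
Qed.

(** * Linear maps on L^2 *)

Section LinearMaps.
Context {d : measure_display} {T : measurableType d} {R : realType}.
Variable mu : {measure set T -> \bar R}.
Local Notation H := (L2 mu).
Variable U : H -> H.
Hypothesis lU : linear U.

Lemma linear_add f g : U (f + g) = U f + U g.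
Proof. by have := lU 1 f g; rewrite !scale1r. Qed.

Lemma linear_zero : U 0 = 0.
Proof. by apply: (addrI (U 0)); rewrite -linear_add !addr0. Qed.

Lemma linear_scale a f : U (a *: f) = a *: U f.
Proof. by have := lU a f 0; rewrite linear_zero !addr0. Qed.

Lemma linear_opp f : U (- f) = - U f.
Proof. by rewrite -scaleN1r linear_scale scaleN1r. Qed.

Lemma linear_sub f g : U (f - g) = U f - U g.
Proof. by rewrite linear_add linear_opp. Qed.

Lemma linear_sumr (I : Type) (r : seq I) (F : I -> H) :
  U (\sum_(i <- r) F i) = \sum_(i <- r) U (F i).
Proof. exact: (big_morph U linear_add linear_zero). Qed.

Lemma linear_iter n : linear (iter n U).
Proof. by elim: n => [//|n IH] a f g; rewrite !iterS IH lU. Qed.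

End LinearMaps.

(** * Power series in a strict contraction *)

Section FunctionalCalculus.
Context {d : measure_display} {X : measurableType d} {R : realType}.
Variable mu : {measure set X -> \bar R}.
Local Notation C := R[i].
Local Notation H := (L2 mu).
Local Notation nrm := (@L2norm _ _ _ mu).
Implicit Types (f g h : H) (a : nat -> R).

Section PowerSeries.
Variables (T : H -> H) (q : R).
Hypotheses (lT : linear T) (q0 : 0 <= q) (q1 : q < 1).
Hypothesis Tq : forall f, nrm (T f) <= q * nrm f.

Let q1' : 0 < 1 - q. Proof. by rewrite subr_gt0. Qed.

Lemma iter_contraction n f : nrm (iter n T f) <= q ^+ n * nrm f.
Proof.
elim: n => [|n IH]; first by rewrite mul1r.
by rewrite iterS exprS -mulrA (le_trans (Tq _))// ler_wpM2l.
Qed.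

Definition psum a N f : H := \sum_(i < N) (a i)%:C *: iter i T f.

(** Covers both series in use, those of 1/(1 - x) and of (1 - x)^(-1/2), with one common remainder
    bound. *)
Definition unit_coef a := forall n, 0 <= a n <= 1.

Lemma psum_step a n m f : unit_coef a -> (n <= m)%N ->
  nrm (psum a m f - psum a n f) <= q ^+ n / (1 - q) * nrm f.
Proof.
move=> a01 nm; rewrite -(subnK nm).
have main k : nrm (psum a (k + n)%N f - psum a n f) <=
    (1 - q ^+ k) * (q ^+ n / (1 - q)) * nrm f.
  elim: k => [|k IH]; first by rewrite add0n subrr L2norm0 expr0 subrr !mul0r.
  rewrite addSn {1}/psum big_ord_recr/= -/(psum a _ f) addrAC.
  apply: le_trans (L2norm_triangle _ _) _.
  apply: le_trans (lerD IH (_ : _ <= q ^+ (k + n) * nrm f)) _.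
    rewrite L2norm_scale normc_real; have /andP[a0 a1] := a01 (k + n)%N.
    rewrite ger0_norm//; apply: le_trans (iter_contraction _ _).
    by rewrite ler_piMl ?L2norm_ge0.
  rewrite -mulrDl ler_wpM2r ?L2norm_ge0// exprD exprS le_eqVlt.
  by apply/orP; left; apply/eqP; field; rewrite gt_eqF.
apply: le_trans (main _) _; rewrite ler_wpM2r ?L2norm_ge0//.
by rewrite ler_piMl ?divr_ge0 ?exprn_ge0 ?(ltW q1')// gerBl exprn_ge0.
Qed.

Lemma geometric_lt (K e : R) : 0 < e -> exists n, K * q ^+ n < e.
Proof.
move=> e0; have : (fun n => K * q ^+ n) @ \oo --> 0.
  rewrite -(mulr0 K); apply: cvgM; first exact: cvg_cst.
  by apply: cvg_expr; rewrite ger0_norm.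
move=> /cvgrPdist_lt/(_ e e0) [n _ /(_ n (leqnn n))] /=.
rewrite sub0r normrN => h; exists n; exact: le_lt_trans (ler_norm _) h.
Qed.

Lemma geometric_eq0 (K : R) f : (forall n, nrm f <= K * q ^+ n) -> f = 0.
Proof.
move=> fK; apply: L2norm_small_eq0 => e /(geometric_lt K)[n hn].
exact: le_trans (fK n) (ltW hn).
Qed.

Lemma geometric_ge0 (K x : R) : (forall n, - (K * q ^+ n) <= x) -> 0 <= x.
Proof.
move=> xK; apply/ler_addgt0Pr => e /(geometric_lt K)[n hn].
by have := xK n; lra.
Qed.

Lemma power_series_ex a f : unit_coef a ->
  exists s, forall n, nrm (s - psum a n f) <= q ^+ n / (1 - q) * nrm f.
Proof.
move=> a01; have Fn : ProperFilter ((psum a)^~ f @ \oo) by exact: fmap_proper_filter.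
have [e e0|s hs] := @L2_complete _ _ _ mu ((psum a)^~ f @ \oo) _.
  have [n hn] := geometric_lt (nrm f / (1 - q)) e0.
  exists (psum a n f); exists n => // m /= nm.
  rewrite L2norm_distC; apply: le_lt_trans (psum_step f a01 nm) _.
  by apply: le_lt_trans hn; rewrite le_eqVlt; apply/orP; left; apply/eqP; ring.
exists s => n; apply/ler_addgt0Pl => e e0.
have [m _ hm] := hs _ e0; have /= h := hm (maxn m n) (leq_maxl _ _).
apply: le_trans (L2norm_dist_trans _ (psum a (maxn m n) f) _) _.
by apply: lerD; [exact: ltW|apply: psum_step => //; exact: leq_maxr].
Qed.

(** The sum is singled out by its rate of convergence, which determines it. Identities between sums
    then reduce, through [power_series_unique], to identities between partial sums with a geometric
    error. *)
Definition power_series a f : H :=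
  get [set s | forall n, nrm (s - psum a n f) <= q ^+ n / (1 - q) * nrm f].

Lemma power_seriesP a f n : unit_coef a ->
  nrm (power_series a f - psum a n f) <= q ^+ n / (1 - q) * nrm f.
Proof. by move=> /(power_series_ex f) h; apply: (getPex h). Qed.

Lemma power_series_unique a f s K : unit_coef a ->
  (forall n, nrm (s - psum a n f) <= K * q ^+ n) -> s = power_series a f.
Proof.
move=> a01 sK; apply/eqP; rewrite -subr_eq0; apply/eqP.
apply: (@geometric_eq0 (K + (1 - q)^-1 * nrm f)) => n.
apply: le_trans (L2norm_dist_trans _ (psum a n f) _) _; rewrite mulrDl lerD//.
rewrite L2norm_distC; apply: le_trans (power_seriesP _ _ a01) _.
by rewrite le_eqVlt; apply/orP; left; apply/eqP; ring.
Qed.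

Lemma psum_map a n (U : H -> H) f : linear U -> (forall g, U (T g) = T (U g)) ->
  U (psum a n f) = psum a n (U f).
Proof.
move=> lU UT; rewrite /psum linear_sumr//; apply: eq_bigr => i _.
rewrite linear_scale//; congr (_ *: _); elim: (i : nat) => //= k IH.
by rewrite UT IH.
Qed.

Lemma power_series_commute a (U : H -> H) K f : unit_coef a -> linear U ->
  (forall g, nrm (U g) <= K * nrm g) -> (forall g, U (T g) = T (U g)) ->
  U (power_series a f) = power_series a (U f).
Proof.
move=> a01 lU UK UT.
have K1 : 0 <= Num.max K 1 by rewrite le_max ler01 orbT.
apply: (@power_series_unique _ _ _ (Num.max K 1 * (nrm f / (1 - q)))) => // n.
rewrite -psum_map// -linear_sub//; apply: le_trans (UK _) _.
apply: (@le_trans _ _ (Num.max K 1 * nrm (power_series a f - psum a n f))).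
  by rewrite ler_wpM2r ?L2norm_ge0// le_max lexx.
rewrite -[leRHS]mulrA ler_wpM2l//; apply: le_trans (power_seriesP _ _ a01) _.
by rewrite le_eqVlt; apply/orP; left; apply/eqP; ring.
Qed.

Lemma psum_linear a n : linear (psum a n).
Proof.
move=> b f g; rewrite /psum scaler_sumr -big_split; apply: eq_bigr => i _ /=.
by rewrite linear_iter// scalerDr !scalerA mulrC.
Qed.

Lemma power_series_linear a : unit_coef a -> linear (power_series a).
Proof.
move=> a01 b f g; apply/esym.
apply: (@power_series_unique _ _ _ ((normc b * nrm f + nrm g) / (1 - q))) => // n.
rewrite psum_linear opprD addrACA -scalerBr.
apply: le_trans (L2norm_triangle _ _) _; rewrite L2norm_scale.
apply: (@le_trans _ _ (normc b * (q ^+ n / (1 - q) * nrm f) + q ^+ n / (1 - q) * nrm g)).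
  by apply: lerD; [apply: ler_wpM2l; rewrite ?normc_ge0//|]; exact: power_seriesP.
rewrite le_eqVlt; apply/orP; left; apply/eqP; field; rewrite gt_eqF//.
Qed.

Lemma power_series_bounded a f : unit_coef a ->
  nrm (power_series a f) <= (1 - q)^-1 * nrm f.
Proof.
move=> a01; have := power_seriesP f 0 a01.
by rewrite /psum big_ord0 subr0 expr0 mul1r.
Qed.

(** On partial sums the left-hand side telescopes to f - T^n f, and T^n f tends to 0
    geometrically. *)
Lemma neumann_series f : power_series (fun=> 1) f - T (power_series (fun=> 1) f) = f.
Proof.
have a01 : unit_coef (fun=> 1) by move=> n; rewrite ler01 lexx.
apply/eqP; rewrite -subr_eq0; apply/eqP.
set s := power_series _ _.
have tele n : psum (fun=> 1) n f - T (psum (fun=> 1) n f) = f - iter n T f.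
  rewrite psum_map//; elim: n => [|n IH]; first by rewrite /psum !big_ord0 !subrr.
  rewrite /psum !big_ord_recr/= opprD addrACA -/(psum _ n f) -/(psum _ n (T f)) IH.
  by rewrite !scale1r -!iterSr -iterS addrA subrK.
apply: (@geometric_eq0 ((1 - q)^-1 * nrm f + q * ((1 - q)^-1 * nrm f) + nrm f)) => n.
have h := power_seriesP f n a01; rewrite -/s in h.
apply: le_trans (L2norm_dist_trans _ (psum (fun=> 1) n f - T (psum (fun=> 1) n f)) _) _.
rewrite {2}tele [f - _]addrC addrK L2norm_opp opprD addrACA -opprD -linear_sub//.
rewrite mulrDl; apply: lerD; last by rewrite mulrC; exact: iter_contraction.
apply: le_trans (L2norm_triangleB _ _) _; rewrite mulrDl; apply: lerD.
  by apply: le_trans h _; rewrite le_eqVlt; apply/orP; left; apply/eqP; ring.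
apply: le_trans (Tq _) _; rewrite -mulrA ler_wpM2l//.
by apply: le_trans h _; rewrite le_eqVlt; apply/orP; left; apply/eqP; ring.
Qed.

(** Since the self-convolution of the coefficients is 1, the truncated geometric series is the
    triangle i + j < n of the product of two inverse square root series. *)
Lemma psum_isqrt_triangle n f :
  psum (fun=> 1) n f =
  \sum_(i < n) (isqrt_coef i)%:C *: iter i T (psum isqrt_coef (n - i) f).
Proof.
pose F i j := (isqrt_coef i * isqrt_coef j)%:C *: iter (i + j) T f.
transitivity (\sum_(i < n) \sum_(j < n - i) F i j).
  rewrite -triangle_sum; apply: eq_bigr => m _.
  rewrite -(isqrt_coef_conv m) rmorph_sum scaler_suml; apply: eq_bigr => i _.
  by rewrite /F subnKC// -ltnS.
apply: eq_bigr => i _; rewrite /psum linear_sumr; last exact: linear_iter.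
rewrite scaler_sumr; apply: eq_bigr => j _.
rewrite (linear_scale (linear_iter lT i)) scalerA -rmorphM /F.
by rewrite iterD.
Qed.

Lemma isqrt_coef_unit : unit_coef isqrt_coef.
Proof. exact: isqrt_coef_bounds. Qed.

(** In the triangle of [psum_isqrt_triangle], replacing the inner partial sum of length n - i by the
    full sum costs a multiple of q^i q^(n - i) = q^n. The n rows together cost n q^n, which a rate r
    strictly between q and 1 absorbs. *)
Lemma power_series_isqrt_sqr f :
  power_series isqrt_coef (power_series isqrt_coef f) = power_series (fun=> 1) f.
Proof.
have a01 : unit_coef (fun=> 1) by move=> n; rewrite ler01 lexx.
set s := power_series isqrt_coef f.
have [r qr r1] : exists2 r : R, q < r & r < 1.
  by exists ((q + 1) / 2); move: q1; lra.
have r0 : 0 < r by rewrite (le_lt_trans q0).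
have rq : 0 < r - q by rewrite subr_gt0.
apply/eqP; rewrite -subr_eq0; apply/eqP; apply: L2norm_small_eq0 => e e0.
pose K := (1 - q)^-1 * nrm s + (q / (r - q)) * ((1 - q)^-1 * nrm f) +
  (1 - q)^-1 * nrm f.
have [n hn] : exists n, K * r ^+ n < e.
  have : (fun n => K * r ^+ n) @ \oo --> 0.
    rewrite -(mulr0 K); apply: cvgM; first exact: cvg_cst.
    by apply: cvg_expr; rewrite ger0_norm// ltW.
  move=> /cvgrPdist_lt/(_ e e0) [n _ /(_ n (leqnn n))] /=.
  rewrite sub0r normrN => h; exists n; exact: le_lt_trans (ler_norm _) h.
apply: le_trans (ltW hn).
have qrn : q ^+ n <= r ^+ n by apply: lerXn2r; rewrite ?nnegrE// ltW.
apply: le_trans (L2norm_dist_trans _ (psum (fun=> 1) n f) _) _.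
rewrite /K mulrDl; apply: lerD; last first.
  rewrite L2norm_distC; apply: le_trans (power_seriesP f n a01) _.
  rewrite [leLHS](_ : _ = (1 - q)^-1 * nrm f * q ^+ n); last by ring.
  by rewrite ler_wpM2l// mulr_ge0 ?L2norm_ge0// invr_ge0 ltW.
apply: le_trans (L2norm_dist_trans _ (psum isqrt_coef n s) _) _.
rewrite mulrDl; apply: lerD.
  apply: le_trans (power_seriesP _ _ isqrt_coef_unit) _.
  rewrite [leLHS](_ : _ = (1 - q)^-1 * nrm s * q ^+ n); last by ring.
  by rewrite ler_wpM2l// mulr_ge0 ?L2norm_ge0// invr_ge0 ltW.
rewrite psum_isqrt_triangle {1}/psum -sumrB.
apply: le_trans (L2norm_sum _ _) _.
apply: (@le_trans _ _ (\sum_(i < n) q ^+ n * ((1 - q)^-1 * nrm f))).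
  apply: ler_sum => i _; rewrite -scalerBr -(linear_sub (linear_iter lT i)).
  rewrite L2norm_scale normc_real.
  have /andP[c0 c1] := isqrt_coef_bounds (R := R) i.
  rewrite ger0_norm//.
  apply: le_trans (ler_wpM2r (L2norm_ge0 _) c1) _; rewrite mul1r.
  apply: le_trans (iter_contraction _ _) _.
  apply: le_trans (ler_wpM2l (exprn_ge0 _ q0) (power_seriesP f (n - i) isqrt_coef_unit)) _.
  rewrite mulrA mulrA -exprD subnKC ?(ltnW (ltn_ord i))//.
  by rewrite mulrA.
rewrite sumr_const card_ord -[leLHS]mulr_natl mulrA.
rewrite [leRHS]mulrAC ler_wpM2r//; last exact: natmul_geometric_le.
by rewrite mulr_ge0 ?L2norm_ge0// invr_ge0 ltW.
Qed.

(** The term of index 0 contributes the norm square of f, and all others are nonnegative. The strict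
    lower bound is what makes the positive square root unique in [sqrt_operatorE]. *)
Lemma power_series_form_ge a f : unit_coef a -> a 0%N = 1 ->
  (forall n, 0 <= inner (iter n T f) f) ->
  Im (inner (power_series a f) f) = 0 /\
  nrm f ^+ 2 <= Re (inner (power_series a f) f).
Proof.
move=> a01 a0 Tpos.
have pos n : 0 <= inner (psum a n f) f.
  rewrite inner_suml; apply: sumr_ge0 => i _; rewrite innerZl mulr_ge0//.
  by rewrite ler0c; case/andP: (a01 i).
have pos1 n : nrm f ^+ 2 <= Re (inner (psum a n.+1 f) f).
  have -> : psum a n.+1 f = f + \sum_(i < n) (a i.+1)%:C *: iter i.+1 T f.
    by rewrite /psum big_ord_recl/= a0 scale1r.
  rewrite innerDl ReD -sqr_L2norm lerDl.
  have : 0 <= inner (\sum_(i < n) (a i.+1)%:C *: iter i.+1 T f) f.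
    rewrite inner_suml; apply: sumr_ge0 => i _; rewrite innerZl mulr_ge0//.
    by rewrite ler0c; case/andP: (a01 i.+1).
  by rewrite lecE => /andP[].
have close n : normc (inner (power_series a f) f - inner (psum a n f) f) <=
    (nrm f ^+ 2 / (1 - q)) * q ^+ n.
  rewrite -innerBl; apply: le_trans (cauchy_schwarz _ _) _.
  apply: le_trans (ler_wpM2r (L2norm_ge0 _) (power_seriesP f n a01)) _.
  by rewrite le_eqVlt; apply/orP; left; apply/eqP; ring.
split.
  apply/eqP; rewrite -normr_eq0 eq_le normr_ge0 andbT -oppr_ge0.
  apply: (@geometric_ge0 (nrm f ^+ 2 / (1 - q))) => n; rewrite lerN2.
  apply: le_trans (close n); apply: le_trans (normc_ge_absIm _).
  have := pos n; rewrite lecE => /andP[/eqP/= h _]; rewrite ImD.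
  by case: (inner (psum _ _ _) _) h => x y /= ->; rewrite oppr0 addr0.
rewrite -subr_ge0; apply: (@geometric_ge0 (nrm f ^+ 2 / (1 - q))) => n.
have h1 := pos1 n.
have := le_trans (normc_ge_absRe _) (close n.+1).
have : nrm f ^+ 2 / (1 - q) * q ^+ n.+1 <= nrm f ^+ 2 / (1 - q) * q ^+ n.
  rewrite ler_wpM2l ?divr_ge0 ?exprn_ge0 ?L2norm_ge0 ?(ltW q1')//.
  by rewrite exprS ler_piMl ?exprn_ge0// ltW.
rewrite ReD; case: (inner (psum _ _ _) _) h1 => x y /= h1 h2.
by rewrite ler_norml => /andP[h3 _]; lra.
Qed.

End PowerSeries.
End FunctionalCalculus.

(** * Inverse and inverse square root of a bounded, positive, invertible operator *)

Section InverseAndSquareRoot.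
Context {d : measure_display} {X : measurableType d} {R : realType}.
Variable mu : {measure set X -> \bar R}.
Local Notation C := R[i].
Local Notation H := (L2 mu).
Local Notation nrm := (@L2norm _ _ _ mu).
Implicit Types (f g h : H).
Variables (S : H -> H) (A B : R).
Hypotheses (A0 : 0 < A) (AB : A <= B) (lS : linear S).
Hypothesis S_sym : forall f g, inner (S f) g = inner f (S g).
Hypothesis S_lower : forall f, A * nrm f ^+ 2 <= Re (inner (S f) f).
Hypothesis S_upper : forall f, Re (inner (S f) f) <= B * nrm f ^+ 2.

Definition relaxation f : H := f - (B^-1)%:C *: S f.
Definition relaxation_rate : R := 1 - A / B.
Local Notation T := relaxation.
Local Notation q := relaxation_rate.

Let B0 : 0 < B. Proof. exact: lt_le_trans A0 AB. Qed.

Lemma relaxation_rate_ge0 : 0 <= q.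
Proof. by rewrite subr_ge0 ler_pdivrMr// mul1r. Qed.

Lemma relaxation_rate_lt1 : q < 1.
Proof. by rewrite gtrBl divr_gt0. Qed.

Lemma relaxation_linear : linear T.
Proof.
move=> a f g; rewrite /relaxation lS scalerDr opprD addrACA; congr (_ + _).
by rewrite scalerBr !scalerA mulrC.
Qed.

Lemma relaxation_sym f g : inner (T f) g = inner f (T g).
Proof.
by rewrite innerBl innerBr innerZl innerZr S_sym conjc_realE.
Qed.

Lemma S_form_real f : Im (inner (S f) f) = 0.
Proof.
have := innerC (S f) f; rewrite -S_sym; case: inner => x y [] /eqP.
by rewrite -addr_eq0 -mulr2n mulrn_eq0/= => /eqP.
Qed.

Lemma relaxation_form f : Re (inner (T f) f) = nrm f ^+ 2 - B^-1 * Re (inner (S f) f).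
Proof.
rewrite innerBl innerZl inner_norm ReD.
by case: (inner (S f) f) => x y /=; rewrite mul0r subr0.
Qed.

Lemma relaxation_form_ge0 f : 0 <= inner (T f) f.
Proof.
rewrite lecE; apply/andP; split.
  rewrite innerBl innerZl inner_norm ImD; have := S_form_real f.
  by case: (inner (S f) f) => x y /= ->; rewrite mulr0 mul0r addr0 oppr0 addr0.
rewrite -[Re 0]/(0 : R) relaxation_form subr_ge0 ler_pdivrMl//.
Qed.

Lemma relaxation_form_le f : Re (inner (T f) f) <= q * nrm f ^+ 2.
Proof.
rewrite relaxation_form /relaxation_rate mulrBl mul1r lerD2l lerN2.
by rewrite mulrC mulrA mulrC ler_pM2l ?invr_gt0// mulrC.
Qed.

(** Cauchy-Schwarz for the form <T f, g> at g = T f bounds |T f|^4 by <T f, f> <T T f, T f>, hence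
    by q |f|^2 times q |T f|^2; then divide by |T f|^2. *)
Lemma relaxation_contraction f : nrm (T f) <= q * nrm f.
Proof.
have [->|Tf0] := eqVneq (nrm (T f)) 0.
  by rewrite mulr_ge0 ?L2norm_ge0 ?relaxation_rate_ge0.
have Tf : 0 < nrm (T f) by rewrite lt_neqAle eq_sym Tf0 L2norm_ge0.
have q0 := relaxation_rate_ge0.
have := @form_cauchy_schwarz _ _ _ mu (fun f g => inner (T f) g) _ _ _ _ f (T f).
move=> /(_ _ _ _ relaxation_form_ge0); rewrite inner_norm normc_real.
rewrite ger0_norm ?sqr_ge0// => /(_ _ _ _)/= h.
have {}h : nrm (T f) ^+ 2 ^+ 2 <= (q * nrm f ^+ 2) * (q * nrm (T f) ^+ 2).
  apply: le_trans (h _ _ _) _.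
  - by move=> u v w; rewrite (linear_add relaxation_linear) innerDl.
  - by move=> a u w; rewrite (linear_scale relaxation_linear) innerZl.
  - by move=> u v; rewrite relaxation_sym innerC.
  - apply: ler_pM; rewrite ?relaxation_form_le//.
    + by have := relaxation_form_ge0 f; rewrite lecE => /andP[].
    + by have := relaxation_form_ge0 (T f); rewrite lecE => /andP[].
rewrite -(@ler_pXn2r _ 2) ?nnegrE ?mulr_ge0 ?L2norm_ge0//.
have T2 : 0 < nrm (T f) ^+ 2 by rewrite exprn_gt0.
rewrite -(ler_pM2r T2) -expr2; apply: le_trans h _.
by rewrite le_eqVlt; apply/orP; left; apply/eqP; ring.
Qed.

Lemma relaxation_iter_sym n f g : inner (iter n T f) g = inner f (iter n T g).
Proof.
elim: n f g => [//|n IH] f g; rewrite iterS relaxation_sym IH.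
by rewrite -iterSr.
Qed.

(** Half of the factors move to the right by symmetry. What remains is a norm square for even n, and
    the form of T at a vector for odd n. *)
Lemma relaxation_iter_ge0 n f : 0 <= inner (iter n T f) f.
Proof.
rewrite -(odd_double_half n) addnC -addnn -addnA iterD relaxation_iter_sym.
case: odd; last by rewrite addn0 inner_norm ler0c sqr_ge0.
by rewrite addn1 iterS; exact: relaxation_form_ge0.
Qed.

Lemma S_relaxation f : S f = B%:C *: (f - T f).
Proof.
rewrite /relaxation opprB addrC subrK scalerA -rmorphM mulfV ?gt_eqF//.
by rewrite rmorph1 scale1r.
Qed.

Let q0 := relaxation_rate_ge0.
Let q1 := relaxation_rate_lt1.
Let lT := relaxation_linear.
Let Tq := relaxation_contraction.
Let one_unit : unit_coef (fun=> 1 : R).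
Proof. by move=> n; rewrite ler01 lexx. Qed.
Let isq_unit := @isqrt_coef_unit R.

Local Notation ps := (power_series T q).

Definition neumann_inverse f : H := (B^-1)%:C *: ps (fun=> 1) f.
(** From S = B (1 - T), this is S^(-1/2) = B^(-1/2) (1 - T)^(-1/2). *)
Definition neumann_inverse_sqrt f : H := (Num.sqrt B^-1)%:C *: ps isqrt_coef f.

Lemma scaled_power_series_bounded (c : R) a : unit_coef a ->
  bounded_operator (fun f => c%:C *: ps a f).
Proof.
move=> a01; split.
  move=> b f g; rewrite (power_series_linear lT q0 q1 Tq a01) scalerDr !scalerA.
  by rewrite mulrC.
exists (`|c| * (1 - q)^-1) => f; rewrite L2norm_scale normc_real -mulrA.
by rewrite ler_wpM2l//; exact: power_series_bounded.
Qed.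

Lemma S_neumann_inverse f : S (neumann_inverse f) = f.
Proof.
rewrite /neumann_inverse linear_scale// S_relaxation scalerA -rmorphM.
by rewrite mulVf ?gt_eqF// rmorph1 scale1r; exact: neumann_series.
Qed.

Lemma neumann_inverse_S f : neumann_inverse (S f) = f.
Proof.
have lps := power_series_linear lT q0 q1 Tq one_unit.
rewrite /neumann_inverse S_relaxation (linear_scale lps) scalerA -rmorphM.
rewrite mulVf ?gt_eqF// rmorph1 scale1r (linear_sub lps).
rewrite -(power_series_commute q0 q1 Tq f one_unit lT Tq)//.
exact: neumann_series.
Qed.

Lemma inverse_operatorE f : inverse_operator S f = neumann_inverse f.
Proof.
have P : [set G | [/\ bounded_operator G, cancel S G & cancel G S]] neumann_inverse.
  split; [exact: scaled_power_series_bounded|exact: neumann_inverse_S|].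
  exact: S_neumann_inverse.
rewrite /inverse_operator; set G := get _.
have [_ SG _] : [set G | [/\ bounded_operator G, cancel S G & cancel G S]] G.
  by apply: getPex; exists neumann_inverse.
by rewrite -[in LHS](S_neumann_inverse f) SG.
Qed.

Lemma neumann_inverse_sqrtK f :
  neumann_inverse_sqrt (neumann_inverse_sqrt f) = neumann_inverse f.
Proof.
have lps := power_series_linear lT q0 q1 Tq isq_unit.
rewrite /neumann_inverse_sqrt (linear_scale lps) scalerA -rmorphM -expr2.
by rewrite sqr_sqrtr ?invr_ge0 ?(ltW B0)// power_series_isqrt_sqr.
Qed.

Lemma neumann_inverse_sqrt_form f :
  Im (inner (neumann_inverse_sqrt f) f) = 0 /\
  Num.sqrt B^-1 * nrm f ^+ 2 <= Re (inner (neumann_inverse_sqrt f) f).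
Proof.
have [h1 h2] := power_series_form_ge q0 q1 Tq isq_unit erefl
  (fun n => relaxation_iter_ge0 n f).
rewrite /neumann_inverse_sqrt innerZl.
case: (inner (ps _ f) f) h1 h2 => x y /= -> h2.
by rewrite mulr0 !mul0r addr0 subr0 ler_wpM2l// sqrtr_ge0.
Qed.

Lemma neumann_inverse_sqrt_sym f g :
  inner (neumann_inverse_sqrt f) g = inner f (neumann_inverse_sqrt g).
Proof.
rewrite /neumann_inverse_sqrt innerZl innerZr conjc_realE; congr (_ * _).
have sym n u v : inner (psum T isqrt_coef n u) v = inner u (psum T isqrt_coef n v).
  rewrite inner_suml inner_sumr; apply: eq_bigr => i _.
  rewrite innerZl innerZr conjc_realE; congr (_ * _).
  by elim: (i : nat) u v => //= k IH u v; rewrite relaxation_sym IH -iterSr.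
apply/eqP; rewrite -subr_eq0; apply/eqP/Normc.eq0_normc/eqP.
rewrite eq_le normc_ge0 andbT; apply/ler_addgt0Pr => e e0; rewrite add0r.
have q1' : 0 < 1 - q by rewrite subr_gt0.
have [n hn] := geometric_lt q0 q1 (2 * (nrm f * nrm g / (1 - q))) e0.
apply: le_trans (ltW hn).
rewrite (_ : _ - _ = inner (ps isqrt_coef f - psum T isqrt_coef n f) g -
   inner f (ps isqrt_coef g - psum T isqrt_coef n g)); last first.
  by rewrite innerBl innerBr sym opprB addrA subrK.
apply: le_trans (le_normcD _ _) _; rewrite normc_opp.
apply: le_trans (lerD (cauchy_schwarz _ _) (cauchy_schwarz _ _)) _.
have hf := power_seriesP q0 q1 Tq f n isq_unit.
have hg := power_seriesP q0 q1 Tq g n isq_unit.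
apply: le_trans (lerD (ler_wpM2r (L2norm_ge0 _) hf) (ler_wpM2l (L2norm_ge0 _) hg)) _.
by rewrite le_eqVlt; apply/orP; left; apply/eqP; ring.
Qed.

(** Uniqueness of the positive root. Any such root G commutes with its square S^-1, hence with S,
    with T and with the series Z = [neumann_inverse_sqrt]. For y = G f - Z f this gives (G + Z) y =
    G^2 f - Z^2 f = 0. The form of G is nonnegative and that of Z is bounded below by a positive
    multiple of |y|^2, so y = 0. *)
Lemma sqrt_operatorE (S' : H -> H) f : (forall f, S' f = neumann_inverse f) ->
  sqrt_operator S' f = neumann_inverse_sqrt f.
Proof.
move=> S'E; have bZ := scaled_power_series_bounded (Num.sqrt B^-1) isq_unit.
have sB : 0 < Num.sqrt B^-1 by rewrite sqrtr_gt0 invr_gt0.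
have P : [set G | [/\ bounded_operator G, positive_operator G
    & forall f, G (G f) = S' f]] neumann_inverse_sqrt.
  split => // [u|u]; last by rewrite S'E neumann_inverse_sqrtK.
  have [h1 h2] := neumann_inverse_sqrt_form u.
  rewrite lecE h1 eqxx/=; apply: le_trans h2.
  by rewrite mulr_ge0 ?sqr_ge0// ltW.
rewrite /sqrt_operator; set G := get _.
have [[lG [K GK]] Gp GG] : [set G | [/\ bounded_operator G, positive_operator G
    & forall f, G (G f) = S' f]] G.
  by apply: getPex; exists neumann_inverse_sqrt.
have GGE u : G (G u) = neumann_inverse u by rewrite GG S'E.
have GS u : G (S u) = S (G u).
  by rewrite -[LHS]S_neumann_inverse -GGE (GGE (S u)) neumann_inverse_S.
have GT u : G (T u) = T (G u).
  by rewrite /relaxation (linear_sub lG) (linear_scale lG) GS.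
have GZ u : G (neumann_inverse_sqrt u) = neumann_inverse_sqrt (G u).
  by rewrite /neumann_inverse_sqrt (linear_scale lG)
    (power_series_commute q0 q1 Tq u isq_unit lG GK GT).
have lZ : linear neumann_inverse_sqrt by case: bZ.
set y := G f - neumann_inverse_sqrt f.
have Ey : G y + neumann_inverse_sqrt y = 0.
  rewrite /y (linear_sub lG) (linear_sub lZ) GGE GZ.
  by rewrite -/(neumann_inverse_sqrt _) neumann_inverse_sqrtK addrA subrK subrr.
apply/eqP; rewrite -subr_eq0 -/y; apply/eqP/L2norm_eq0P.
have [_ h2] := neumann_inverse_sqrt_form y.
have h1 : 0 <= Re (inner (G y) y) by have := Gp y; rewrite lecE => /andP[].
have h3 : Re (inner (G y) y) + Re (inner (neumann_inverse_sqrt y) y) = 0.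
  by rewrite -ReD -innerDl Ey inner0l.
have : Num.sqrt B^-1 * nrm y ^+ 2 <= 0 by lra.
rewrite pmulr_rle0// => y2; apply/eqP.
by rewrite -sqrf_eq0 eq_le y2 sqr_ge0.
Qed.

End InverseAndSquareRoot.

(** * Open boxes as a generating pi-system *)

Section OpenBoxes.
Context {R : realType} (n : nat).
Implicit Types (a b x : 'rV[R]_n).

Definition open_box a b : set 'rV[R]_n :=
  [set x | forall i, a ord0 i < x ord0 i < b ord0 i].

Definition open_boxes : set (set 'rV[R]_n) :=
  [set B | exists a b, B = open_box a b].

Lemma open_box_prod a b :
  open_box a b = [set x | forall i, [set` `]a ord0 i, b ord0 i[] (x ord0 i)].
Proof. by apply/seteqP; split=> x /= h i; have := h i; rewrite /= in_itv. Qed.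

Lemma measurable_open_box a b : measurable (open_box a b).
Proof.
rewrite open_box_prod.
apply: (measurable_box (A := fun i => [set` `]a ord0 i, b ord0 i[])) => i.
exact: measurable_itv.
Qed.

Lemma open_boxes_setI : setI_closed open_boxes.
Proof.
move=> _ _ [a [b ->]] [a' [b' ->]].
exists (\row_i Num.max (a ord0 i) (a' ord0 i)),
  (\row_i Num.min (b ord0 i) (b' ord0 i)).
apply/seteqP; split => [x [h h'] i|x h].
  by rewrite !mxE gt_max lt_min; have /andP[-> ->] := h i; have /andP[-> ->] := h' i.
by split=> i; have := h i; rewrite !mxE gt_max lt_min => /andP[/andP[? ?] /andP[? ?]];
  apply/andP.
Qed.

Lemma lebesgue_open_box a b :
  lebesgue_rV n (open_box a b) =
  (\prod_(i < n) lebesgue_measure [set` `]a ord0 i, b ord0 i[])%E.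
Proof.
rewrite open_box_prod.
apply: (lebesgue_rV_box (A := fun i => [set` `]a ord0 i, b ord0 i[])) => i.
exact: measurable_itv.
Qed.

Lemma lebesgue_open_box_lty a b : (lebesgue_rV n (open_box a b) < +oo)%E.
Proof.
rewrite lebesgue_open_box.
rewrite (eq_bigr (fun i => (Num.max 0 (b ord0 i - a ord0 i))%:E)).
  by rewrite prodEFin ltry.
move=> i _; rewrite lebesgue_measure_itv/= lte_fin.
case: ltP => h; last by rewrite max_l ?subr_le0.
by rewrite -EFinB max_r// subr_ge0 ltW.
Qed.

Definition centered_box (k : nat) := open_box (const_mx (- k%:R)) (const_mx k%:R).

Lemma rV_coord_bound x i : `|x ord0 i| <= \sum_j `|x ord0 j|.
Proof. by rewrite (bigD1 i)//= lerDl sumr_ge0. Qed.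

Lemma centered_box_cover : \bigcup_k centered_box k = [set: 'rV[R]_n].
Proof.
apply/seteqP; split => // x _.
exists (Num.bound (\sum_j `|x ord0 j|)) => // i; rewrite !mxE -ltr_norml.
by apply: le_lt_trans (rV_coord_bound x i) _; rewrite archi_boundP// sumr_ge0.
Qed.

(** The preimage of an interval under one coordinate is a countable union of boxes whose other sides
    are ]-k, k[. *)
Lemma measurable_open_boxes : @measurable _ 'rV[R]_n = <<s open_boxes >>.
Proof.
apply/seteqP; split; last first.
  apply: smallest_sub; first exact: sigma_algebra_measurable.
  by move=> _ [a [b ->]]; exact: measurable_open_box.
have sG := smallest_sigma_algebra setT open_boxes.
apply: smallest_sub => //.
rewrite -bigcup_seq; apply: bigcup_sub => i _ B [C mC <-]; rewrite setTI.
pose P := [set D : set R | <<s open_boxes >> (rV_coord i @^-1` D)].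
suff : <<s [set D : set R | exists s t : R, D = `]s, t[%classic] >> `<=` P.
  apply; suff : (@RGenOpens.G R).-sigma.-measurable C by [].
  by rewrite -RGenOpens.measurableE.
apply: smallest_sub.
  split.
  - by rewrite /P /= preimage_set0; case: sG.
  - move=> D PD; rewrite /P /= setTD preimage_setC.
    by case: sG => _ + _ => /(_ _ PD); rewrite setTD.
  - move=> F PF; rewrite /P /= preimage_bigcup.
    by case: sG => _ _; exact.
move=> _ [u [v ->]]; rewrite /P /=.
rewrite (_ : _ @^-1` _ = \bigcup_k open_box
   (\row_j if j == i then u else - k%:R) (\row_j if j == i then v else k%:R)).
  case: sG => _ _; apply=> k; apply: sub_sigma_algebra; by eexists; eexists.
apply/seteqP; split => [x /=|x [k _ h]]; last first.
  by have := h i; rewrite !mxE eqxx /= in_itv.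
rewrite in_itv/= => xi; exists (Num.bound (\sum_j `|x ord0 j|)) => // j; rewrite !mxE.
case: eqP => [->//|_]; rewrite -ltr_norml.
by apply: le_lt_trans (rV_coord_bound x j) _; rewrite archi_boundP// sumr_ge0.
Qed.

End OpenBoxes.

(** * Translation invariance of Lebesgue measure *)

Section TranslationInvariance.
Context {R : realType} {n : nat}.
Local Notation lambda := (@lebesgue_rV R n).
Implicit Types (a b x : 'rV[R]_n).

Lemma measurable_rV_translate a : measurable_fun setT (fun x => x - a).
Proof.
apply: measurable_fun_rVP => i.
rewrite (_ : _ \o _ = (fun x => rV_coord i x - rV_coord i a)).
  by apply: measurable_funB => //; exact: measurable_rV_coord.
by apply/funext => x; rewrite /rV_coord/= !mxE.
Qed.

(** The measure and its pushforward agree on boxes, where side lengths are unchanged; the centered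
    boxes have finite measure and exhaust the space, so the two measures coincide. *)
Lemma lebesgue_rV_translate a (A : set 'rV[R]_n) : measurable A ->
  lambda ((fun x => x - a) @^-1` A) = lambda A.
Proof.
pose push := measure_function_pushforward__canonical__measure_function_Measure
  lambda (@measurable_rV_translate a).
move=> mA; rewrite -[LHS]/(push A); apply/esym.
apply: (measure_unique (@open_boxes R n) (@centered_box R n)).
- exact: measurable_open_boxes.
- exact: open_boxes_setI.
- by move=> k; eexists; eexists.
- exact: centered_box_cover.
- move=> _ [u [v ->]]; rewrite [RHS]/(pushforward _ _ _).
  rewrite (_ : _ @^-1` _ = open_box (u + a) (v + a)); last first.
    by apply/seteqP; split=> x h i; have := h i; rewrite !mxE ltrBrDr ltrBlDr.
  apply: (eq_trans (lebesgue_open_box u v)).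
  apply: (eq_trans _ (esym (lebesgue_open_box _ _))); apply: eq_bigr => i _.
  rewrite !lebesgue_measure_itv/= !mxE !lte_fin ltrD2r; case: ifP => // _.
  by rewrite -!EFinB; congr EFin; ring.
- move=> k; exact: lebesgue_open_box_lty.
- exact: mA.
Qed.

Lemma ge0_integral_translate a (f : 'rV[R]_n -> \bar R) :
  measurable_fun setT f -> (forall x, (0 <= f x)%E) ->
  (\int[lambda]_x f (x - a)%R = \int[lambda]_x f x)%E.
Proof.
move=> mf f0; transitivity (\int[pushforward lambda (fun x => (x - a)%R)]_x f x)%E.
  by rewrite ge0_integral_pushforward//; exact: measurable_rV_translate.
pose push := measure_function_pushforward__canonical__measure_function_Measure
  lambda (@measurable_rV_translate a).
rewrite -[LHS]/(\int[push]_x f x)%E.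
by apply: eq_measure_integral => A mA _; exact: lebesgue_rV_translate.
Qed.

Lemma translate_ae a (P : 'rV[R]_n -> Prop) :
  {ae lambda, forall x, P x} -> {ae lambda, forall x, P (x - a)}.
Proof.
move=> [N [mN N0 PN]]; exists ((fun x => x - a) @^-1` N); split.
- by rewrite -[X in measurable X]setTI; exact: measurable_rV_translate.
- by rewrite lebesgue_rV_translate.
- by move=> x /= nP; apply: PN.
Qed.

End TranslationInvariance.

Local Transparent inner.

(** * Unimodular factors and the dot product *)

Section PhaseFactors.
Context {R : realType}.

Lemma normc_expi (t : R) : normc (expi t) = 1.
Proof. by rewrite /expi /= cos2Dsin2 sqrtr1. Qed.

Lemma expiD (s t : R) : expi (s + t) = expi s * expi t.
Proof.
by rewrite /expi sinD cosD; apply: complexP => /=; rewrite // addrC.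
Qed.

Lemma expi0 : expi (0 : R) = 1.
Proof. by rewrite /expi cos0 sin0. Qed.

Lemma conj_expi (t : R) : conjc (expi t) = expi (- t).
Proof. by rewrite /expi cosN sinN. Qed.

Lemma expi_conjK (t : R) : expi t * conjc (expi t) = 1.
Proof. by rewrite conj_expi -expiD subrr expi0. Qed.

Context {n : nat}.
Implicit Types x y z : 'rV[R]_n.

Lemma dotDl x y z : dot (x + y) z = dot x z + dot y z.
Proof. by rewrite /dot -big_split; apply: eq_bigr => i _; rewrite mxE mulrDl. Qed.

Lemma dotC x y : dot x y = dot y x.
Proof. by apply: eq_bigr => i _; rewrite mulrC. Qed.

Lemma dotDr x y z : dot z (x + y) = dot z x + dot z y.
Proof. by rewrite dotC dotDl !(dotC z). Qed.

Lemma dotNl x y : dot (- x) y = - dot x y.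
Proof. by rewrite /dot -sumrN; apply: eq_bigr => i _; rewrite mxE mulNr. Qed.

Lemma dotNr x y : dot x (- y) = - dot x y.
Proof. by rewrite dotC dotNl dotC. Qed.

Lemma dot0l x : dot 0 x = 0.
Proof. by rewrite /dot big1// => i _; rewrite mxE mul0r. Qed.

End PhaseFactors.

(** * Time-frequency shifts as isometries of L^2 *)

Section TimeFrequencyShifts.
Context {R : realType} {d : nat}.
Local Notation C := R[i].
Local Notation lambda := (@lebesgue_rV R d).
Local Notation sqi := (square_integrable lambda).
Local Notation H := (L2Rd R d).
Local Notation nrm := (@L2norm _ _ _ lambda).
Implicit Types (f g h : H) (l m : 'rV[R]_(d + d)) (u : 'rV[R]_d -> C).

Definition tf_fun l u : 'rV[R]_d -> C :=
  translation (lsubmx l) (modulation (rsubmx l) u).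

Lemma cmeasurable_expi_dot (b : 'rV[R]_d) (c : R) :
  cmeasurable (fun x => expi (c * dot b x)).
Proof.
have mdot : measurable_fun setT (fun x : 'rV[R]_d => c * dot b x).
  apply: measurable_funM => //; apply: measurable_sum => i.
  by apply: measurable_funM => //; exact: (measurable_rV_coord i).
split.
- by apply: (measurableT_comp (f := @cos R)) => //;
    apply: continuous_measurable_fun; exact: continuous_cos.
- by apply: (measurableT_comp (f := @sin R)) => //;
    apply: continuous_measurable_fun; exact: continuous_sin.
Qed.

Lemma modulation_sqi b u : u \in sqi -> modulation b u \in sqi.
Proof.
move=> su; apply: (sqi_le _ su) => [|x]; last first.
  by rewrite /modulation Normc.normcM normc_expi mul1r.
by apply: cmeasurableM; [exact: cmeasurable_expi_dot|exact: sqi_measurable su].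
Qed.

Lemma translation_cmeasurable a u : cmeasurable u -> cmeasurable (translation a u).
Proof.
by move=> [ur ui]; split;
  [apply: (measurableT_comp ur)|apply: (measurableT_comp ui)];
  exact: measurable_rV_translate.
Qed.

Lemma integral_normc_translation a u : cmeasurable u ->
  (\int[lambda]_x ((normc (translation a u x)) ^+ 2)%:E =
   \int[lambda]_x ((normc (u x)) ^+ 2)%:E)%E.
Proof.
move=> mu_; apply: (ge0_integral_translate a (f := fun x => ((normc (u x)) ^+ 2)%:E)).
- by apply/measurable_EFinP; apply: measurable_funX; exact: measurable_normc.
- by move=> x; rewrite lee_fin sqr_ge0.
Qed.

Lemma translation_sqi a u : u \in sqi -> translation a u \in sqi.
Proof.
move=> /sqiP[mu_ iu]; apply/sqiP; split; first exact: translation_cmeasurable.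
by rewrite integral_normc_translation.
Qed.

Lemma tf_fun_sqi l u : u \in sqi -> tf_fun l u \in sqi.
Proof. by move=> su; apply/translation_sqi/modulation_sqi. Qed.

Lemma tf_funE l u x : tf_fun l u x =
  expi (2 * pi * dot (rsubmx l) (x - lsubmx l)) * u (x - lsubmx l).
Proof. by []. Qed.

Lemma tf_shift_ae l f u : (f : _ -> C) = u %[ae lambda] ->
  tf_shift l f = tf_fun l u %[ae lambda].
Proof.
move=> fu; apply: ae_eq_trans (L2_classE (tf_fun_sqi l (L2_sqi f))) _.
apply: filterS (translate_ae (lsubmx l) fu) => x /= + _ => /(_ Logic.I) E.
by rewrite !tf_funE E.
Qed.

Lemma tf_shift_class l u : u \in sqi ->
  tf_shift l (L2_class lambda u) = L2_class lambda (tf_fun l u).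
Proof.
move=> su; apply/esym/L2_classP; first exact: tf_fun_sqi.
by apply: ae_eq_sym; apply: tf_shift_ae; exact: L2_classE.
Qed.

Lemma tf_shift_linear l : linear (@tf_shift R d l).
Proof.
move=> a f g; apply/L2_extP.
have h : (a *: f + g : H) = (fun x => a * (f : H) x + (g : H) x) %[ae lambda].
  apply: ae_eq_trans (L2_addE _ _) _.
  by apply: filterS (L2_scaleE a f) => x /= + xT => /(_ xT) ->.
apply: ae_eq_trans (tf_shift_ae l h) _; apply: ae_eq_sym.
apply: ae_eq_trans (L2_addE _ _) _.
have hf := tf_shift_ae l (ae_eq_refl _ _ (f : H)).
have hg := tf_shift_ae l (ae_eq_refl _ _ (g : H)).
apply: filterS2 (L2_scaleE a (tf_shift l f)) (filterI hf hg) => x /= h1 [h2 h3] xT.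
rewrite h1// h2// h3// !tf_funE [RHS]mulrDr; congr (_ + _).
exact: mulrCA.
Qed.

Lemma tf_shift_norm l f : nrm (tf_shift l f) = nrm f.
Proof.
apply/eqP; rewrite -(@eqrXn2 _ 2) ?L2norm_ge0//; apply/eqP; apply: EFin_inj.
rewrite L2norm_class; last exact: tf_fun_sqi (L2_sqi f).
rewrite sqr_L2normE integral_normc_translation.
  apply: eq_integral => x _.
  by rewrite /modulation Normc.normcM normc_expi mul1r.
exact: sqi_measurable (modulation_sqi _ (L2_sqi f)).
Qed.

(** Polarization: comparing norms of f + g gives the real part, of f + i g the imaginary part. *)
Lemma isometry_inner (U : H -> H) : linear U -> (forall f, nrm (U f) = nrm f) ->
  forall f g, inner (U f) (U g) = inner f g.
Proof.
move=> lU Un f g.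
have key (u v : H) : inner (U u) (U v) + inner (U v) (U u) = inner u v + inner v u.
  have := inner_norm (U (u + v)); rewrite Un -inner_norm (linear_add lU).
  rewrite !innerDl !innerDr !(inner_norm (U _)) !Un -!inner_norm.
  move=> /eqP; rewrite -!addrA (inj_eq (addrI _)) !addrA (inj_eq (addIr _)).
  by move=> /eqP.
have := key f g; have := key f ('i%C *: g).
rewrite (linear_scale lU) !innerZl !innerZr.
rewrite !(innerC (U f) (U g)) !(innerC f g).
case: (inner (U f) (U g)) => a b; case: (inner f g) => x y [h1 h2] [h3 h4].
by apply: complexP => /=; lra.
Qed.

Lemma tf_shift_inner l f g : inner (tf_shift l f) (tf_shift l g) = inner f g.
Proof. exact: isometry_inner (tf_shift_linear l) (tf_shift_norm l) _ _. Qed.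

Lemma lsubmxD l m : lsubmx (l + m) = lsubmx l + lsubmx m.
Proof. by apply/rowP => i; rewrite !mxE. Qed.

Lemma rsubmxD l m : rsubmx (l + m) = rsubmx l + rsubmx m.
Proof. by apply/rowP => i; rewrite !mxE. Qed.

Lemma lsubmx0 : lsubmx (0 : 'rV[R]_(d + d)) = 0.
Proof. by apply/rowP => i; rewrite !mxE. Qed.

Lemma rsubmx0 : rsubmx (0 : 'rV[R]_(d + d)) = 0.
Proof. by apply/rowP => i; rewrite !mxE. Qed.

Lemma tf_shift_comp l m f : tf_shift l (tf_shift m f) =
  expi (2 * pi * dot (rsubmx l) (lsubmx m)) *: tf_shift (l + m) f.
Proof.
apply/L2_extP.
apply: ae_eq_trans (tf_shift_ae l (tf_shift_ae m (ae_eq_refl _ _ f))) _.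
apply: ae_eq_sym; apply: ae_eq_trans (L2_scaleE _ _) _.
apply: filterS (tf_shift_ae (l + m) (ae_eq_refl _ _ f)) => x /= + xT => /(_ xT) ->.
rewrite !tf_funE lsubmxD rsubmxD mulrA opprD addrA mulrA -!expiD; congr (expi _ * _).
by rewrite !(dotDl, dotDr, dotNr); ring.
Qed.

Lemma tf_shift0 f : tf_shift 0 f = f.
Proof.
apply/L2_extP; apply: ae_eq_trans (tf_shift_ae 0 (ae_eq_refl _ _ f)) _.
apply: aeW => x _; by rewrite tf_funE lsubmx0 rsubmx0 subr0 dot0l mulr0 expi0 mul1r.
Qed.

(** The order of the quantifiers matters: one phase serves all vectors. It therefore cancels in the
    terms <f, pi(l) g> pi(l) h, where it occurs once conjugated and once not
    ([expi_scale_cancel]). *)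
Lemma tf_shift_commute l m : exists t : R, forall f,
  tf_shift l (tf_shift m f) = expi t *: tf_shift m (tf_shift l f).
Proof.
eexists => f; rewrite !tf_shift_comp [m + l]addrC.
by rewrite scalerA -expiD addrC; congr (expi _ *: _); apply/esym/addrNK.
Qed.

End TimeFrequencyShifts.

Local Opaque inner tf_shift L2norm.

(** * The lattice as an additive group *)

Section LatticeAction.
Context {R : realType} {d : nat}.
Variable L : set 'rV[R]_(d + d).
Hypothesis hL : is_lattice L.

Lemma lattice_add l m : L l -> L m -> L (l + m).
Proof.
have [A _ ->] := hL => -[z _ <-] [w _ <-]; exists (z + w) => //.
by rewrite map_mxD mulmxDr linearD.
Qed.

Lemma lattice_opp l : L l -> L (- l).
Proof.
have [A _ ->] := hL => -[z _ <-]; exists (- z) => //.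
by rewrite map_mxN mulmxN linearN.
Qed.

Lemma lattice_mem_addr l m : L m -> (l + m \in L) = (l \in L).
Proof.
move=> Lm; apply/idP/idP; rewrite !inE => h; last exact: lattice_add.
by rewrite -(addrK m l); apply: lattice_add => //; exact: lattice_opp.
Qed.

Lemma lattice_mem_opp l : (- l \in L) = (l \in L).
Proof.
apply/idP/idP; rewrite !inE => h; last exact: lattice_opp.
by rewrite -(opprK l); exact: lattice_opp.
Qed.

End LatticeAction.

(** * Gabor families and estimates by the norm of a window *)

Section GaborFamilies.
Context {R : realType} {d : nat}.
Local Notation lambda := (@lebesgue_rV R d).
Local Notation H := (L2Rd R d).
Local Notation nrm := (@L2norm _ _ _ lambda).
Local Notation I := ('rV[R]_(d + d) : choiceType).
Variable L : set 'rV[R]_(d + d).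
Hypothesis hL : is_lattice L.
Implicit Types (f g h : H) (l m z : 'rV[R]_(d + d)).

(* Extending the Gabor system by 0 off the lattice makes all families be indexed
   by the same type. *)
Definition gabor_family g l : H := if l \in L then tf_shift l g else 0.
Local Notation gab := gabor_family.

Lemma normc_inner_phase (t : R) f g : normc (inner f (expi t *: g)) = normc (inner f g).
Proof. by rewrite innerZr Normc.normcM conj_expi normc_expi mul1r. Qed.

Lemma frame_operatorE g f : frame_operator g L f = mixed (gab g) (gab g) f.
Proof.
rewrite /frame_operator /mixed; congr summability.sum; apply/funext => l.
by rewrite /gabor_family; case: ifP => // _; rewrite scaler0.
Qed.

Lemma normc_inner_tf_shiftV f h l :
  normc (inner f (tf_shift l h)) = normc (inner h (tf_shift (- l) f)).
Proof.
rewrite -(tf_shift_inner (- l)) tf_shift_comp addNr tf_shift0.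
by rewrite normc_inner_phase normc_innerC.
Qed.

Lemma gabor_family_swap f h l :
  normc (inner f (gab h l)) = normc (inner h (gab f (- l))).
Proof.
rewrite /gabor_family (lattice_mem_opp hL); case: ifP => _.
  exact: normc_inner_tf_shiftV.
by rewrite !inner0r.
Qed.

(** Vector and window exchange roles under l to -l, which preserves the lattice. The bound depends
    on the window h through its norm only, and on the orbit of f through its Bessel bound. *)
Lemma gabor_swap_bounded f h b : bessel (gab f) b ->
  l2_bounded (fun l : I => inner f (gab h l)) (b * nrm h ^+ 2).
Proof.
move=> [_ fb] F; apply: le_trans (fb h [fset (- l) | l in F]%fset).
rewrite big_imfset/=; last by move=> l m _ _; exact: oppr_inj.
apply: ler_sum => l _; rewrite le_eqVlt; apply/orP; left; apply/eqP.
exact: (congr1 (fun x => x ^+ 2) (gabor_family_swap f h l)).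
Qed.

Lemma gabor_family_tf_shift z l : exists t : R, forall g,
  gab (tf_shift z g) l = expi t *: tf_shift z (gab g l).
Proof.
rewrite /gabor_family; case: (l \in L).
  by have [t E] := tf_shift_commute l z; exists t => g; rewrite E.
by exists 0 => g; rewrite (linear_zero (tf_shift_linear z)) scaler0.
Qed.

Lemma tf_shift_opp_inner z f g :
  normc (inner f (tf_shift z g)) = normc (inner (tf_shift (- z) f) g).
Proof. by rewrite normc_inner_tf_shiftV normc_innerC. Qed.

Lemma gabor_bessel_tf_shift z g b : bessel (gab g) b ->
  bessel (gab (tf_shift z g)) b.
Proof.
move=> [b0 gb]; split; first exact: b0.
move=> f F.
rewrite -(tf_shift_norm (- z) f); apply: le_trans (gb _ F).
rewrite le_eqVlt; apply/orP; left; apply/eqP; apply: eq_bigr => l _.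
have [t E] := gabor_family_tf_shift z l.
by rewrite E normc_inner_phase tf_shift_opp_inner.
Qed.

Lemma expi_scale_cancel (t : R) (f g h : H) :
  inner f (expi t *: g) *: (expi t *: h) = inner f g *: h.
Proof.
rewrite innerZr scalerA mulrAC [conjc _ * _]mulrC expi_conjK mul1r//.
Qed.

Lemma tf_shift_mixed z g h f b b' : bessel (gab g) b -> bessel (gab h) b' ->
  tf_shift z (mixed (gab g) (gab h) f) =
  mixed (gab (tf_shift z g)) (gab (tf_shift z h)) (tf_shift z f).
Proof.
move=> gb hb; apply: usum_nrm_unique (mixed_usum _ (gabor_bessel_tf_shift z gb)
  (gabor_bessel_tf_shift z hb)).
have zK v : nrm (tf_shift z v) <= 1 * nrm v by rewrite tf_shift_norm mul1r.
apply: eq_usum (usum_map (linear_sub (tf_shift_linear z)) zK (@L2norm_ge0 _ _ _ _)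
  (mixed_usum f gb hb)) => l.
have [t E] := gabor_family_tf_shift z l.
by rewrite !E expi_scale_cancel tf_shift_inner (linear_scale (tf_shift_linear z)).
Qed.

Lemma gabor_family_translate m l : L m -> exists t : R, forall g,
  gab (tf_shift m g) l = expi t *: gab g (l + m).
Proof.
move=> Lm; rewrite /gabor_family (lattice_mem_addr hL)//; case: (l \in L).
  by eexists => g; rewrite tf_shift_comp.
by exists 0 => g; rewrite scaler0.
Qed.

(** Shifting both windows by a lattice point permutes the two families simultaneously, up to phases
    that cancel. *)
Lemma mixed_lattice_shift m g h f b b' : L m ->
  bessel (gab g) b -> bessel (gab h) b' ->
  mixed (gab (tf_shift m g)) (gab (tf_shift m h)) f = mixed (gab g) (gab h) f.
Proof.
move=> Lm gb hb; apply: usum_nrm_unique (mixed_usum _ (gabor_bessel_tf_shift m gb)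
  (gabor_bessel_tf_shift m hb)) _.
have := usum_reindex (p := fun l : I => l + m) (q := fun l : I => l - m)
  (addrK m) (subrK m) (mixed_usum f gb hb).
apply: eq_usum => l; have [t E] := gabor_family_translate l Lm.
by rewrite !E expi_scale_cancel.
Qed.

Lemma mixed_lattice_commute m g h f b b' : L m ->
  bessel (gab g) b -> bessel (gab h) b' ->
  tf_shift m (mixed (gab g) (gab h) f) = mixed (gab g) (gab h) (tf_shift m f).
Proof.
by move=> Lm gb hb; rewrite (tf_shift_mixed _ _ gb hb) (mixed_lattice_shift _ _ gb hb).
Qed.

(** The estimate for a small window h on the analysis side: [bh] is absent from the bound. *)
Lemma mixed_window_le g h f bg bh bf : bessel (gab g) bg -> bessel (gab h) bh ->
  bessel (gab f) bf ->
  nrm (mixed (gab h) (gab g) f) ^+ 2 <= bg * (bf * nrm h ^+ 2).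
Proof.
move=> gb hb fb; apply: (mixed_norm_le hb gb).
exact: gabor_swap_bounded fb.
Qed.

Variables (g : H) (A B : R).
Hypotheses (A0 : 0 < A) (AB : A <= B) (gAB : frame_bounds g L A B).

Lemma frame_bounds_esum f :
  ((A * nrm f ^+ 2)%:E <=
   (\esum_(l in [set: I]) (normc (inner f (gab g l)) ^+ 2)%:E)%R <=
   (B * nrm f ^+ 2)%:E)%E.
Proof.
have := gAB f; rewrite esum_mkcond.
rewrite (_ : (fun l : I => if l \in L then _ else _) =
  (fun l : I => (normc (inner f (gab g l)) ^+ 2)%:E)) //.
apply/funext => l; rewrite /gabor_family; case: ifP => // _.
by rewrite inner0r Normc.normc0 expr0n.
Qed.

Lemma frame_bessel : bessel (gab g) B.
Proof.
split => [|f F]; first exact: lt_le_trans A0 AB.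
have /andP[_ h] := frame_bounds_esum f.
by rewrite -lee_fin; apply: le_trans (fset_le_esum _ F) h.
Qed.

Local Notation S := (mixed (gab g) (gab g)).

Lemma frame_operator_form_bounds f :
  A * nrm f ^+ 2 <= Re (inner (S f) f) <= B * nrm f ^+ 2.
Proof.
by have := frame_bounds_esum f; rewrite (mixed_diag_esum f frame_bessel) !lee_fin.
Qed.

(* The adjoint of [mixed (gab g) (gab h)] is [mixed (gab h) (gab g)], which
   commutes with the lattice shifts; so the coefficients of the left-hand side
   against [gab g] are those of [f] against the orbit of a single vector. *)
Lemma mixed_target_le h f bh bf : bessel (gab h) bh -> bessel (gab f) bf ->
  nrm (mixed (gab g) (gab h) f) ^+ 2 <= A^-1 * (bf * (B * (B * nrm h ^+ 2))).
Proof.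
move=> hb fb; have gb := frame_bessel; have [bf0 _] := fb.
set u := mixed _ _ f; set w := mixed (gab h) (gab g) g.
have wle : nrm w ^+ 2 <= B * (B * nrm h ^+ 2) by exact: (mixed_window_le gb hb gb).
have coef l : normc (inner u (gab g l)) = normc (inner f (gab w l)).
  rewrite /u (mixed_adjoint f (gab g l) gb hb) /gabor_family; case: ifP => lL.
    by rewrite /w (mixed_lattice_commute _ _ hb gb)//; move: lL; rewrite inE.
  by rewrite (linear_zero (mixed_linear hb gb)).
have /andP[+ _] := frame_bounds_esum u.
move=> h1; rewrite ler_pdivlMl// -lee_fin; apply: le_trans h1 _.
apply: esum_le_fset => F; rewrite (eq_bigr (fun l => normc (inner f (gab w l)) ^+ 2)).
  by apply: le_trans (gabor_swap_bounded w fb F) _; rewrite ler_pM2l.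
by move=> l _; rewrite coef.
Qed.

End GaborFamilies.

(** * The dual window and the Parseval window under time-frequency shifts *)

Section DualWindows.
Context {R : realType} {d : nat}.
Local Notation C := R[i].
Local Notation lambda := (@lebesgue_rV R d).
Local Notation H := (L2Rd R d).
Local Notation nrm := (@L2norm _ _ _ lambda).
Local Notation I := ('rV[R]_(d + d) : choiceType).
Variable L : set 'rV[R]_(d + d).
Hypothesis hL : is_lattice L.
Local Notation gab := (gabor_family L).
Implicit Types (f h : H) (l m z : 'rV[R]_(d + d)).
Variables (g : H) (A B : R).
Hypotheses (A0 : 0 < A) (AB : A <= B) (gAB : frame_bounds g L A B).
Local Notation S := (mixed (gab g) (gab g)).
Local Notation T := (relaxation S B).
Local Notation q := (relaxation_rate A B).

Let B0 : 0 < B. Proof. exact: lt_le_trans A0 AB. Qed.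
Let gb : bessel (gab g) B. Proof. exact: (frame_bessel A0 AB gAB). Qed.
Let lS : linear S. Proof. exact: mixed_linear gb gb. Qed.
Let S_sym f h : inner (S f) h = inner f (S h).
Proof. exact: mixed_adjoint gb gb. Qed.
Let S_lower f : A * nrm f ^+ 2 <= Re (inner (S f) f).
Proof. by have /andP[] := frame_operator_form_bounds A0 AB gAB f. Qed.
Let S_upper f : Re (inner (S f) f) <= B * nrm f ^+ 2.
Proof. by have /andP[] := frame_operator_form_bounds A0 AB gAB f. Qed.
Let lT : linear T := relaxation_linear B lS.
Let q0 : 0 <= q := relaxation_rate_ge0 A0 AB.
Let q1 : q < 1 := relaxation_rate_lt1 A0 AB.
Let Tq f : nrm (T f) <= q * nrm f :=
  relaxation_contraction A0 AB lS S_sym S_lower S_upper f.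

Lemma relaxation_lattice_commute m f : L m -> tf_shift m (T f) = T (tf_shift m f).
Proof.
move=> Lm; rewrite /relaxation (linear_sub (tf_shift_linear m)).
rewrite (linear_scale (tf_shift_linear m)).
by rewrite (mixed_lattice_commute hL f Lm gb gb).
Qed.

(* A symmetric operator commuting with the lattice shifts moves to the other
   side of the Gabor coefficients. *)
Lemma inner_gabor_family_commute (U : H -> H) f h l : linear U ->
  (forall f1 f2, inner (U f1) f2 = inner f1 (U f2)) ->
  (forall m f1, L m -> tf_shift m (U f1) = U (tf_shift m f1)) ->
  inner f (gab (U h) l) = inner (U f) (gab h l).
Proof.
move=> lU Us UL; rewrite /gabor_family; case: (boolP (l \in L)) => lL.
  by rewrite UL ?Us//; move: lL; rewrite inE.
by rewrite !inner0r.
Qed.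

(** T^n is symmetric and commutes with lattice shifts, so the coefficients against the orbit of T^n
    g are those of T^n f against the orbit of g. The rate p replaces q because [bessel] wants a
    positive bound, while q = 0 for a tight frame with A = B. *)
Lemma relaxation_iter_bessel (p : R) n : q <= p -> 0 < p ->
  bessel (gab (iter n T g)) ((Num.sqrt B * p ^+ n) ^+ 2).
Proof.
move=> qp p0; split; first by rewrite exprn_gt0// mulr_gt0 ?sqrtr_gt0 ?exprn_gt0.
move=> f F.
rewrite (eq_bigr (fun l => normc (inner (iter n T f) (gab g l)) ^+ 2)); last first.
  move=> l _; congr (normc _ ^+ 2).
  apply: (@inner_gabor_family_commute (iter n T)).
  - exact: linear_iter.
  - move=> f1 f2; exact: (relaxation_iter_sym B S_sym n f1 f2).
  - move=> m f1 Lm; elim: n => [//|n IH]; rewrite !iterS.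
    exact: (etrans (relaxation_lattice_commute _ Lm) (congr1 T IH)).
have [_ h] := gb; apply: le_trans (h _ F) _.
rewrite exprMn sqr_sqrtr ?(ltW B0)// -mulrA ler_pM2l//.
rewrite -exprMn; apply: lerXn2r; rewrite ?nnegrE ?L2norm_ge0//.
  by rewrite mulr_ge0 ?exprn_ge0 ?L2norm_ge0// ltW.
apply: le_trans (iter_contraction q0 Tq n f) _; rewrite ler_wpM2r ?L2norm_ge0//.
by apply: lerXn2r; rewrite ?nnegrE// ltW.
Qed.

(** The factor 1/B is the one in T = 1 - S/B. The two summands come from the window difference on
    the analysis side and on the synthesis side; the second pays for the lower frame bound. *)
Definition window_constant : R := B^-1 * (Num.sqrt B + Num.sqrt A^-1 * B).

Lemma relaxation_tf_shift_step z f s : 0 < s -> bessel (gab f) (s ^+ 2) ->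
  nrm (tf_shift z (T f) - T f) <=
  q * nrm (tf_shift z f - f) + window_constant * s * nrm (tf_shift z g - g).
Proof.
move=> s0 fb; set r := tf_shift z; set D := r g - g.
have lr : linear r by exact: tf_shift_linear.
have rgb : bessel (gab (r g)) B by exact: gabor_bessel_tf_shift.
have rfb : bessel (gab (r f)) (s ^+ 2) by exact: gabor_bessel_tf_shift.
have ED l : gab D l = gab (r g) l - gab g l.
  rewrite /gabor_family; case: (l \in L); last by rewrite subr0.
  exact: (linear_sub (tf_shift_linear l)).
have Db : bessel (gab D) (2 * (B + B)).
  by rewrite (_ : gab D = (fun l => gab (r g) l - gab g l)); [exact: bessel_sub|exact/funext].
(* The commutator r S f - S r f is S_{rg,rg} r f - S_{g,g} r f; the intermediate operator S_{g,rg}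
   changes one window at a time. *)
set u := mixed (gab D) (gab (r g)) (r f); set v := mixed (gab g) (gab D) (r f).
have uE : u = mixed (gab (r g)) (gab (r g)) (r f) - mixed (gab g) (gab (r g)) (r f).
  exact: (mixed_subl (r f) rgb gb Db rgb ED).
have vE : v = mixed (gab g) (gab (r g)) (r f) - S (r f).
  exact: (mixed_subr (r f) rgb gb Db gb ED).
have uv : u + v = r (S f) - S (r f).
  have -> : r (S f) = mixed (gab (r g)) (gab (r g)) (r f).
    exact: (tf_shift_mixed z f gb gb).
  have tele (V : zmodType) (a b c x y : V) : x = a - b -> y = b - c -> x + y = a - c.
    by move=> -> ->; rewrite addrA subrK.
  exact: (tele _ _ _ _ _ _ uE vE).
have TE : r (T f) - T f = T (r f - f) - (B^-1)%:C *: (u + v).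
  have E1 : r (T f) = r f - (B^-1)%:C *: r (S f).
    by rewrite /relaxation (linear_sub lr) (linear_scale lr).
  have E2 : (B^-1)%:C *: (u + v) = (B^-1)%:C *: r (S f) - (B^-1)%:C *: S (r f).
    by rewrite uv scalerBr.
  have arith (V : zmodType) (a b c t x y w e : V) :
      x = a - b -> y = a - c -> w = y - t -> e = b - c -> x - t = w - e.
    by move=> -> -> -> ->; rewrite opprB [a - c - t]addrAC addrA subrK addrAC.
  exact: (arith _ _ _ _ _ _ _ _ _ E1 erefl (linear_sub lT _ _) E2).
have Bi : 0 < B^-1 by rewrite invr_gt0.
have ule : nrm u <= Num.sqrt B * s * nrm D.
  rewrite -(@ler_pXn2r _ 2) ?nnegrE ?mulr_ge0 ?L2norm_ge0 ?sqrtr_ge0 ?(ltW s0)//.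
  rewrite !exprMn sqr_sqrtr ?(ltW B0)// -mulrA.
  exact: (mixed_window_le hL rgb Db rfb).
have vle : nrm v <= Num.sqrt A^-1 * B * s * nrm D.
  rewrite -(@ler_pXn2r _ 2) ?nnegrE ?mulr_ge0 ?L2norm_ge0 ?sqrtr_ge0 ?(ltW s0) ?(ltW B0)//.
  rewrite !exprMn sqr_sqrtr ?invr_ge0 ?(ltW A0)//.
  apply: le_trans (mixed_target_le hL A0 AB gAB Db rfb) _.
  by rewrite le_eqVlt; apply/orP; left; apply/eqP; ring.
rewrite TE; apply: le_trans (L2norm_triangleB _ _) _; apply: lerD; first exact: Tq.
rewrite L2norm_scale normc_real ger0_norm ?(ltW Bi)// /window_constant -!mulrA ler_pM2l//.
apply: le_trans (L2norm_triangle _ _) _; apply: le_trans (lerD ule vle) _.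
by rewrite le_eqVlt; apply/orP; left; apply/eqP; ring.
Qed.

Lemma relaxation_iter_tf_shift : exists M r : R, [/\ 0 <= M, 0 <= r, r < 1 &
  forall z n, nrm (tf_shift z (iter n T g) - iter n T g) <=
    M * r ^+ n * nrm (tf_shift z g - g)].
Proof.
(* The recursion is e_{n+1} <= q e_n + K p^n e. The rate p is positive even if q = 0, and the gap
   between p and r absorbs the accumulated inhomogeneous terms. *)
pose p := (1 + q) / 2; pose r := (1 + p) / 2.
have qp : q <= p by rewrite /p; move: q1; lra.
have p0 : 0 < p by rewrite /p; move: q0; lra.
have p1 : p < 1 by rewrite /p; move: q1; lra.
have pr : p < r by rewrite /r; lra.
have r1 : r < 1 by rewrite /r; lra.
pose K := window_constant * Num.sqrt B.
have K0 : 0 <= K.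
  rewrite /K /window_constant !mulr_ge0 ?sqrtr_ge0 ?invr_ge0 ?(ltW B0)//.
  by rewrite addr_ge0 ?mulr_ge0 ?sqrtr_ge0 ?(ltW B0).
have rp : 0 < r - p by rewrite subr_gt0.
(* The induction step p M + K <= M r amounts to M (r - p) - K >= 0; this difference is r - p here,
   and the summand 1 settles n = 0. *)
pose M := 1 + K / (r - p).
have M1 : 1 <= M by rewrite lerDl divr_ge0// ltW.
exists M, r; split => //; [exact: le_trans M1|exact: ltW (lt_trans p0 pr)|].
move=> z; set e := nrm (tf_shift z g - g).
have e0 : 0 <= e by exact: L2norm_ge0.
elim=> [|n IH]; first by rewrite expr0 mulr1 /= ler_peMl.
rewrite iterS.
have sB : 0 < Num.sqrt B * p ^+ n by rewrite mulr_gt0 ?sqrtr_gt0 ?exprn_gt0.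
apply: le_trans (relaxation_tf_shift_step z sB (relaxation_iter_bessel n qp p0)) _.
rewrite -/e.
have h1 : q * nrm (tf_shift z (iter n T g) - iter n T g) <= p * (M * r ^+ n * e).
  by apply: ler_pM => //; rewrite ?L2norm_ge0.
have h2 : window_constant * (Num.sqrt B * p ^+ n) * e <= K * (r ^+ n * e).
  rewrite [leLHS](_ : _ = K * (p ^+ n * e)); last by rewrite /K; ring.
  rewrite ler_wpM2l// ler_wpM2r//.
  by apply: lerXn2r; rewrite ?nnegrE ?(ltW p0) ?(ltW (lt_trans p0 pr))// ltW.
apply: le_trans (lerD h1 h2) _; rewrite -subr_ge0.
rewrite [leRHS](_ : _ = (M * (r - p) - K) * (r ^+ n * e)); last by rewrite exprS; ring.
rewrite mulr_ge0 ?mulr_ge0 ?exprn_ge0 ?(ltW (lt_trans p0 pr))//.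
rewrite (_ : _ - _ = r - p); first exact: ltW.
by rewrite /M mulrDl mul1r divfK ?gt_eqF// addrK.
Qed.

Lemma power_series_tf_shift a : unit_coef a -> exists K : R, forall z,
  nrm (tf_shift z (power_series T q a g) - power_series T q a g) <=
  K * nrm (tf_shift z g - g).
Proof.
move=> a01; have [M [r [M0 r0 r1 hM]]] := relaxation_iter_tf_shift.
have r1' : 0 < 1 - r by rewrite subr_gt0.
exists (M / (1 - r)) => z; set e := nrm (tf_shift z g - g); set s := power_series _ _ _ _.
have e0 : 0 <= e by exact: L2norm_ge0.
have lz := tf_shift_linear (d := d) z.
have part n : nrm (tf_shift z (psum T a n g) - psum T a n g) <=
    (1 - r ^+ n) / (1 - r) * M * e.
  elim: n => [|n IH].
    by rewrite /psum !big_ord0 (linear_zero lz) subrr L2norm0 expr0 subrr !mul0r.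
  rewrite /psum !big_ord_recr/= -/(psum T a n g) (linear_add lz) (linear_scale lz).
  rewrite opprD addrACA -scalerBr; apply: le_trans (L2norm_triangle _ _) _.
  apply: le_trans (lerD IH (_ : _ <= M * r ^+ n * e)) _.
    rewrite L2norm_scale normc_real; have /andP[a0 a1] := a01 n.
    rewrite ger0_norm//; apply: le_trans (hM z n).
    by rewrite ler_piMl ?L2norm_ge0.
  by rewrite le_eqVlt; apply/orP; left; apply/eqP; rewrite exprS; field; rewrite gt_eqF.
apply/ler_addgt0Pr => eps eps0.
have [n hn] := geometric_lt q0 q1 (2 * (nrm g / (1 - q))) eps0.
have hP := power_seriesP q0 q1 Tq g n a01; rewrite -/s in hP.
(* The remainder of the series is not compared with e: the shift is an isometry, so it costs at most
   twice its norm, which is below any [eps] for large n. *)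
rewrite (_ : _ - s = (tf_shift z (psum T a n g) - psum T a n g) +
   (tf_shift z (s - psum T a n g) - (s - psum T a n g))); last first.
  rewrite (linear_sub lz) opprB; set x := tf_shift z (psum _ _ _ _).
  by rewrite [RHS]addrA [X in _ = X + _]addrC [X in _ = X + _]addrA subrK
    [RHS]addrA subrK.
apply: le_trans (L2norm_triangle _ _) _; apply: lerD.
  apply: le_trans (part n) _; rewrite ler_wpM2r// [M / _]mulrC ler_wpM2r//.
  by rewrite ler_piMl ?invr_ge0 ?(ltW r1')// gerBl exprn_ge0.
apply: le_trans (L2norm_triangleB _ _) _; rewrite tf_shift_norm.
apply: le_trans (lerD hP hP) _; apply: le_trans (ltW hn).
by rewrite le_eqVlt; apply/orP; left; apply/eqP; ring.
Qed.

Local Notation S_inv := (inverse_operator (frame_operator g L)).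

Lemma frame_operator_fun : frame_operator g L = S.
Proof. by apply/funext => f; exact: frame_operatorE. Qed.

Lemma S_invE f : S_inv f = neumann_inverse S A B f.
Proof.
rewrite frame_operator_fun.
exact: (inverse_operatorE A0 AB lS S_sym S_lower S_upper).
Qed.

Lemma S_inv_sqrtE f : sqrt_operator S_inv f = neumann_inverse_sqrt S A B f.
Proof.
apply: (sqrt_operatorE A0 AB lS S_sym S_lower S_upper) => h.
exact: S_invE.
Qed.

Let one_unit : unit_coef (fun=> 1 : R).
Proof. by move=> n; rewrite ler01 lexx. Qed.

Lemma scaled_tf_shift (c : R) (x : H) : (exists K : R, forall z,
    nrm (tf_shift z x - x) <= K * nrm (tf_shift z g - g)) ->
  exists K : R, forall z,
    nrm (tf_shift z (c%:C *: x) - c%:C *: x) <= K * nrm (tf_shift z g - g).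
Proof.
move=> [K hK]; exists (`|c| * K) => z.
rewrite (linear_scale (tf_shift_linear z)) -scalerBr L2norm_scale normc_real.
by rewrite -mulrA ler_wpM2l.
Qed.

Lemma dual_window_tf_shift : exists K : R, forall z,
  nrm (tf_shift z (S_inv g) - S_inv g) <= K * nrm (tf_shift z g - g).
Proof.
rewrite S_invE; apply: scaled_tf_shift; exact: power_series_tf_shift.
Qed.

Lemma parseval_window_tf_shift : exists K : R, forall z,
  nrm (tf_shift z (sqrt_operator S_inv g) - sqrt_operator S_inv g) <=
  K * nrm (tf_shift z g - g).
Proof.
rewrite S_inv_sqrtE; apply: scaled_tf_shift; apply: power_series_tf_shift.
exact: isqrt_coef_unit.
Qed.

(** Z = S^(-1/2) is symmetric and commutes with lattice shifts, so <f, pi(l) Z g> = <Z f, pi(l) g>.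
    The squares sum to <S Z f, Z f> = <S Z Z f, f> = <f, f>. *)
Lemma parseval_window : parseval_gabor_frame (sqrt_operator S_inv g) L.
Proof.
rewrite S_inv_sqrtE; set Z := neumann_inverse_sqrt S A B => f.
have lZ : linear Z.
  by have [] := scaled_power_series_bounded A0 AB lS S_sym S_lower S_upper
    (Num.sqrt B^-1) (@isqrt_coef_unit R).
have psU U K : linear U -> (forall f, nrm (U f) <= K * nrm f) ->
    (forall f, U (T f) = T (U f)) -> forall f, U (Z f) = Z (U f).
  move=> lU UK UT f'; rewrite /Z /neumann_inverse_sqrt (linear_scale lU).
  by rewrite (power_series_commute q0 q1 Tq f' (@isqrt_coef_unit R) lU UK UT).
have ZL m f' : L m -> tf_shift m (Z f') = Z (tf_shift m f').
  move=> Lm; apply: (psU _ 1 (tf_shift_linear m)) => [h|h].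
    by rewrite tf_shift_norm mul1r.
  exact: relaxation_lattice_commute.
have ZS f' : Z (S f') = S (Z f').
  have ZT h : Z (T h) = T (Z h) by rewrite (psU _ q lT Tq).
  rewrite !(S_relaxation S A0 AB) (linear_scale lZ) (linear_sub lZ).
  by rewrite ZT.
have Zs : forall f1 f2, inner (Z f1) f2 = inner f1 (Z f2).
  exact: (neumann_inverse_sqrt_sym A0 AB lS S_sym S_lower S_upper).
rewrite mul1r esum_mkcond.
have E : (\esum_(i in [set: I]) (normc (inner (Z f) (gab g i)) ^+ 2)%:E)%R =
    (nrm f ^+ 2)%:E.
  rewrite (mixed_diag_esum (Z f) gb) -Zs ZS.
  have -> : Z (Z f) = neumann_inverse S A B f.
    exact: (neumann_inverse_sqrtK A0 AB lS S_sym S_lower S_upper).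
  rewrite (S_neumann_inverse A0 AB lS S_sym S_lower S_upper).
  by rewrite inner_norm.
suff -> : (\esum_(i in [set: I])
    (if i \in L then (normc (inner f (tf_shift i (Z g))) ^+ 2)%:E else 0%E))%R
   = (nrm f ^+ 2)%:E by rewrite lexx.
rewrite -E; apply: eq_esum => l _.
have := inner_gabor_family_commute f g l lZ Zs ZL.
rewrite /gabor_family; case: (l \in L) => [->//|_].
by rewrite inner0r Normc.normc0 expr0n.
Qed.

End DualWindows.

Local Transparent inner tf_shift L2norm.

(** * First and second order estimates on the line *)

Section TaylorEstimates.
Context {R : realType}.

Lemma mean_value_bound (f f1 : R -> R) (M a b : R) :
  (forall x : R, is_derive x 1 f (f1 x)) ->
  (forall x, Num.min a b <= x <= Num.max a b -> `|f1 x| <= M) ->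
  `|f b - f a| <= M * `|b - a|.
Proof.
move=> df.
have main u v : u <= v -> (forall x, u <= x <= v -> `|f1 x| <= M) ->
    `|f v - f u| <= M * `|v - u|.
  move=> uv fM.
  have [|c cuv ->] := @MVT_segment R f f1 u v uv (fun x _ => df x).
    by apply: derivable_within_continuous => x _; exact: ex_derive.
  by rewrite normrM ler_wpM2r// fM; move: cuv; rewrite in_itv.
have [ab|ba] := leP a b.
  by move=> fM; apply: main.
by move=> fM; rewrite distrC [ `|b - a|]distrC; apply: main => //; exact: ltW.
Qed.

(** Two applications of the mean value bound: f minus its tangent has derivative f1 x - f1 0, at
    most M |t| between 0 and t. The factor 1/2 is given up, since only the order t^2 matters. *)
Lemma taylor2_bound (f f1 f2 : R -> R) (M t : R) :
  (forall x : R, is_derive x 1 f (f1 x)) -> (forall x : R, is_derive x 1 f1 (f2 x)) ->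
  (forall x, `|f2 x| <= M) ->
  `|f t - f 0 - t * f1 0| <= M * t ^+ 2.
Proof.
move=> df df1 fM.
have M0 : 0 <= M by exact: le_trans (fM 0).
pose g s := f s - f1 0 * s.
have dg (x : R) : is_derive x 1 g (f1 x - f1 0).
  have dfx := df x.
  by apply: is_derive_eq; rewrite [f1 0 *: 1]mulr1.
rewrite (_ : f t - f 0 - t * f1 0 = g t - g 0); last by rewrite /g; ring.
rewrite (_ : M * t ^+ 2 = M * `|t| * `|t - 0|); last first.
  by rewrite subr0 -mulrA -expr2 real_normK ?num_real.
apply: (mean_value_bound (M := M * `|t|) dg) => x xt.
have := @mean_value_bound f1 f2 M 0 x df1 (fun x _ => fM x).
rewrite subr0 => h; apply: le_trans h _; rewrite ler_wpM2l//.
move: xt; have [t0|t0] := leP 0 t => /andP[x1 x2].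
  by rewrite !ger0_norm.
by rewrite !ler0_norm ?lerN2 ?(ltW t0).
Qed.

Lemma abs_sin_le (t : R) : `|sin t| <= `|t|.
Proof.
have := @mean_value_bound sin cos 1 0 t (fun x => is_derive_sin x) (fun x _ => cos_max x).
by rewrite sin0 !subr0 mul1r.
Qed.

Lemma abs_cos_sub1_le (t : R) : `|cos t - 1| <= `|t|.
Proof.
have := @mean_value_bound cos (fun x => - sin x) 1 0 t (fun x => is_derive_cos x).
by rewrite cos0 subr0 mul1r; apply => x _; rewrite normrN; exact: sin_max.
Qed.

Lemma abs_sin_sub_le (t : R) : `|sin t - t| <= t ^+ 2.
Proof.
have := @taylor2_bound sin cos (fun x => - sin x) 1 t
   (fun x => is_derive_sin x) (fun x => is_derive_cos x).
rewrite sin0 cos0 subr0 mulr1 mul1r; apply => x.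
by rewrite normrN; exact: sin_max.
Qed.

Lemma abs_cos_sub1_le_sqr (t : R) : `|cos t - 1| <= t ^+ 2.
Proof.
have := @taylor2_bound cos (fun x => - sin x) (fun x => - cos x) 1 t
   (fun x => is_derive_cos x).
rewrite cos0 sin0 oppr0 mulr0 subr0 mul1r; apply => x.
by rewrite normrN; exact: cos_max.
Qed.

Lemma normc_expi_sub1_le (t : R) : normc (expi t - 1) <= 2 * `|t|.
Proof.
apply: le_trans (normc_le_ReIm _) _; rewrite /= subr0.
by have := abs_sin_le t; have := abs_cos_sub1_le t; lra.
Qed.

End TaylorEstimates.

Lemma invn_cvg0 {R : realType} : (fun n : nat => n.+1%:R^-1 : R) @ \oo --> 0.
Proof. exact: cvg_harmonic. Qed.

(** * The weighted space and Lipschitz modulations *)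

Section WeightedSpace.
Context {R : realType} {d : nat}.
Local Notation C := R[i].
Local Notation lambda := (@lebesgue_rV R d).
Local Notation sqi := (square_integrable lambda).
Local Notation H := (L2Rd R d).
Local Notation nrm := (@L2norm _ _ _ lambda).
Implicit Types (f g h : H) (x : 'rV[R]_d) (i : 'I_d).

Definition axis i (t : R) : 'rV[R]_d := t *: delta_mx ord0 i.

Lemma dot_axis i t x : dot (axis i t) x = t * x ord0 i.
Proof.
rewrite /dot (bigD1 i)//= big1 ?addr0; last first.
  by move=> j ji; rewrite !mxE eqxx (negbTE ji) mulr0 mul0r.
by rewrite !mxE !eqxx mulr1.
Qed.

Definition mod_axis i t : 'rV[R]_(d + d) := row_mx 0 (axis i t).
Definition trans_axis i t : 'rV[R]_(d + d) := row_mx (axis i t) 0.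

Lemma abs_coord_le i x : `|x ord0 i| <= euclidean_norm x.
Proof.
rewrite -sqrtr_sqr ler_wsqrtr// /dot (bigD1 i)//= -expr2 lerDl.
by apply: sumr_ge0 => j _; rewrite -expr2 sqr_ge0.
Qed.

Lemma euclidean_norm_le x : euclidean_norm x <= \sum_i `|x ord0 i|.
Proof.
rewrite -[leRHS]ger0_norm ?sumr_ge0// -sqrtr_sqr ler_wsqrtr//.
rewrite expr2 mulr_suml; apply: ler_sum => i _.
by rewrite -expr2 -real_normK ?num_real// expr2 ler_wpM2l// rV_coord_bound.
Qed.

Lemma measurable_euclidean_norm : measurable_fun setT (@euclidean_norm R d).
Proof.
apply: (measurableT_comp (f := @Num.sqrt R)).
  by apply: continuous_measurable_fun; exact: sqrt_continuous.
apply: measurable_sum => i.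
by apply: measurable_funM; exact: (measurable_rV_coord i).
Qed.

Lemma tf_fun_mod_axis i t (u : 'rV[R]_d -> C) x :
  tf_fun (mod_axis i t) u x = expi (2 * pi * (t * x ord0 i)) * u x.
Proof. by rewrite tf_funE row_mxKl row_mxKr subr0 dot_axis. Qed.

Lemma tf_shift_sub_norm (l : 'rV[R]_(d + d)) f (u : 'rV[R]_d -> C) : u \in sqi ->
  (f : _ -> C) = u %[ae lambda] ->
  ((nrm (tf_shift l f - f) ^+ 2)%:E =
   \int[lambda]_x ((normc (tf_fun l u x - u x)) ^+ 2)%:E)%E.
Proof.
move=> su fu; rewrite -L2norm_class; last by apply: sqiB => //; exact: tf_fun_sqi.
congr ((nrm _ ^+ 2)%:E); apply/esym/L2_classP.
  by apply: sqiB => //; exact: tf_fun_sqi.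
apply: ae_eq_sym; apply: ae_eq_trans (L2_subE _ _) _.
by apply: filterS2 (tf_shift_ae l fu) fu => x /= h1 h2 xT; rewrite h1// h2.
Qed.

(** Pointwise, |exp(2 pi i t x_i) - 1| is at most 4 pi |t| |x_i|, hence at most 4 pi |t| times the
    weight. *)
Lemma weighted_modulation_lipschitz g : L2_weighted g -> forall i,
  exists K : R, forall t, nrm (tf_shift (mod_axis i t) g - g) <= K * `|t|.
Proof.
rewrite /L2_weighted /= => sg i.
pose w x : C := (1 + euclidean_norm x)%:C * g x.
exists (4 * pi * L2norm (L2_class lambda w)) => t.
have pi0 : 0 <= 4 * pi :> R by rewrite mulr_ge0// pi_ge0.
rewrite -(@ler_pXn2r _ 2) ?nnegrE ?L2norm_ge0 ?mulr_ge0 ?L2norm_ge0//.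
rewrite -lee_fin (tf_shift_sub_norm _ (L2_sqi g) (ae_eq_refl _ _ _)).
rewrite (_ : _ * `|t| = L2norm (L2_class lambda (fun x => (4 * pi * t)%:C * w x))).
  rewrite L2norm_class; last exact: sqiZ.
  apply: ge0_le_integral => //.
  - by move=> x _; rewrite lee_fin sqr_ge0.
  - apply/measurable_EFinP; apply: measurable_funX; apply: measurable_normc.
    by apply: (sqi_measurable (sqiB (tf_fun_sqi _ (L2_sqi g)) (L2_sqi g))).
  - apply/measurable_EFinP; apply: measurable_funX; apply: measurable_normc.
    exact: (sqi_measurable (sqiZ _ sg)).
  move=> x _; rewrite lee_fin ler_pXn2r ?nnegrE ?normc_ge0//.
  rewrite tf_fun_mod_axis -[X in _ - X]mul1r -mulrBl /w !Normc.normcM !normc_real.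
  rewrite [leRHS]mulrA ler_wpM2r ?normc_ge0//.
  apply: le_trans (normc_expi_sub1_le _) _.
  have e0 : 0 <= euclidean_norm x by exact: sqrtr_ge0.
  rewrite [ `|1 + _|]ger0_norm ?addr_ge0//.
  rewrite !normrM !normr_nat (ger0_norm (pi_ge0 R)).
  have := abs_coord_le i x; have := pi_ge0 R; have := normr_ge0 t.
  set y := `|x _ _|; move: (pi : R) `|t| => p s s0 p0 yx.
  rewrite [leLHS](_ : _ = 4 * p * s * y); last by ring.
  by apply: ler_wpM2l; [rewrite !mulr_ge0|lra].
rewrite L2_classZ// L2norm_scale normc_real !normrM normr_nat.
  by rewrite (ger0_norm (pi_ge0 R)); ring.
exact: pi_ge0.
Qed.

Lemma sqi_abs (u : 'rV[R]_d -> C) : u \in sqi -> (fun x => (normc (u x))%:C) \in sqi.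
Proof.
move=> su; apply: (sqi_le _ su) => [|x]; last first.
  by rewrite normc_real ger0_norm ?normc_ge0.
split; last exact: measurable_cst.
exact: measurable_normc (sqi_measurable su).
Qed.

Lemma sqi_sum (J : Type) (r : seq J) (u : J -> 'rV[R]_d -> C) :
  (forall j, u j \in sqi) -> (fun x => \sum_(j <- r) u j x) \in sqi.
Proof.
move=> su; elim: r => [|j r IH].
  rewrite (_ : (fun _ => _) = (fun x => 0 * (L2_class lambda (fun=> 0) : H) x)).
    by apply: sqiZ; exact: L2_sqi.
  by apply/funext => x; rewrite big_nil mul0r.
rewrite (_ : (fun _ => _) = (fun x => u j x + \sum_(k <- r) u k x)); first exact: sqiD.
by apply/funext => x; rewrite big_cons.
Qed.

(** The difference quotients of modulations have norm at most K and converge pointwise to 2 pi i x_i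
    f(x); Fatou makes the limit square integrable. *)
Lemma modulation_lipschitz_coord f i (K : R) :
  (forall t, nrm (tf_shift (mod_axis i t) f - f) <= K * `|t|) ->
  (fun x => (x ord0 i)%:C * f x) \in sqi.
Proof.
move=> fK; pose t_ n : R := n.+1%:R^-1.
have t0 n : 0 < t_ n by rewrite invr_gt0.
pose v_ n x : C := ((t_ n)^-1)%:C * (tf_fun (mod_axis i (t_ n)) f x - f x).
pose c x : R := 2 * pi * x ord0 i.
pose v x : C := (0 +i* c x) * f x.
have sv n : v_ n \in sqi.
  by apply: sqiZ; apply: sqiB; [exact: tf_fun_sqi (L2_sqi f)|exact: L2_sqi].
have vE n x : v_ n x = (((t_ n)^-1)%:C * (expi (c x * t_ n) - 1)) * f x.
  rewrite /v_ tf_fun_mod_axis -[RHS]mulrA; congr (_ * _).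
  rewrite [RHS]mulrBl mul1r; congr (expi _ * _ - _).
  by rewrite /c; ring.
have cre x : (fun n => Re (((t_ n)^-1)%:C * (expi (c x * t_ n) - 1))) @ \oo --> (0 : R).
  apply/cvgr0Pnorm_le => e e0.
  have : (fun n => (c x ^+ 2) * t_ n) @ \oo --> 0.
    by rewrite -(mulr0 (c x ^+ 2)); apply: cvgM; [exact: cvg_cst|exact: invn_cvg0].
  move=> /cvgr0Pnorm_le/(_ e e0); apply: filterS => n; apply: le_trans.
  rewrite [Re _](_ : _ = (t_ n)^-1 * (cos (c x * t_ n) - 1)); last by rewrite /=; ring.
  rewrite normrM gtr0_norm ?invr_gt0// ler_pdivrMl//.
  apply: le_trans (abs_cos_sub1_le_sqr _) _.
  rewrite (ger0_norm (mulr_ge0 (sqr_ge0 (c x)) (ltW (t0 n)))).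
  by rewrite le_eqVlt; apply/orP; left; apply/eqP; ring.
have cim x : (fun n => Im (((t_ n)^-1)%:C * (expi (c x * t_ n) - 1))) @ \oo --> c x.
  apply/cvgrPdist_le => e e0.
  have : (fun n => (c x ^+ 2) * t_ n) @ \oo --> 0.
    by rewrite -(mulr0 (c x ^+ 2)); apply: cvgM; [exact: cvg_cst|exact: invn_cvg0].
  move=> /cvgr0Pnorm_le/(_ e e0); apply: filterS => n; apply: le_trans.
  rewrite distrC.
  rewrite [Im _](_ : _ = (t_ n)^-1 * sin (c x * t_ n)); last by rewrite /=; ring.
  rewrite (_ : _ - _ = (t_ n)^-1 * (sin (c x * t_ n) - c x * t_ n)); last first.
    by rewrite mulrBr mulrCA mulVf ?gt_eqF// mulr1.
  rewrite normrM gtr0_norm ?invr_gt0// ler_pdivrMl//.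
  apply: le_trans (abs_sin_sub_le _) _.
  rewrite (ger0_norm (mulr_ge0 (sqr_ge0 (c x)) (ltW (t0 n)))).
  by rewrite le_eqVlt; apply/orP; left; apply/eqP; ring.
have [mv iv] : cmeasurable v /\ (\int[lambda]_x ((normc (v x)) ^+ 2)%:E <= (K ^+ 2)%:E)%E.
  apply: (@sqi_fatou _ _ _ _ v_).
  - by move=> n; apply: (sqi_measurable (sv n)).
  - move=> x; rewrite /v ReM; under eq_fun do rewrite vE ReM.
    by apply: cvgB; apply: cvgM; rewrite /=; by [exact: cvg_cst|exact: cre|exact: cim].
  - move=> x; rewrite /v ImM; under eq_fun do rewrite vE ImM.
    by apply: cvgD; apply: cvgM; rewrite /=; by [exact: cvg_cst|exact: cre|exact: cim].
  - move=> n; rewrite -L2norm_class// lee_fin.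
    have su : (fun x => tf_fun (mod_axis i (t_ n)) f x - f x) \in sqi.
      by apply: sqiB; [exact: tf_fun_sqi (L2_sqi f)|exact: L2_sqi].
    have K0 : 0 <= K.
      by have := le_trans (L2norm_ge0 _) (fK 1); rewrite normr1 mulr1.
    rewrite ler_pXn2r ?nnegrE ?L2norm_ge0// /v_ L2_classZ// L2norm_scale.
    rewrite normc_real gtr0_norm ?invr_gt0// ler_pdivrMl//.
    have := fK (t_ n); rewrite (gtr0_norm (t0 n)) mulrC; apply: le_trans.
    rewrite -(@ler_pXn2r _ 2) ?nnegrE ?L2norm_ge0// -lee_fin.
    by rewrite L2norm_class// (tf_shift_sub_norm _ (L2_sqi f) (ae_eq_refl _ _ _)).
have sv0 : v \in sqi by apply/sqiP; split => //; apply: le_lt_trans iv _; rewrite ltry.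
rewrite (_ : (fun x => _) = (fun x => (0 +i* (2 * pi)^-1) * - v x)).
  rewrite (_ : (fun x => _) = (fun x => (- (0 +i* (2 * pi)^-1)) * v x)).
    exact: sqiZ.
  by apply/funext => x; rewrite mulrN mulNr.
apply/funext => x; rewrite /v mulrN mulrA -mulNr; congr (_ * _).
have p0 : pi != 0 :> R by rewrite gt_eqF// pi_gt0.
rewrite /c; move: (pi : R) p0 => p p0.
by apply: complexP => /=; [field|ring].
Qed.

(** Since |x| is at most the sum of the |x_i|, the weighted function is dominated by |f| plus the
    sum of the |x_i f|. *)
Lemma modulation_lipschitz_weighted f :
  (forall i, exists K : R, forall t, nrm (tf_shift (mod_axis i t) f - f) <= K * `|t|) ->
  L2_weighted f.
Proof.
move=> fK; rewrite /L2_weighted /=.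
have sx i : (fun x => (x ord0 i)%:C * f x) \in sqi.
  by have [K hK] := fK i; exact: modulation_lipschitz_coord hK.
pose w x : C := (normc (f x))%:C + \sum_i (normc ((x ord0 i)%:C * f x))%:C.
have sw : w \in sqi.
  apply: sqiD; first by apply: sqi_abs; exact: L2_sqi.
  by apply: sqi_sum => j; exact: sqi_abs.
apply: (sqi_le _ sw) => [|x].
  apply: cmeasurableM; last exact: (sqi_measurable (L2_sqi f)).
  split; last exact: measurable_cst.
  by apply: measurable_funD => //; exact: measurable_euclidean_norm.
have E : w x = ((1 + \sum_i `|x ord0 i|) * normc (f x))%:C.
  rewrite /w mulrDl mul1r mulr_suml rmorphD rmorph_sum; congr (_ + _).
  by apply: eq_bigr => i _; rewrite Normc.normcM normc_real.
rewrite E normc_real Normc.normcM normc_real.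
rewrite !ger0_norm ?mulr_ge0 ?addr_ge0 ?sumr_ge0 ?normc_ge0 ?sqrtr_ge0//.
by rewrite ler_wpM2r ?normc_ge0// lerD2l euclidean_norm_le.
Qed.

End WeightedSpace.

(** * Measurability and boundedness of continuous functions *)

Section ContinuousMeasurable.
Context {R : realType} {d : nat}.

(** The sigma-algebra is generated by the coordinates, not by the topology. The link is that U is
    the union of the countably many rational boxes contained in it; [F p] is empty for the other
    boxes. *)
Lemma open_measurable_rV (U : set 'rV[R]_d) : open U -> measurable U.
Proof.
move=> oU.
pose F (p : 'rV[rat]_d * 'rV[rat]_d) : set 'rV[R]_d :=
  [set x | open_box (map_mx ratr p.1) (map_mx ratr p.2) `<=` U /\
           open_box (map_mx ratr p.1) (map_mx ratr p.2) x].
rewrite (_ : U = \bigcup_p F p).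
  apply: countable_bigcupT_measurable => // p.
  have [h|h] := pselect (open_box (map_mx ratr p.1) (map_mx ratr p.2) `<=` U).
    rewrite (_ : F p = open_box (map_mx ratr p.1) (map_mx ratr p.2)).
      exact: measurable_open_box.
    by apply/seteqP; split => [x []//|x hx]; split.
  by rewrite (_ : F p = set0)//; apply/seteqP; split => [x []//|].
apply/seteqP; split => [x Ux|x [p _ [h]]]; last exact: h.
have /nbhs_ballP[e /= e0 he] : nbhs x U by apply: open_nbhs_nbhs.
have ha i : exists q : rat, ratr q \in `]x ord0 i - e, x ord0 i[%R.
  by apply: rat_in_itvoo; rewrite gtrBl.
have hb i : exists q : rat, ratr q \in `]x ord0 i, x ord0 i + e[%R.
  by apply: rat_in_itvoo; rewrite ltrDl.
exists (\row_i projT1 (cid (ha i)), \row_i projT1 (cid (hb i))) => //.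
split => /= [y hy|i]; last first.
  rewrite !mxE; case: cid => q; case: cid => r /=; rewrite !in_itv/=.
  by move=> /andP[-> _] /andP[_ ->].
apply: he; split => // j i; rewrite (ord1 j) /ball/=.
have := hy i; rewrite !mxE; case: cid => q; case: cid => r /=; rewrite !in_itv/=.
by move=> /andP[h1 h2] /andP[h3 h4] /andP[h5 h6]; rewrite ltr_norml; apply/andP; lra.
Qed.

Lemma continuous_measurable_rV (u : 'rV[R]_d -> R) : continuous u ->
  measurable_fun setT u.
Proof.
move=> cu; apply: (measurability (@RGenOpens.G R)).
  exact: RGenOpens.measurableE.
move=> _ [_ [a [b ->]] <-]; rewrite setTI; apply: open_measurable_rV.
by apply: open_comp => //; exact: interval_open.
Qed.

Lemma coord_le_norm (x : 'rV[R]_d) (i : 'I_d) : `|x ord0 i| <= `|x|.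
Proof.
rewrite [leRHS]mx_normrE.
exact: (le_bigmax _ (fun ij : 'I_1 * 'I_d => `|x ij.1 ij.2|) (ord0, i)).
Qed.

Lemma continuous_translate (u : 'rV[R]_d -> R) (a : 'rV[R]_d) : continuous u ->
  continuous (fun x : 'rV[R]_d => u (x + a)).
Proof.
move=> cu x; have h : (fun y : 'rV[R]_d => y + a) y @[y --> x] --> x + a.
  exact: (cvgD (@cvg_id _ (nbhs x)) (cvg_cst a)).
exact: (cvg_comp _ _ h (cu (x + a))).
Qed.

(** Support in a cube with an explicit half-side. Some [k] exists for each test function
    ([test_function_bounded_support]), and conversely it yields compact support ([test_functionI]);
    unlike compactness it is immediate for sums, shifts and derivatives. *)
Definition vanishes_off (k : R) (V : zmodType) (u : 'rV[R]_d -> V) :=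
  forall (x : 'rV[R]_d) (i : 'I_d), k < `|x ord0 i| -> u x = 0.

Lemma compact_cube (k : R) : compact [set x : 'rV[R]_d | forall i, `|x ord0 i| <= k].
Proof.
rewrite (_ : mkset _ = [set x : 'rV[R]_d | forall i, `[- k, k]%classic (x ord0 i)]).
  by apply: (@rV_compact _ d (fun=> `[- k, k]%classic)) => i; exact: segment_compact.
by apply/seteqP; split => x /= h i; have := h i; rewrite in_itv/= ler_norml.
Qed.

Lemma vanishes_off_bounded (k : R) (u : 'rV[R]_d -> R) : continuous u ->
  vanishes_off k u -> exists M, forall x, `|u x| <= M.
Proof.
move=> cu uk.
have : compact (u @` [set x : 'rV[R]_d | forall i, `|x ord0 i| <= k]).
  by apply: continuous_compact; [exact: continuous_subspaceT|exact: compact_cube].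
move=> /compact_bounded[M [_ hM]].
exists (Num.max 0 (M + 1)) => x.
have [h|/existsNP[i /negP]] := pselect (forall i, `|x ord0 i| <= k).
  rewrite le_max; apply/orP; right.
  by apply: hM; [rewrite ltrDl|exists x].
by rewrite -ltNge => /uk ->; rewrite normr0 le_max lexx.
Qed.

End ContinuousMeasurable.

(** * Smooth functions and test functions *)

Section SmoothFunctions.
Context {R : realType} {d : nat}.
Local Notation C := R[i].
Implicit Types (u v : 'rV[R]_d -> R) (phi psi : 'rV[R]_d -> C) (i j : 'I_d).

Local Notation e_ i := (delta_mx ord0 i : 'rV[R]_d).

Lemma smooth_continuous u : smooth u -> continuous u.
Proof. by move=> /(_ [::])[]. Qed.

Lemma smooth_derivable u i x : smooth u -> derivable u x (e_ i).
Proof. by move=> /(_ [::])[_ /(_ i x)]. Qed.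

Lemma smooth_partial u i : smooth u -> smooth (partial i u).
Proof. by move=> su s; have := su (rcons s i); rewrite foldr_rcons. Qed.

Lemma smooth_of_foldr (f : seq 'I_d -> 'rV[R]_d -> R) u :
  (forall s, foldr partial u s = f s) -> (forall s, continuous (f s)) ->
  (forall s i x, derivable (f s) x (e_ i)) -> smooth u.
Proof. by move=> uf cf df s; rewrite uf; split. Qed.

Lemma smooth_lin (a b : R) u v : smooth u -> smooth v ->
  smooth (fun x => a * u x + b * v x) /\
  forall s, foldr partial (fun x => a * u x + b * v x) s =
    (fun x => a * foldr partial u s x + b * foldr partial v s x).
Proof.
move=> su sv.
have dlin f g i x : derivable f x (e_ i) -> derivable g x (e_ i) ->
    is_derive x (e_ i) (fun y => a * f y + b * g y)
      (a * partial i f x + b * partial i g x).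
  move=> /derivableP df /derivableP dg.
  have -> : (fun y => a * f y + b * g y) = a *: f + b *: g by [].
  by apply: is_deriveD; apply: is_deriveZ.
have E s : foldr partial (fun x => a * u x + b * v x) s =
    (fun x => a * foldr partial u s x + b * foldr partial v s x).
  elim: s => [//|i s IH] /=; apply/funext => x; rewrite /partial IH.
  have [_ h1] := su s; have [_ h2] := sv s.
  by have := dlin _ _ i x (h1 i x) (h2 i x) => hd; rewrite derive_val.
split; last exact: E.
apply: (smooth_of_foldr E) => s.
  have [h1 _] := su s; have [h2 _] := sv s => x.
  exact: (cvgD (cvgZr (h1 x)) (cvgZr (h2 x))).
move=> i x; have [_ h1] := su s; have [_ h2] := sv s.
by have := dlin _ _ i x (h1 i x) (h2 i x) => hd; exact: ex_derive.
Qed.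

Lemma partial_shift u a i x : partial i (fun y => u (y + a)) x = partial i u (x + a).
Proof.
rewrite /partial /derive.
rewrite (_ : (fun h => _) = (fun h => h^-1 *: ((u \o shift (x + a)) (h *: e_ i) - u (x + a))))//.
by apply/funext => h /=; rewrite addrA.
Qed.

Lemma derivable_shift u a i x : derivable u (x + a) (e_ i) ->
  derivable (fun y => u (y + a)) x (e_ i).
Proof.
rewrite /derivable => h.
rewrite (_ : (fun h => _) = (fun h => h^-1 *: ((u \o shift (x + a)) (h *: e_ i) - u (x + a))))//.
by apply/funext => t /=; rewrite addrA.
Qed.

Lemma smooth_shift u a : smooth u -> smooth (fun x => u (x + a)).
Proof.
move=> su.
have E s : foldr partial (fun x => u (x + a)) s = (fun x => foldr partial u s (x + a)).
  elim: s => [//|i s IH] /=; rewrite IH; apply/funext => x.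
  exact: partial_shift.
apply: (smooth_of_foldr E) => s; have [h1 h2] := su s.
  exact: continuous_translate.
by move=> i x; exact: derivable_shift.
Qed.

(** The strict inequality in [vanishes_off] is an open condition, so u vanishes in a neighbourhood
    of x. *)
Lemma partial_vanishes_off k u i : vanishes_off k u -> vanishes_off k (partial i u).
Proof.
move=> uk x j kx; rewrite /partial (@near_eq_derive _ _ _ u (cst 0)).
  exact: derive_cst.
have : (fun y : 'rV[R]_d => `|y ord0 j|) @ x --> `|x ord0 j|.
  exact: (cvg_norm (@coord_continuous R 1 d ord0 j x)).
move=> /cvgr_gt/(_ _ kx); apply: filterS => y; exact: uk.
Qed.

Lemma derivable_line u i x (s : R) : derivable u (x + s *: e_ i) (e_ i) ->
  is_derive s 1 (fun t => u (x + t *: e_ i)) (partial i u (x + s *: e_ i)).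
Proof.
have E : (fun h : R => h^-1 *: (((fun t => u (x + t *: e_ i)) \o shift s) (h *: 1)
      - u (x + s *: e_ i))) =
    (fun h : R => h^-1 *: ((u \o shift (x + s *: e_ i)) (h *: e_ i) - u (x + s *: e_ i))).
  apply/funext => h /=; congr (_ *: (u _ - _)).
  by rewrite scalerDl [h *: 1]mulr1 addrCA.
move=> du; apply: DeriveDef; first by rewrite /derivable E.
by rewrite /partial /derive E.
Qed.

Lemma smooth_taylor2 u i M : smooth u ->
  (forall x, `|partial i (partial i u) x| <= M) ->
  forall x t, `|u (x + t *: e_ i) - u x - t * partial i u x| <= M * t ^+ 2.
Proof.
move=> su uM x t.
have d1 (s : R) := derivable_line (smooth_derivable (x := x + s *: e_ i) (i := i) su).
have d2 (s : R) := derivable_line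
  (smooth_derivable (x := x + s *: e_ i) (i := i) (@smooth_partial u i su)).
have := taylor2_bound t d1 d2 (fun s => uM _).
by rewrite scale0r addr0.
Qed.

Lemma test_function_bounded_support phi : test_function phi ->
  exists2 k : R, 0 <= k & vanishes_off k phi.
Proof.
move=> [_ _ cK].
move: cK => /compact_bounded[M [_ hM]].
exists (Num.max 0 (M + 1)) => [|x i]; first by rewrite le_max lexx.
rewrite gt_max => /andP[_ Mx]; apply/eqP/negPn/negP => px.
have := hM (M + 1) _ x; rewrite ltrDl ltr01 => /(_ isT) h.
have /h : closure [set x | phi x != 0] x by exact: subset_closure.
by apply/negP; rewrite /= -ltNge; exact: lt_le_trans Mx (coord_le_norm x i).
Qed.

Lemma test_functionI phi k : smooth (Re \o phi) -> smooth (Im \o phi) ->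
  vanishes_off k phi -> test_function phi.
Proof.
move=> sr si vk; split => //.
apply: (subclosed_compact _ (@compact_cube R d k)); first exact: closed_closure.
rewrite [X in _ `<=` X](closure_id _).1; last first.
  by apply: compact_closed; [exact: norm_hausdorff|exact: compact_cube].
apply: closureS => x /= /eqP px i; rewrite leNgt; apply/negP => kx.
by apply: px; exact: vk kx.
Qed.

Lemma test_function_lin (a b : C) phi psi : test_function phi -> test_function psi ->
  test_function (fun x => a * phi x + b * psi x).
Proof.
move=> tp ts; have [k k0 kp] := test_function_bounded_support tp.
have [l l0 lp] := test_function_bounded_support ts.
have [pr pi_ _] := tp; have [sr si _] := ts.
have lin4 (u1 u2 u3 u4 : 'rV[R]_d -> R) (c1 c2 c3 c4 : R) :
    smooth u1 -> smooth u2 -> smooth u3 -> smooth u4 ->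
    smooth (fun x => (c1 * u1 x + c2 * u2 x) + (c3 * u3 x + c4 * u4 x)).
  move=> s1 s2 s3 s4.
  have [h1 _] := smooth_lin c1 c2 s1 s2; have [h2 _] := smooth_lin c3 c4 s3 s4.
  have [h _] := smooth_lin 1 1 h1 h2.
  rewrite (_ : (fun x => _) = (fun x => 1 * (c1 * u1 x + c2 * u2 x) +
    1 * (c3 * u3 x + c4 * u4 x)))//.
  by apply/funext => x; rewrite !mul1r.
apply: (@test_functionI _ (Num.max k l)).
- have E : Re \o (fun x => a * phi x + b * psi x) =
      (fun x => (Re a * (Re \o phi) x + (- Im a) * (Im \o phi) x) +
        (Re b * (Re \o psi) x + (- Im b) * (Im \o psi) x)).
    by apply/funext => x /=; rewrite ReD !ReM !mulNr.
  by rewrite E; apply: lin4.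
- have E : Im \o (fun x => a * phi x + b * psi x) =
      (fun x => (Re a * (Im \o phi) x + Im a * (Re \o phi) x) +
        (Re b * (Im \o psi) x + Im b * (Re \o psi) x)).
    by apply/funext => x /=; rewrite ImD !ImM.
  by rewrite E; apply: lin4.
move=> x i; rewrite gt_max => /andP[kx lx].
by rewrite (kp x i kx) (lp x i lx) !mulr0 addr0.
Qed.

Lemma test_function0 : test_function (fun _ : 'rV[R]_d => 0 : C).
Proof.
have E s : foldr partial (fun _ : 'rV[R]_d => 0 : R) s = (fun=> 0).
  by elim: s => [//|i s /= ->]; apply/funext => x; exact: derive_cst.
have s0 : smooth (fun _ : 'rV[R]_d => 0 : R).
  apply: (smooth_of_foldr E) => [s|s i x]; first exact: cst_continuous.
  exact: derivable_cst.
by apply: (@test_functionI _ 0).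
Qed.

Lemma test_function_conj phi : test_function phi ->
  test_function (fun x => conjc (phi x)).
Proof.
move=> tp; have [k k0 kp] := test_function_bounded_support tp.
have [pr pi_ _] := tp; apply: (@test_functionI _ k).
- by rewrite (_ : _ \o _ = Re \o phi)//; apply/funext => x /=; rewrite Re_conj.
- have [h _] := smooth_lin (-1) 0 pi_ pi_.
  rewrite (_ : _ \o _ = (fun x => -1 * (Im \o phi) x + 0 * (Im \o phi) x))//.
  by apply/funext => x /=; rewrite Im_conj mul0r addr0 mulN1r.
by move=> x i /kp ->; rewrite conjc0.
Qed.

Lemma test_function_shift phi a : test_function phi ->
  test_function (fun x => phi (x + a)).
Proof.
move=> tp; have [k k0 kp] := test_function_bounded_support tp.
have [pr pi_ _] := tp; apply: (@test_functionI _ (k + \sum_i `|a ord0 i|)).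
- exact: (smooth_shift a pr).
- exact: (smooth_shift a pi_).
move=> x i kx; apply: (kp _ i); rewrite mxE.
have := rV_coord_bound a i; have := ler_normD (x ord0 i + a ord0 i) (- a ord0 i).
by rewrite addrK normrN; lra.
Qed.

Lemma cpartial_lin (a b : C) phi psi i : test_function phi -> test_function psi ->
  cpartial i (fun x => a * phi x + b * psi x) =
  (fun x => a * cpartial i phi x + b * cpartial i psi x).
Proof.
move=> [pr pi_ _] [sr si _].
have lin4 (u1 u2 u3 u4 : 'rV[R]_d -> R) (c1 c2 c3 c4 : R) :
    smooth u1 -> smooth u2 -> smooth u3 -> smooth u4 ->
    partial i (fun x => (c1 * u1 x + c2 * u2 x) + (c3 * u3 x + c4 * u4 x)) =
    (fun x => (c1 * partial i u1 x + c2 * partial i u2 x) +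
       (c3 * partial i u3 x + c4 * partial i u4 x)).
  move=> s1 s2 s3 s4.
  have [h1 e1] := smooth_lin c1 c2 s1 s2; have [h2 e2] := smooth_lin c3 c4 s3 s4.
  have [_ e] := smooth_lin 1 1 h1 h2.
  have := e [:: i]; have := e1 [:: i]; have := e2 [:: i] => /= -> -> E.
  rewrite (_ : (fun x => _) = (fun x => 1 * (c1 * u1 x + c2 * u2 x) +
    1 * (c3 * u3 x + c4 * u4 x))).
    by rewrite E; apply/funext => x; rewrite !mul1r.
  by apply/funext => x; rewrite !mul1r.
apply/funext => x; rewrite /cpartial; apply: complexP => /=.
- rewrite (_ : _ \o _ = (fun x => (Re a * Re (phi x) + (- Im a) * Im (phi x)) +
    (Re b * Re (psi x) + (- Im b) * Im (psi x)))).
    rewrite (lin4 (Re \o phi) (Im \o phi) (Re \o psi) (Im \o psi))//.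
    by rewrite ReD !ReM !mulNr.
  by apply/funext => y /=; rewrite ReD !ReM !mulNr.
- rewrite (_ : _ \o _ = (fun x => (Re a * Im (phi x) + Im a * Re (phi x)) +
    (Re b * Im (psi x) + Im b * Re (psi x)))).
    rewrite (lin4 (Im \o phi) (Re \o phi) (Im \o psi) (Re \o psi))//.
    by rewrite ImD !ImM.
  by apply/funext => y /=; rewrite ImD !ImM.
Qed.

Lemma cpartial_conj phi i : test_function phi ->
  cpartial i (fun x => conjc (phi x)) = (fun x => conjc (cpartial i phi x)).
Proof.
move=> [pr pi_ _]; apply/funext => x; rewrite /cpartial; apply: complexP => /=.
  by rewrite (_ : _ \o _ = Re \o phi)//; apply/funext => y /=; rewrite Re_conj.
have [_ /(_ [:: i])/= E] := smooth_lin (-1) 0 pi_ pi_.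
rewrite (_ : _ \o _ = (fun x => -1 * (Im \o phi) x + 0 * (Im \o phi) x)).
  by rewrite E mul0r addr0 mulN1r.
by apply/funext => y /=; rewrite Im_conj mul0r addr0 mulN1r.
Qed.

Lemma cpartial_shift phi a i :
  cpartial i (fun x => phi (x + a)) = (fun x => cpartial i phi (x + a)).
Proof.
by apply/funext => x; rewrite /cpartial; congr (_ +i* _);
  [exact: (partial_shift (Re \o phi))|exact: (partial_shift (Im \o phi))].
Qed.

End SmoothFunctions.

(** * Test functions as elements of L^2 *)

Section TestFunctionsL2.
Context {R : realType} {d : nat}.
Local Notation C := R[i].
Local Notation lambda := (@lebesgue_rV R d).
Local Notation sqi := (square_integrable lambda).
Local Notation H := (L2Rd R d).
Local Notation nrm := (@L2norm _ _ _ lambda).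
Local Notation cls := (@L2_class _ _ _ lambda).
Implicit Types (f g h : H) (phi psi : 'rV[R]_d -> C) (i : 'I_d).

(** [K] depends on the cube alone, so uniform estimates of order t^2 become L^2 estimates of the
    same order. *)
Lemma vanishes_off_L2norm (k : R) : exists2 K : R, 0 <= K &
  forall (u : 'rV[R]_d -> C) (M : R), 0 <= M -> cmeasurable u -> vanishes_off k u ->
    (forall x, normc (u x) <= M) -> u \in sqi /\ nrm (cls u) <= K * M.
Proof.
(* The margin 1 is there because the box is open while u may be nonzero on the faces |x_i| = k. *)
pose Q : set 'rV[R]_d := open_box (const_mx (- k - 1)) (const_mx (k + 1)).
have mQ : measurable Q by exact: measurable_open_box.
have Qoo : (lambda Q < +oo)%E by exact: lebesgue_open_box_lty.
exists (Num.sqrt (fine (lambda Q))) => [|u M M0 mu_ uk uM]; first exact: sqrtr_ge0.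
set F := fun x => ((normc (u x)) ^+ 2)%:E.
have FQ : F = F \_ Q.
  apply/funext => x; rewrite patchE; case: ifPn => // /negP xQ.
  have [h|/existsNP[i /negP]] := pselect (forall i, `|x ord0 i| <= k).
    exfalso; apply: xQ; rewrite inE => i; rewrite !mxE.
    by have := h i; rewrite ler_norml => /andP[h1 h2]; apply/andP; split; lra.
  by rewrite -ltNge /F => /uk ->; rewrite Normc.normc0 expr0n.
have mF : measurable_fun setT F.
  by apply/measurable_EFinP; apply: measurable_funX; exact: measurable_normc.
have FM : (\int[lambda]_x F x <= ((Num.sqrt (fine (lambda Q)) * M) ^+ 2)%:E)%E.
  rewrite FQ -integral_mkcond.
  apply: (@le_trans _ _ (\int[lambda]_(x in Q) cst (M ^+ 2)%:E x)%E).
    apply: ge0_le_integral => //.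
    - by move=> x _; rewrite lee_fin sqr_ge0.
    - exact: measurable_funTS.
    - by move=> x _; rewrite lee_fin ler_pXn2r ?nnegrE ?normc_ge0.
  rewrite integral_cst// exprMn sqr_sqrtr ?fine_ge0// [X in (_ <= X)%E]EFinM.
  by rewrite (fineK (x := lambda Q)) ?ge0_fin_numE// muleC.
have su : u \in sqi by apply/sqiP; split => //; apply: le_lt_trans FM _; rewrite ltry.
by split => //; apply: L2norm_class_lte => //; rewrite mulr_ge0 ?sqrtr_ge0.
Qed.

Lemma continuous_cmeasurable (u : 'rV[R]_d -> C) :
  continuous (Re \o u) -> continuous (Im \o u) -> cmeasurable u.
Proof. by move=> cr ci; split; exact: continuous_measurable_rV. Qed.

Lemma vanishes_off_bounded_complex (u : 'rV[R]_d -> C) k :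
  continuous (Re \o u) -> continuous (Im \o u) -> vanishes_off k u ->
  exists2 M, 0 <= M & forall x, normc (u x) <= M.
Proof.
move=> cr ci uk.
have [M hM] : exists M, forall x, `|(Re \o u) x| <= M.
  by apply: (vanishes_off_bounded (k := k)) => // x i /uk /= ->.
have [N hN] : exists M, forall x, `|(Im \o u) x| <= M.
  by apply: (vanishes_off_bounded (k := k)) => // x i /uk /= ->.
exists (M + N) => [|x].
  by apply: addr_ge0; [have := hM 0|have := hN 0]; apply: le_trans.
by apply: le_trans (normc_le_ReIm _) _; apply: lerD; [exact: hM|exact: hN].
Qed.

Lemma vanishes_off_sqi (u : 'rV[R]_d -> C) k :
  continuous (Re \o u) -> continuous (Im \o u) -> vanishes_off k u -> u \in sqi.
Proof.
move=> cr ci uk; have [M M0 hM] := vanishes_off_bounded_complex cr ci uk.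
have [K _ hK] := vanishes_off_L2norm k.
by have [] := hK u M M0 (continuous_cmeasurable cr ci) uk hM.
Qed.

Lemma vanishes_off_ReIm k phi : vanishes_off k phi ->
  vanishes_off k (Re \o phi) /\ vanishes_off k (Im \o phi).
Proof. by move=> pk; split => x i /pk /= ->. Qed.

Lemma cpartial_vanishes_off k phi i : vanishes_off k phi ->
  vanishes_off k (cpartial i phi).
Proof.
move=> /vanishes_off_ReIm[pr pi_] x j kx; rewrite /cpartial.
by rewrite (partial_vanishes_off i pr kx) (partial_vanishes_off i pi_ kx).
Qed.

Lemma test_function_sqi phi : test_function phi -> phi \in sqi.
Proof.
move=> tp; have [k _ pk] := test_function_bounded_support tp.
have [pr pi_ _] := tp.
by apply: (vanishes_off_sqi _ _ pk); exact: smooth_continuous.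
Qed.

Lemma L2_class0 : cls (fun=> 0) = 0.
Proof.
transitivity (0 *: cls (fun=> 0)); last exact: scale0r.
rewrite -(L2_classZ 0 (test_function_sqi test_function0)); congr (cls _).
by apply/funext => x; rewrite mul0r.
Qed.

Lemma Re_cpartial phi i : Re \o cpartial i phi = partial i (Re \o phi).
Proof. by []. Qed.

Lemma Im_cpartial phi i : Im \o cpartial i phi = partial i (Im \o phi).
Proof. by []. Qed.

Lemma cpartial_sqi phi i : test_function phi -> cpartial i phi \in sqi.
Proof.
move=> tp; have [k _ pk] := test_function_bounded_support tp.
have [pr pi_ _] := tp.
apply: (vanishes_off_sqi _ _ (cpartial_vanishes_off i pk)).
  by rewrite Re_cpartial; apply: smooth_continuous; exact: smooth_partial.
by rewrite Im_cpartial; apply: smooth_continuous; exact: smooth_partial.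
Qed.

Lemma tf_fun_trans_axis i t phi x :
  tf_fun (trans_axis i t) phi x = phi (x - axis i t).
Proof. by rewrite tf_funE row_mxKl row_mxKr dot0l mulr0 expi0 mul1r. Qed.

Lemma axisN i (t : R) : axis i (- t) = - axis i t.
Proof. by rewrite /axis scaleNr. Qed.

Lemma axisD i (s t : R) : axis i (s + t) = axis i s + axis i t.
Proof. by rewrite /axis scalerDl. Qed.

Lemma class_shift phi i t : phi \in sqi ->
  tf_shift (trans_axis i (- t)) (cls phi) = cls (fun x => phi (x + axis i t)).
Proof.
move=> sp; rewrite tf_shift_class//; congr (cls _); apply/funext => x.
by rewrite tf_fun_trans_axis axisN opprK.
Qed.

(** The Taylor remainder is uniformly of order t^2, and for |t| <= 1 all shifted supports stay in
    one cube of half-side k + 1. *)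
Lemma test_function_taylor phi i : test_function phi -> exists2 K : R, 0 <= K &
  forall t : R, `|t| <= 1 ->
    nrm (tf_shift (trans_axis i (- t)) (cls phi) - cls phi - t%:C *: cls (cpartial i phi))
    <= K * t ^+ 2.
Proof.
move=> tp; have [k k0 pk] := test_function_bounded_support tp.
have [pr pi_ _] := tp; have [vr vi] := vanishes_off_ReIm pk.
have bnd (u : 'rV[R]_d -> R) : smooth u -> vanishes_off k u ->
    exists2 M, 0 <= M & forall x t, `|u (x + axis i t) - u x - t * partial i u x| <= M * t ^+ 2.
  move=> su uk.
  have [M hM] : exists M, forall x, `|partial i (partial i u) x| <= M.
    apply: (vanishes_off_bounded (k := k)).
      by apply: smooth_continuous; do 2 apply: smooth_partial.
    by do 2 apply: partial_vanishes_off.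
  exists M; first exact: le_trans (hM 0).
  by move=> x t; exact: smooth_taylor2.
have [M M0 hM] := bnd _ pr vr; have [N N0 hN] := bnd _ pi_ vi.
have [K K0 hK] := vanishes_off_L2norm (k + 1).
exists (K * (M + N)) => [|t t1]; first by rewrite mulr_ge0 ?addr_ge0.
have sp := test_function_sqi tp; have sq := cpartial_sqi i tp.
have ts := test_function_sqi (test_function_shift (axis i t) tp).
rewrite (class_shift _ _ sp) -L2_classB// -L2_classZ// -L2_classB//; last 2 first.
- exact: sqiB.
- exact: sqiZ.
rewrite -mulrA.
have [] // := hK (fun x => phi (x + axis i t) - phi x - t%:C * cpartial i phi x)
  ((M + N) * t ^+ 2).
- by rewrite mulr_ge0 ?addr_ge0 ?sqr_ge0.
- by apply: (@sqi_measurable _ _ _ lambda); apply: sqiB; [exact: sqiB|exact: sqiZ].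
- move=> x j kx; have -> : cpartial i phi x = 0.
    by apply: (cpartial_vanishes_off i pk (_ : k < `|x ord0 j|)); lra.
  rewrite (pk x j); last lra.
  rewrite (pk _ j) ?mulr0 ?subr0// !mxE.
  have e2 : `|t * (j == i)%:R| <= 1.
    by case: eqP => _; rewrite ?mulr1 ?mulr0 ?normr0.
  have := ler_normD (x ord0 j + t * (j == i)%:R) (- (t * (j == i)%:R)).
  by rewrite addrK normrN eqxx /=; move: kx e2; lra.
move=> x; apply: le_trans (normc_le_ReIm _) _; rewrite mulrDl; apply: lerD.
  have := hM x t; rewrite /=; congr (_ <= _); congr `|_|.
  by rewrite !(raddfB, ReM) /=; ring.
have := hN x t; rewrite /=; congr (_ <= _); congr `|_|.
by rewrite !(raddfB, ImM) /=; ring.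
Qed.

(** The definition pairs bilinearly; since conjugation preserves test functions and commutes with
    the derivative, the sesquilinear pairing may be used instead. *)
Lemma distributional_partialP i f h : distributional_partial i f h <->
  forall phi, test_function phi -> inner f (cls (cpartial i phi)) = - inner h (cls phi).
Proof.
have key phi : test_function phi ->
    (inner f (cls (cpartial i phi)) = cintegral lambda (fun x => f x *
       cpartial i (fun y => conjc (phi y)) x)) *
    (inner h (cls phi) = cintegral lambda (fun x => h x * conjc (phi x))).
  move=> tp; split.
    rewrite (inner_ae (L2_sqi f) (cpartial_sqi i tp) (ae_eq_refl _ _ f)
      (L2_classE (cpartial_sqi i tp))).
    by rewrite cpartial_conj.
  exact: (inner_ae (L2_sqi h) (test_function_sqi tp) (ae_eq_refl _ _ h)
      (L2_classE (test_function_sqi tp))).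
split=> [fh phi tp|fh phi tp].
  by rewrite !key//; apply: fh; exact: test_function_conj.
have := fh _ (test_function_conj tp).
have E : (fun y => conjc (conjc (phi y))) = phi by apply/funext => y; rewrite conjcK.
rewrite !key; [|exact: test_function_conj..].
rewrite E => ->; congr (- _); apply: eq_cintegral => x; by rewrite conjcK.
Qed.

End TestFunctionsL2.

(** * Riesz representation by minimization *)

Section RieszRepresentation.
Context {R : realType} {d : measure_display} {T : measurableType d}.
Context {mu : {measure set T -> \bar R}}.
Local Notation C := R[i].
Local Notation H := (L2 mu).
Local Notation nrm := (@L2norm _ _ _ mu).
(** P is the graph of a bounded linear functional on a subspace that need not be closed. As a
    relation it can be given in terms of test functions, without first showing that the value
    depends on the class only; [PK] implies this. *)
Variables (P : H -> C -> Prop) (K : R).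
Hypothesis K0 : 0 <= K.
Hypothesis P0 : P 0 0.
Hypothesis Plin : forall (a : C) u c v e, P u c -> P v e -> P (a *: u + v) (a * c + e).
Hypothesis PK : forall u c, P u c -> normc c <= K * nrm u.

(** If c = <u, h>, this is |u - h|^2 - |h|^2, so minimizing vectors look for the representing h. *)
Let J (u : H) (c : C) : R := nrm u ^+ 2 - 2 * Re c.

Let values := [set J p.1 p.2 | p in [set p | P p.1 p.2]].

Let values_lb : lbound values (- K ^+ 2).
Proof.
move=> _ [[u c] /= Puc <-]; rewrite /J.
have := PK Puc; have := normc_ge_absRe c; have := ler_norm (Re c).
have := sqr_ge0 (nrm u - K); rewrite sqrrB; move: (nrm u) (Re c) (`|Re c|) (normc c).
by move=> a b b' b'' *; nra.
Qed.

Let m := inf values.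

Let J_ge u c : P u c -> m <= J u c.
Proof. by move=> Puc; apply: ge_inf; [exists (- K ^+ 2)|exists (u, c)]. Qed.

Let J_near e : 0 < e -> exists u c, P u c /\ J u c < m + e.
Proof.
move=> e0; have [|_ [[u c] /= Puc <-] h] := @inf_adherent _ values e e0.
  by split; [exists (J 0 0), (0, 0)|exists (- K ^+ 2)].
by exists u, c.
Qed.

Let minimizing e u := exists2 c, P u c & J u c < m + e.

(** By the parallelogram law, |u - v|^2 is 2 J(u) + 2 J(v) - 4 J at the midpoint, and the midpoint
    value is at least m. *)
Let minimizing_close e u v : minimizing e u -> minimizing e v ->
  nrm (u - v) ^+ 2 <= 4 * e.
Proof.
move=> [c Pu uc] [c' Pv vc].
have Pw := Plin (2^-1)%:C (Plin 1 Pu Pv) P0; have := J_ge Pw.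
move: uc vc; rewrite /J !addr0 !scale1r !mul1r => uc vc.
have E : nrm ((2^-1)%:C *: (u + v)) ^+ 2 = 4^-1 * nrm (u + v) ^+ 2.
  by rewrite L2norm_scale normc_real ger0_norm ?invr_ge0// exprMn; congr (_ * _); field.
rewrite E ReM ReD /= mul0r subr0.
have := parallelogram u v; move: (nrm (u + v) ^+ 2) (nrm (u - v) ^+ 2) uc vc.
by move: (nrm u ^+ 2) (nrm v ^+ 2) => *; lra.
Qed.

(** With z = <w, u> - c, moving u by -r conj(z) w changes J by r^2 |z|^2 |w|^2 - 2 r |z|^2, and J
    can drop by at most e. For r = 1/(1 + |w|^2) the quadratic term is at most r |z|^2. *)
Let minimizing_gradient e u w c : minimizing e u -> P w c ->
  normc (inner w u - c) ^+ 2 <= e * (1 + nrm w ^+ 2).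
Proof.
move=> [c0 Pu uc] Pw; set z := inner w u - c.
pose r : R := (1 + nrm w ^+ 2)^-1.
have W0 : 0 < 1 + nrm w ^+ 2 by rewrite ltr_pwDl// sqr_ge0.
have r0 : 0 < r by rewrite invr_gt0.
have := J_ge (Plin (- (r%:C * conjc z)) Pw Pu).
have E : nrm (- (r%:C * conjc z) *: w + u) ^+ 2 =
    r ^+ 2 * normc z ^+ 2 * nrm w ^+ 2 + nrm u ^+ 2 - 2 * Re (r%:C * conjc z * inner w u).
  rewrite sqr_L2norm innerDl !innerDr !innerZl !innerZr !inner_norm (innerC w u).
  rewrite sqr_normcE; move: (inner w u) z (nrm w ^+ 2) (nrm u ^+ 2) => [p q] [a b] s t.
  by rewrite /=; ring.
rewrite /J E => Jm.
have E2 : Re (r%:C * conjc z * inner w u) - Re (r%:C * conjc z * c) = r * normc z ^+ 2.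
  rewrite sqr_normcE -raddfB -mulrBr /= -/z.
  by case: (z) => a b /=; ring.
have E3 : Re (- (r%:C * conjc z) * c + c0) = - Re (r%:C * conjc z * c) + Re c0.
  by rewrite raddfD mulNr raddfN.
rewrite E3 in Jm; move: uc; rewrite /J => uc.
have rW : r * (1 + nrm w ^+ 2) = 1 by rewrite mulVf ?gt_eqF.
rewrite mulrC -ler_pdivrMl// -/r.
have : r ^+ 2 * normc z ^+ 2 * nrm w ^+ 2 <= r * normc z ^+ 2.
  rewrite (_ : _ * _ * _ = (r * nrm w ^+ 2) * (r * normc z ^+ 2)); last by ring.
  rewrite -[leRHS]mul1r ler_wpM2r// ?mulr_ge0 ?normc_ge0 ?(ltW r0)//.
  by rewrite -[leRHS]rW mulrDr mulr1 lerDr ltW.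
by lra.
Qed.

(** The gradient estimate vanishes in the limit, so the limit h represents P. As h is a limit of
    vectors u of the domain, <h, h> is approximated by values c = <u, h> of modulus at most K |u|,
    whence |h| <= K. *)
Lemma riesz_minimization : exists2 h, nrm h <= K & forall u c, P u c -> c = inner u h.
Proof.
pose F := filter_from [set e : R | 0 < e] minimizing.
have PF : ProperFilter F.
  apply: filter_from_proper.
    apply: filter_from_filter; first by exists 1 => /=.
    move=> a b /= a0 b0; exists (Num.min a b); first by rewrite /= lt_min a0.
    move=> u [c Pu uc]; split; exists c => //; apply: lt_le_trans uc _.
      by rewrite lerD2l ge_min lexx.
    by rewrite lerD2l ge_min lexx orbT.
  by move=> e /= /J_near[u [c [Pu uc]]]; exists u, c.
have [|h hF] := L2_complete PF.
  move=> e e0; have e1 : 0 < e ^+ 2 / 8 by rewrite divr_gt0 ?exprn_gt0.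
  have [u [c [Pu uc]]] := J_near e1; exists u; exists (e ^+ 2 / 8) => //= v hv.
  have := minimizing_close (ex_intro2 _ _ c Pu uc) hv => h.
  rewrite /= -(@ltr_pXn2r _ 2) ?nnegrE ?L2norm_ge0 ?(ltW e0)//.
  by apply: le_lt_trans h _; move: e1; lra.
suff rep : forall w c, P w c -> c = inner w h.
  exists h => //; suff : nrm h ^+ 2 <= K * nrm h.
    have := L2norm_ge0 h; rewrite le_eqVlt => /orP[/eqP <- //|h0].
    by rewrite expr2 ler_pM2r.
  apply/ler_addgt0Pr => e e0; have L0 : 0 < K + nrm h + 1.
    by rewrite ltr_wpDl// addr_ge0// L2norm_ge0.
  have [|e1 /= e10 he1] := hF (e / (K + nrm h + 1)); first by rewrite divr_gt0.
  have [u [c [Pu uc]]] := J_near e10.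
  have hu := ltW (he1 u (ex_intro2 _ _ c Pu uc)).
  have -> : nrm h ^+ 2 = normc (inner h h).
    by rewrite inner_norm normc_real ger0_norm ?sqr_ge0.
  have -> : inner h h = c + inner (h - u) h by rewrite (rep _ _ Pu) -innerDl addrC subrK.
  apply: le_trans (le_normcD _ _) _.
  have h1 := PK Pu; have h2 := cauchy_schwarz (h - u) h.
  have h3 : nrm u <= nrm h + nrm (h - u).
    by have := L2norm_triangleB h (h - u); rewrite subKr.
  have h4 : (K + nrm h) * nrm (h - u) <= e.
    apply: (@le_trans _ _ ((K + nrm h + 1) * (e / (K + nrm h + 1)))).
      by apply: ler_pM => //; rewrite ?addr_ge0 ?L2norm_ge0// lerDl.
    by rewrite mulrCA mulfV ?gt_eqF// mulr1.
  have h5 := ler_wpM2l K0 h3; lra.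
move=> w c Pw; apply/esym/eqP; rewrite -subr_eq0; apply/eqP.
apply: Normc.eq0_normc; apply/eqP; rewrite eq_le normc_ge0 andbT.
apply/ler_addgt0Pr => e e0; rewrite add0r.
pose W := 1 + nrm w ^+ 2; have W0 : 0 < W by rewrite ltr_pwDl// sqr_ge0.
have [|e1 /= e10 he1] := hF (e / (2 * W)); first by rewrite divr_gt0// mulr_gt0.
(* The first entry puts u close to h, the second makes the gradient at most e/2. *)
pose e2 := Num.min e1 (e ^+ 2 / (4 * W)).
have e20 : 0 < e2 by rewrite lt_min e10 divr_gt0 ?exprn_gt0 ?mulr_gt0.
have [u [c' [Pu uc]]] := J_near e20.
have hu : nrm (h - u) < e / (2 * W).
  apply: he1; exists c' => //; apply: lt_le_trans uc _.
  by rewrite lerD2l ge_min lexx.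
have g := minimizing_gradient (ex_intro2 _ _ c' Pu uc) Pw.
have g1 : normc (inner w u - c) <= e / 2.
  rewrite -(@ler_pXn2r _ 2) ?nnegrE ?normc_ge0 ?divr_ge0 ?(ltW e0)//.
  apply: le_trans g _; apply: (@le_trans _ _ (e ^+ 2 / (4 * W) * W)).
    by rewrite ler_wpM2r ?(ltW W0)// ge_min lexx orbT.
  by rewrite le_eqVlt; apply/orP; left; apply/eqP; field; rewrite gt_eqF.
have g2 : normc (inner w (h - u)) <= e / 2.
  apply: le_trans (cauchy_schwarz _ _) _.
  have wW : nrm w <= W by rewrite /W; have := sqr_ge0 (nrm w - 2^-1); rewrite sqrrB; lra.
  apply: (@le_trans _ _ (W * (e / (2 * W)))).
    by apply: ler_pM => //; [exact: L2norm_ge0|exact: L2norm_ge0|exact: ltW].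
  by rewrite le_eqVlt; apply/orP; left; apply/eqP; field; rewrite gt_eqF.
have -> : inner w h - c = inner w (h - u) + (inner w u - c).
  by rewrite innerBr addrA addrNK.
by apply: le_trans (le_normcD _ _) _; lra.
Qed.

End RieszRepresentation.

(** * Weak derivatives and Lipschitz translations *)

Section SobolevTranslations.
Context {R : realType} {d : nat}.
Local Notation C := R[i].
Local Notation lambda := (@lebesgue_rV R d).
Local Notation H := (L2Rd R d).
Local Notation nrm := (@L2norm _ _ _ lambda).
Local Notation cls := (@L2_class _ _ _ lambda).
Implicit Types (f g h : H) (phi psi : 'rV[R]_d -> C) (i : 'I_d).

Lemma trans_axis_comp i (s t : R) f :
  tf_shift (trans_axis i s) (tf_shift (trans_axis i t) f) =
  tf_shift (trans_axis i (s + t)) f.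
Proof.
rewrite tf_shift_comp row_mxKr dot0l mulr0 expi0 scale1r; congr (tf_shift _ f).
by rewrite /trans_axis axisD add_row_mx addr0.
Qed.

Lemma trans_axis0 i f : tf_shift (trans_axis i 0) f = f.
Proof. by rewrite /trans_axis /axis scale0r row_mx0 tf_shift0. Qed.

Lemma trans_axis_adjoint i (t : R) f g :
  inner (tf_shift (trans_axis i t) f) g = inner f (tf_shift (trans_axis i (- t)) g).
Proof.
rewrite -[LHS](tf_shift_inner (trans_axis i (- t))) trans_axis_comp addNr.
by rewrite trans_axis0.
Qed.

Lemma trans_difference_inner i (t : R) f g :
  inner (tf_shift (trans_axis i t) f - f) g =
  inner f (tf_shift (trans_axis i (- t)) g - g).
Proof. by rewrite innerBl innerBr trans_axis_adjoint. Qed.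

(** The derivative of phi is replaced by a difference quotient, whose translation moves to f. The
    step t is at most 1 for the Taylor estimate, and small enough for its error to stay below e. *)
Lemma translation_lipschitz_derivative_bound f i (K : R) phi :
  (forall t, nrm (tf_shift (trans_axis i t) f - f) <= K * `|t|) -> test_function phi ->
  normc (inner f (cls (cpartial i phi))) <= K * nrm (cls phi).
Proof.
move=> fK tp; have [M M0 hM] := test_function_taylor i tp.
apply/ler_addgt0Pr => e e0.
pose t := Num.min 1 (e / (1 + nrm f * M)).
have N0 : 0 < 1 + nrm f * M by rewrite ltr_pwDl// mulr_ge0// L2norm_ge0.
have t0 : 0 < t by rewrite lt_min ltr01 divr_gt0.
have t1 : `|t| <= 1 by rewrite gtr0_norm// ge_min lexx.
have te : nrm f * M * t <= e.
  apply: (@le_trans _ _ ((1 + nrm f * M) * t)).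
    by rewrite ler_wpM2r ?(ltW t0)// lerDr.
  by rewrite mulrC -ler_pdivlMr// ge_min lexx orbT.
set D := cls (cpartial i phi); set F := cls phi.
have E : t%:C * inner f D = inner (tf_shift (trans_axis i t) f - f) F -
    inner f (tf_shift (trans_axis i (- t)) F - F - t%:C *: D).
  by rewrite trans_difference_inner -innerBr subKr innerZr conjc_realE.
rewrite -(ler_pM2l t0).
have -> : t * normc (inner f D) = normc (t%:C * inner f D).
  by rewrite Normc.normcM normc_real gtr0_norm.
rewrite E; apply: le_trans (le_normcD _ _) _; rewrite normc_opp.
have h1 := cauchy_schwarz (tf_shift (trans_axis i t) f - f) F.
have h2 := cauchy_schwarz f (tf_shift (trans_axis i (- t)) F - F - t%:C *: D).
have h3 : nrm (tf_shift (trans_axis i t) f - f) * nrm F <= K * t * nrm F.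
  by rewrite ler_wpM2r ?L2norm_ge0//; have := fK t; rewrite (gtr0_norm t0).
have h4 : nrm f * nrm (tf_shift (trans_axis i (- t)) F - F - t%:C *: D) <= t * e.
  apply: (@le_trans _ _ (nrm f * (M * t ^+ 2))).
    by rewrite ler_wpM2l ?L2norm_ge0//; exact: hM.
  rewrite (_ : _ * (M * _) = t * (nrm f * M * t)); last by ring.
  by rewrite ler_wpM2l// ltW.
apply: le_trans (lerD (le_trans h1 h3) (le_trans h2 h4)) _.
by rewrite le_eqVlt; apply/orP; left; apply/eqP; ring.
Qed.

(** By the preceding bound, phi to -<partial phi, f> is a bounded functional on test functions; its
    representing vector is the weak derivative. f stands on the right to keep the functional linear
    rather than antilinear. *)
Lemma translation_lipschitz_H1 f :
  (forall i, exists K : R, forall t, nrm (tf_shift (trans_axis i t) f - f) <= K * `|t|) ->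
  H1 f.
Proof.
move=> fK i; have [K hK] := fK i.
pose P (u : H) (c : C) := exists2 phi, test_function phi &
  u = cls phi /\ c = - inner (cls (cpartial i phi)) f.
have t0 := @test_function0 R d.
have K0 : 0 <= K by have := le_trans (L2norm_ge0 _) (hK 1); rewrite normr1 mulr1.
have [//|||u c [phi tp [-> ->]]|h _ hP] := @riesz_minimization _ _ _ lambda P K.
- exists (fun=> 0) => //; split.
    by rewrite L2_class0.
  have -> : cpartial i (fun _ : 'rV[R]_d => 0 : C) = (fun=> 0).
    have := cpartial_lin 0 0 i t0 t0; rewrite (_ : (fun x => _ + _) = (fun=> 0)).
      by move=> ->; apply/funext => x; rewrite !mul0r addr0.
    by apply/funext => x; rewrite !mul0r addr0.
  by rewrite L2_class0 inner0l oppr0.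
- move=> a u c v e [phi tp [-> ->]] [psi ts [-> ->]].
  exists (fun x => a * phi x + 1 * psi x); first exact: test_function_lin.
  have [sp ss] := (test_function_sqi tp, test_function_sqi ts).
  have [cp cs] := (cpartial_sqi i tp, cpartial_sqi i ts).
  split; first by rewrite (L2_classD (sqiZ a sp) (sqiZ 1 ss)) !L2_classZ// scale1r.
  rewrite cpartial_lin// (L2_classD (sqiZ a cp) (sqiZ 1 cs)) !L2_classZ// scale1r.
  by rewrite innerDl innerZl opprD mulrN.
- rewrite normc_opp normc_innerC; exact: translation_lipschitz_derivative_bound.
exists h; apply/distributional_partialP => phi tp.
have := hP (cls phi) _ (ex_intro2 _ _ phi tp (conj erefl erefl)).
rewrite (innerC f) => E; rewrite (innerC (cls phi) h) -E.
have cN (z : C) : conjc (- conjc z) = - z by case: z => a b; apply: complexP => /=; ring.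
by rewrite cN opprK.
Qed.

(** The shift by t is cut into N + 1 equal steps. Each contributes its share of |t| |h| |phi| plus a
    Taylor error of order (t/(N + 1))^2, so the total error is of order t^2/(N + 1) and vanishes as
    N grows. *)
Lemma derivative_translation_weak f h i (t : R) phi : distributional_partial i f h ->
  test_function phi ->
  normc (inner (tf_shift (trans_axis i t) f - f) (cls phi)) <=
    `|t| * nrm h * nrm (cls phi).
Proof.
move=> /distributional_partialP fh tp; have [M M0 hM] := test_function_taylor i tp.
set D := cls (cpartial i phi); set F := cls phi.
have step (s a : R) : `|s| <= 1 ->
    normc (inner f (tf_shift (trans_axis i (- (a + s))) F - tf_shift (trans_axis i (- a)) F))
    <= `|s| * nrm h * nrm F + nrm f * (M * s ^+ 2).
  move=> s1; pose U := tf_shift (trans_axis i (- a)).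
  have UE u v : U (u - v) = U u - U v := linear_sub (tf_shift_linear _) u v.
  have UZ (c : C) u : U (c *: u) = c *: U u := linear_scale (tf_shift_linear _) c u.
  have -> : tf_shift (trans_axis i (- (a + s))) F - U F =
      U (tf_shift (trans_axis i (- s)) F - F - s%:C *: D) + s%:C *: U D.
    by rewrite !UE UZ addrNK /U trans_axis_comp opprD.
  have UD : inner f (U D) = - inner h (U F).
    rewrite /U !class_shift; [|exact: test_function_sqi|exact: cpartial_sqi].
    rewrite -fh; last exact: test_function_shift.
    by rewrite cpartial_shift.
  rewrite innerDr innerZr conjc_realE UD.
  apply: le_trans (le_normcD _ _) _; rewrite addrC; apply: lerD.
    rewrite Normc.normcM normc_real normc_opp -mulrA ler_wpM2l//.
    by apply: le_trans (cauchy_schwarz _ _) _; rewrite /U tf_shift_norm.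
  apply: le_trans (cauchy_schwarz _ _) _; rewrite /U tf_shift_norm.
  by rewrite ler_wpM2l ?L2norm_ge0//; exact: hM.
have main (N : nat) : `|t| <= N.+1%:R ->
    normc (inner (tf_shift (trans_axis i t) f - f) F) <=
      `|t| * nrm h * nrm F + nrm f * M * t ^+ 2 / N.+1%:R.
  move=> tN; pose s := t / N.+1%:R.
  have s1 : `|s| <= 1.
    by rewrite normrM normfV normr_nat ler_pdivrMr// mul1r.
  rewrite trans_difference_inner.
  have -> : tf_shift (trans_axis i (- t)) F - F =
      \sum_(0 <= n < N.+1) (tf_shift (trans_axis i (- (s * n.+1%:R))) F -
         tf_shift (trans_axis i (- (s * n%:R))) F).
    rewrite (telescope_sumr (fun n => tf_shift (trans_axis i (- (s * n%:R))) F))//.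
    rewrite mulr0 oppr0 trans_axis0; congr (tf_shift (trans_axis i (- _)) F - F).
    by rewrite /s divfK// pnatr_eq0.
  rewrite inner_sumr.
  apply: (@le_trans _ _ (\sum_(0 <= n < N.+1) (`|s| * nrm h * nrm F + nrm f * (M * s ^+ 2)))).
    elim: (index_iota 0 N.+1) => [|n r IH]; first by rewrite !big_nil Normc.normc0.
    rewrite !big_cons; apply: le_trans (le_normcD _ _) _; apply: lerD => //.
    by have := step s (s * n%:R) s1; rewrite -{2}[s]mulr1 -mulrDr natr1.
  rewrite sumr_const_nat subn0 -mulr_natr /s normrM normfV normr_nat.
  rewrite le_eqVlt; apply/orP; left; apply/eqP; field.
  by rewrite nat1r pnatr_eq0.
apply/ler_addgt0Pr => e e0.
have c0 : 0 <= nrm f * M * t ^+ 2.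
  apply: mulr_ge0; last exact: sqr_ge0.
  by rewrite mulr_ge0 ?L2norm_ge0.
pose N := Num.bound (`|t| + nrm f * M * t ^+ 2 / e).
have Nb : `|t| + nrm f * M * t ^+ 2 / e <= N.+1%:R.
  apply: (@le_trans _ _ N%:R); last by rewrite ler_nat.
  have b0 : 0 <= `|t| + nrm f * M * t ^+ 2 / e.
    by rewrite addr_ge0// divr_ge0// ltW.
  by have := ltW (archi_boundP b0).
apply: le_trans (main N _) _.
  by apply: le_trans Nb; rewrite lerDl mulr_ge0// invr_ge0 ltW.
rewrite lerD2l ler_pdivrMr// [e * _]mulrC -ler_pdivrMr//; apply: le_trans Nb.
by rewrite lerDr.
Qed.

End SobolevTranslations.

(** * The flat function exp(-1/y) *)

Section FlatFunctions.
Context {R : realType}.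
Implicit Types (y z : R) (k n : nat).

(* The index [k] makes the family closed under differentiation: the derivative
   of [flat k] is [- k * flat k.+1 + flat k.+2]. *)
Definition flat k y : R := if 0 < y then y^-1 ^+ k * expR (- y^-1) else 0.

Lemma flat_le0 k y : y <= 0 -> flat k y = 0.
Proof. by rewrite /flat; case: ltP. Qed.

(** The exponential series gives exp(1/y) >= y^-(k+1) / (k+1)!. The linear decay at 0 is all that
    differentiability there requires. *)
Lemma flat_bound k y : `|flat k y| <= (k.+1)`!%:R * `|y|.
Proof.
rewrite /flat; case: ltP => y0; last by rewrite normr0 mulr_ge0.
rewrite !ger0_norm ?mulr_ge0 ?exprn_ge0 ?invr_ge0 ?expR_ge0 ?(ltW y0)//.
rewrite expRN ler_pdivrMr ?expR_gt0//.
have := @expR_ge1Dxn R y^-1 k; rewrite invr_ge0 (ltW y0) => /(_ isT).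
move=> h; have {}h : y^-1 ^+ k.+1 / (k.+1)`!%:R <= expR y^-1 by move: h; lra.
move: h; rewrite ler_pdivrMr ?ltr0n ?fact_gt0// => h.
have -> : y^-1 ^+ k = y * y^-1 ^+ k.+1 by rewrite exprS mulrA mulfV ?gt_eqF// mul1r.
rewrite (_ : _ * _ * expR _ = y * (expR y^-1 * (k.+1)`!%:R)); last by ring.
by rewrite ler_wpM2l// ltW.
Qed.

Lemma is_derive_flat k y : is_derive y 1 (flat k) (- k%:R * flat k.+1 y + flat k.+2 y).
Proof.
have [y0|y0|<-] := ltgtP 0 y.
- have y_neq0 : y != 0 by rewrite gt_eqF.
  pose F : R -> R := ((fun z => z^-1) ^+ k) * (expR \o (- (fun z => z^-1))).
  have FE z : F z = z^-1 ^+ k * expR (- z^-1).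
    by rewrite /F /GRing.mul/= exprfctE.
  have nF : \near y, F y = flat k y.
    by near=> z; rewrite FE /flat ifT//; near: z; exact: lt_nbhsr.
  have dinv : is_derive y 1 (fun z : R => z^-1) (- y^-1 ^+ 2).
    have := @is_deriveV R id y 1 1 y_neq0 (is_derive_id _ _).
    by rewrite exprVn [- _ *: 1]mulr1.
  have dexp := @is_derive1_comp R expR (- (fun z : R => z^-1)) y _ _
    (is_derive_expR (- y^-1)) (is_deriveN dinv).
  have dF : is_derive y 1 F _ := is_deriveM (is_deriveX k dinv) dexp.
  apply: DeriveDef.
    by apply: (near_eq_derivable nF); exact: (@ex_derive _ _ _ _ _ _ _ dF).
  rewrite -(near_eq_derive (1 : R) nF) (@derive_val _ _ _ _ _ _ _ dF).
  rewrite /flat y0 exprfctE /=.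
  rewrite -[_ *: _]/(_ * _) -[X in _ + X]/(_ * (_ * _)).
  case: (k) => [|n] /=; first by rewrite !expr0; ring.
  by rewrite !exprS; ring.
- have nF : \near y, cst 0 y = flat k y.
    by near=> z; rewrite flat_le0//; apply: ltW; near: z; exact: lt_nbhsl.
  rewrite !flat_le0 ?(ltW y0)// mulr0 addr0; apply: DeriveDef.
    by apply: (near_eq_derivable nF); exact: derivable_cst.
  by rewrite -(near_eq_derive (1 : R) nF); exact: derive_cst.
(* At 0 the slope function of [flat k] is [flat k.+1], which tends to 0 by [flat_bound]. *)
rewrite !flat_le0// mulr0 addr0; apply/is_derive1_caratheodory.
exists (flat k.+1); split; last by rewrite flat_le0.
  move=> z; rewrite (flat_le0 k (lexx 0)) !subr0 /flat; case: ltP => z0; last by rewrite mul0r.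
  rewrite exprS (_ : _ * _ * z = z^-1 * z * (z^-1 ^+ k * expR (- z^-1))); last by ring.
  by rewrite mulVf ?gt_eqF// mul1r.
apply/cvgrPdist_le => e e0; rewrite (flat_le0 k.+1 (lexx 0)).
have c0 : 0 < (k.+2)`!%:R^-1 * e by rewrite mulr_gt0// invr_gt0 ltr0n fact_gt0.
apply: filterS (@nbhs0_le R R _ c0) => z hz; rewrite sub0r normrN.
by apply: le_trans (flat_bound _ _) _; rewrite -ler_pdivlMl ?ltr0n ?fact_gt0.
Unshelve. all: by end_near.
Qed.

Lemma continuous_flat k : continuous (flat k).
Proof.
move=> y; apply: differentiable_continuous; apply/derivable1_diffP.
exact: (@ex_derive _ _ _ _ _ _ _ (is_derive_flat k y)).
Qed.

Lemma flat0_ge0 y : 0 <= flat 0 y.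
Proof. by rewrite /flat; case: ifP => // _; rewrite expr0 mul1r expR_ge0. Qed.

Lemma flat0_le1 y : flat 0 y <= 1.
Proof.
rewrite /flat; case: ifP => // y0; rewrite expr0 mul1r -[leRHS]expR0 ler_expR.
by rewrite oppr_le0 invr_ge0 ltW.
Qed.

Lemma flat0_cvg1 y : 0 < y -> (fun n => flat 0 (n.+1%:R * y)) @ \oo --> (1 : R).
Proof.
move=> y0.
have -> : (fun n => flat 0 (n.+1%:R * y)) = expR \o (fun n => - (y^-1 * n.+1%:R^-1)).
  apply/funext => n /=; rewrite /flat ifT ?mulr_gt0// expr0 mul1r invfM.
  by rewrite [_^-1 * _]mulrC.
have h : (fun n => - (y^-1 * n.+1%:R^-1)) @ \oo --> - (y^-1 * 0).
  by apply: cvgN; apply: cvgM; [exact: cvg_cst|exact: invn_cvg0].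
rewrite mulr0 oppr0 in h; have := cvg_comp _ _ h (@continuous_expR R 0).
by rewrite expR0.
Qed.

End FlatFunctions.

(** * Smooth approximations of indicators of boxes *)

Section BumpFunctions.
Context {R : realType} {d : nat}.
Implicit Types (u v : 'rV[R]_d -> R) (a b x : 'rV[R]_d) (i j : 'I_d).

Local Notation e_ i := (delta_mx ord0 i : 'rV[R]_d).

(** A class of continuous functions closed under every partial derivative, so that all iterated
    partials are handled by one induction on the list of directions. *)
Inductive bump_algebra : ('rV[R]_d -> R) -> Prop :=
| bump_cst (c : R) : bump_algebra (fun=> c)
| bump_flat k j (s c : R) : bump_algebra (fun x => flat k (s * x ord0 j + c))
| bump_add u v : bump_algebra u -> bump_algebra v -> bump_algebra (fun x => u x + v x)
| bump_mul u v : bump_algebra u -> bump_algebra v -> bump_algebra (fun x => u x * v x).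

Lemma is_derive_of_line u i x (c : R) :
  is_derive (0 : R) 1 (fun t : R => u (x + t *: e_ i)) c -> is_derive x (e_ i) u c.
Proof.
have E : (fun h : R => h^-1 *: (((fun t => u (x + t *: e_ i)) \o shift 0) (h *: 1)
      - u (x + 0 *: e_ i))) =
    (fun h : R => h^-1 *: ((u \o shift x) (h *: e_ i) - u x)).
  apply/funext => h /=; rewrite scale0r !addr0 [h *: 1]mulr1.
  by rewrite [x + _]addrC.
move=> du; apply: DeriveDef.
  have := @ex_derive _ _ _ _ _ _ _ du; by rewrite /derivable E.
by have := @derive_val _ _ _ _ _ _ _ du; rewrite /derive E.
Qed.

Lemma is_derive_flat_coord k j (s c : R) i x :
  is_derive x (e_ i) (fun y => flat k (s * y ord0 j + c))
    ((- k%:R * flat k.+1 (s * x ord0 j + c) + flat k.+2 (s * x ord0 j + c)) *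
     (s * (i == j)%:R)).
Proof.
apply: is_derive_of_line.
have E : (fun t : R => flat k (s * (x + t *: e_ i) ord0 j + c)) =
    flat k \o (fun t : R => (s * (i == j)%:R) * t + (s * x ord0 j + c)).
  apply/funext => t /=; congr (flat k _).
  by rewrite !mxE eqxx /= eq_sym; ring.
rewrite E; apply: is_derive1_comp.
  by rewrite mulr0 add0r; exact: is_derive_flat.
by apply: is_derive_eq; rewrite addr0 [_ *: 1]mulr1.
Qed.

Lemma bump_algebra_continuous u : bump_algebra u -> continuous u.
Proof.
elim=> [c|k j s c|{}u v _ cu _ cv|{}u v _ cu _ cv] x.
- exact: cst_continuous.
- have h : (fun y : 'rV[R]_d => s * y ord0 j + c) y @[y --> x] --> s * x ord0 j + c.
    have hx := @coord_continuous R 1 d ord0 j x.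
    exact: (cvgD (cvgM (cvg_cst s) hx) (cvg_cst c)).
  exact: (cvg_comp _ _ h (@continuous_flat R k _)).
- exact: (cvgD (cu x) (cv x)).
- exact: (cvgM (cu x) (cv x)).
Qed.

Lemma bump_algebra_derive u i : bump_algebra u -> exists2 u', bump_algebra u' &
  forall x, is_derive x (e_ i) u (u' x).
Proof.
elim=> [c|k j s c|{}u v bu [u' bu' du] bv [v' bv' dv]|{}u v bu [u' bu' du] bv [v' bv' dv]].
- exists (fun=> 0); first exact: bump_cst.
  by move=> x; exact: is_derive_cst.
- eexists; last by move=> x; exact: is_derive_flat_coord.
  apply: bump_mul; last exact: bump_cst.
  apply: bump_add; last exact: bump_flat.
  by apply: bump_mul; [exact: bump_cst|exact: bump_flat].
- exists (fun x => u' x + v' x); first exact: bump_add.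
  by move=> x; exact: is_deriveD.
exists (fun x => u x * v' x + v x * u' x).
  by apply: bump_add; exact: bump_mul.
by move=> x; exact: is_deriveM.
Qed.

Lemma bump_algebra_smooth u : bump_algebra u -> smooth u.
Proof.
move=> bu s; have bs : bump_algebra (foldr partial u s).
  elim: s => [//|i s /(bump_algebra_derive i)[v bv dv]] /=.
  rewrite (_ : partial i _ = v)//; apply/funext => x.
  exact: (@derive_val _ _ _ _ _ _ _ (dv x)).
split; first exact: bump_algebra_continuous.
move=> i x; have [v _ dv] := bump_algebra_derive i bs.
exact: (@ex_derive _ _ _ _ _ _ _ (dv x)).
Qed.

Lemma bump_prod (r : seq 'I_d) (F : 'I_d -> 'rV[R]_d -> R) :
  (forall i, bump_algebra (F i)) -> bump_algebra (fun x => \prod_(i <- r) F i x).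
Proof.
move=> bF; elim: r => [|i r IH].
  by rewrite (_ : (fun x => _) = (fun=> 1)); [exact: bump_cst|apply/funext => x; rewrite big_nil].
rewrite (_ : (fun x => _) = (fun x => F i x * \prod_(j <- r) F j x)); first exact: bump_mul.
by apply/funext => x; rewrite big_cons.
Qed.

(** Inside the box this is the exponential of -1/(n+1) times the sum of all 1/(x_i - a_i) and 1/(b_i
    - x_i), which tends to 1; outside the box it is 0. *)
Definition box_bump a b (n : nat) x : R := \prod_i
  (flat 0 (n.+1%:R * (x ord0 i - a ord0 i)) * flat 0 (n.+1%:R * (b ord0 i - x ord0 i))).

Lemma box_bump_smooth a b n : smooth (box_bump a b n).
Proof.
apply: bump_algebra_smooth; apply: bump_prod => i.
rewrite (_ : (fun x => _) = (fun x =>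
    flat 0 (n.+1%:R * x ord0 i + - (n.+1%:R * a ord0 i)) *
    flat 0 (- n.+1%:R * x ord0 i + n.+1%:R * b ord0 i))).
  by apply: bump_mul; exact: bump_flat.
by apply/funext => x; rewrite mulrBr mulrBr mulNr [- _ + _]addrC.
Qed.

Lemma box_bump_ge0 a b n x : 0 <= box_bump a b n x.
Proof. by apply: prodr_ge0 => i _; rewrite mulr_ge0 ?flat0_ge0. Qed.

Lemma box_bump_eq0 a b n x : ~ open_box a b x -> box_bump a b n x = 0.
Proof.
move=> /existsNP[i /negP]; rewrite negb_and -!leNgt => h.
rewrite /box_bump (bigD1 i)//=; case/orP: h => h.
  by rewrite flat_le0 ?mul0r// mulr_ge0_le0// subr_le0.
by rewrite [X in _ * X * _]flat_le0 ?mulr0 ?mul0r// mulr_ge0_le0// subr_le0.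
Qed.

Lemma box_bump_le_indic a b n x : box_bump a b n x <= \1_(open_box a b) x.
Proof.
rewrite indicE; have [xab|xab] := pselect (open_box a b x).
  rewrite mem_set//; apply: (@le_trans _ _ (\prod_(i < d) 1)); last by rewrite big1.
  by apply: ler_prod => i _; rewrite mulr_ge0 ?flat0_ge0//= mulr_ile1 ?flat0_ge0 ?flat0_le1.
by rewrite memNset// box_bump_eq0.
Qed.

Lemma box_bump_cvg a b x : (fun n => box_bump a b n x) @ \oo --> (\1_(open_box a b) x : R).
Proof.
rewrite indicE; have [xab|xab] := pselect (open_box a b x); last first.
  by rewrite memNset//; under eq_fun do rewrite box_bump_eq0//; exact: cvg_cst.
rewrite mem_set// /box_bump mulr1n.
elim: (index_enum _) => [|i r IH].
  by under eq_fun do rewrite big_nil; exact: cvg_cst.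
under eq_fun do rewrite big_cons.
have /andP[h1 h2] := xab i; rewrite -subr_gt0 in h1; rewrite -subr_gt0 in h2.
have := cvgM (cvgM (flat0_cvg1 h1) (flat0_cvg1 h2)) IH.
by rewrite (mulr1 (1 : R)) (mulr1 (1 : R)) => H; apply: H.
Qed.

End BumpFunctions.

(** * Functions whose integrals over boxes vanish *)

Section BoxIntegrals.
Context {R : realType} {d : nat}.
Local Notation lambda := (@lebesgue_rV R d).
Variable w : 'rV[R]_d -> R.
Implicit Types (a b : 'rV[R]_d).
Hypothesis wB : forall a b,
  lambda.-integrable setT (EFin \o (fun x => w x * \1_(open_box a b) x)).
Hypothesis w0 : forall a b,
  (\int[lambda]_x (w x * \1_(open_box a b) x)%:E)%E = 0%E.

(** On a fixed centered box w is integrable, and the sets over which this restriction integrates to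
    0 form a Dynkin system containing the boxes. By the pi-lambda theorem it contains all measurable
    sets. *)
Lemma box_integrals_eq0 : {ae lambda, forall x, w x = 0}.
Proof.
suff ae_box k : {ae lambda, forall x, w x * \1_(@centered_box R d k) x = 0}.
  have := ae_foralln ae_box; apply: filterS => x h.
  have [k _ xk] : (\bigcup_k @centered_box R d k) x by rewrite centered_box_cover.
  by have := h k; rewrite indicE mem_set// mulr1.
pose w1 x := w x * \1_(@centered_box R d k) x.
have iw1 : lambda.-integrable setT (EFin \o w1) by exact: wB.
pose D : set (set 'rV[R]_d) :=
  [set A | measurable A /\ (\int[lambda]_(x in A) (w1 x)%:E)%E = 0%E].
have DT : D setT by split => //; exact: w0.
have dD : dynkin D.
  split => //.
  - move=> A [mA A0]; split; first exact: measurableC.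
    have [_] := DT; rewrite -(setUv A) integral_setU_EFin//.
    + by rewrite A0 add0e.
    + exact: measurableC.
    + rewrite setUv; apply/measurable_EFinP; exact: (measurable_int _ iw1).
    + by apply/disj_setPS; rewrite setICr.
  move=> F tF DF; split; first by apply: bigcup_measurable => i _; case: (DF i).
  rewrite integral_bigcup//.
  - by apply: eseries0 => i _ _; case: (DF i).
  - by move=> i; case: (DF i).
  - apply: (integrableS measurableT) => //.
    by apply: bigcup_measurable => i _; case: (DF i).
have boxD : @open_boxes R d `<=` D.
  move=> _ [a [b ->]]; split; first exact: measurable_open_box.
  (* Intersecting with the centered box gives a box again, to which [w0] applies. *)
  have [a' [b' E]] := open_boxes_setI (ex_intro _ a (ex_intro _ b erefl))
    (ex_intro _ _ (ex_intro _ _ erefl) : @open_boxes R d (centered_box k)).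
  rewrite integral_mkcond -[RHS](w0 a' b'); apply: eq_integral => x _.
  rewrite patchE /w1 -E indicI /=; case: ifPn => xA; rewrite !indicE ?xA.
    by rewrite mul1r.
  by rewrite (negbTE xA) mul0r mulr0.
have mD A : measurable A -> D A.
  rewrite measurable_open_boxes.
  rewrite -(setI_closed_g_dynkin_g_sigma_algebra (@open_boxes_setI R d)).
  by apply: smallest_sub.
have : ae_eq lambda setT (EFin \o w1) (cst 0%E).
  apply: (integral_ae_eq measurableT iw1) => // A _ mA.
  by have [_ ->] := mD A mA; rewrite integral0.
by apply: filterS => x /= /(_ Logic.I) [].
Qed.

End BoxIntegrals.

(** * Totality of test functions in L^2 *)

Section TestFunctionsTotal.
Context {R : realType} {d : nat}.
Local Notation C := R[i].
Local Notation lambda := (@lebesgue_rV R d).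
Local Notation sqi := (square_integrable lambda).
Local Notation H := (L2Rd R d).
Local Notation nrm := (@L2norm _ _ _ lambda).
Local Notation cls := (@L2_class _ _ _ lambda).
Implicit Types (f g h : H) (phi psi : 'rV[R]_d -> C) (i : 'I_d) (a b : 'rV[R]_d).

Definition box_bound a b : R := \sum_i (`|a ord0 i| + `|b ord0 i|).

Lemma open_box_bounded a b x i : open_box a b x -> `|x ord0 i| <= box_bound a b.
Proof.
move=> /(_ i)/andP[ax xb]; apply: (@le_trans _ _ (`|a ord0 i| + `|b ord0 i|)).
  rewrite ler_norml; have := ler_norm (b ord0 i); have := ler_norm (- a ord0 i).
  by rewrite normrN => h1 h2; apply/andP; split; have := normr_ge0 (a ord0 i);
    have := normr_ge0 (b ord0 i); lra.
by rewrite /box_bound (bigD1 i)//= lerDl sumr_ge0// => j _; rewrite addr_ge0.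
Qed.

Lemma box_indic_sqi a b : (fun x => (\1_(open_box a b) x)%:C) \in sqi.
Proof.
have [K _ hK] := @vanishes_off_L2norm R d (box_bound a b).
have [] // := hK (fun x => (\1_(open_box a b) x)%:C) 1.
- split; last exact: measurable_cst.
  exact: (@measurable_indic _ _ _ _ _ (measurable_open_box a b)).
- move=> x i kx; rewrite indicE memNset// => /(open_box_bounded i).
  by rewrite leNgt kx.
by move=> x; rewrite normc_real indicE; case: (_ \in _); rewrite ?normr0 ?normr1.
Qed.

Lemma box_bump_test_function a b n : test_function (fun x => (box_bump a b n x)%:C).
Proof.
apply: (@test_functionI _ _ _ (box_bound a b)).
- exact: box_bump_smooth.
- by have [] := @test_function0 R d.
move=> x i kx; rewrite box_bump_eq0// => /(open_box_bounded i).
by rewrite leNgt kx.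
Qed.

(** Testing with [box_bump] and letting n grow under dominated convergence, the real and the
    imaginary part of f have integral 0 over every box. *)
Lemma test_functions_total f :
  (forall phi, test_function phi -> inner f (cls phi) = 0) -> f = 0.
Proof.
move=> f0.
have ae0 (w : 'rV[R]_d -> R) : measurable_fun setT w ->
    (forall v : 'rV[R]_d -> R, (fun x => (v x)%:C) \in sqi ->
       lambda.-integrable setT (EFin \o (fun x => w x * v x))) ->
    (forall a b n, (\int[lambda]_x (w x * box_bump a b n x)%:E)%E = 0%E) ->
    {ae lambda, forall x, w x = 0}.
  move=> mw wi wb; apply: box_integrals_eq0 => a b.
    exact: wi (box_indic_sqi a b).
  have iB := wi _ (box_indic_sqi a b).
  have := @dominated_cvg _ _ _ lambda setT measurableT
    (fun n x => (w x * box_bump a b n x)%:E) (fun x => (w x * \1_(open_box a b) x)%:E)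
    (fun x => `|(w x * \1_(open_box a b) x)%:E|%E).
  have E : (fun n => \int[lambda]_x (w x * box_bump a b n x)%:E)%E = (fun=> 0%E).
    by apply/funext => n; exact: wb.
  rewrite E => h; apply/esym.
  have {}h : (fun _ : nat => 0%E : \bar R) @ \oo -->
      (\int[lambda]_x (w x * \1_(open_box a b) x)%:E)%E.
    apply: h => //.
    - move=> n; apply/measurable_EFinP; apply: measurable_funM => //.
      apply: continuous_measurable_rV; apply: smooth_continuous.
      exact: box_bump_smooth.
    - move=> x _; apply: cvg_EFin.
        by near=> n.
      by apply: cvgM; [exact: cvg_cst|exact: box_bump_cvg].
    - exact: (integrable_abse iB).
    - move=> n x _; rewrite /= lee_fin !normrM ler_wpM2l//.
      rewrite !ger0_norm ?box_bump_ge0 ?box_bump_le_indic//.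
  exact: (cvg_unique _ (cvg_cst _) h).
have sf := L2_sqi f; have [mr mi] := sqi_measurable sf.
have bump0 a b n : cintegral lambda (fun x => f x * (box_bump a b n x)%:C) = 0.
  have tb := box_bump_test_function a b n.
  rewrite -(f0 _ tb) (inner_ae sf (test_function_sqi tb) (ae_eq_refl _ _ f)
    (L2_classE (test_function_sqi tb))).
  apply: eq_cintegral => x; congr (_ * _).
  by apply: complexP => //=; rewrite oppr0.
have ReE (v : 'rV[R]_d -> R) : Re \o (fun x => f x * (v x)%:C) = (fun x => Re (f x) * v x).
  by apply/funext => x /=; rewrite ReM /= mulr0 subr0.
have ImE (v : 'rV[R]_d -> R) : Im \o (fun x => f x * (v x)%:C) = (fun x => Im (f x) * v x).
  by apply/funext => x /=; rewrite ImM /= mulr0 add0r.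
have fi (v : 'rV[R]_d -> R) : (fun x => (v x)%:C) \in sqi ->
    cintegrable lambda (fun x => f x * (v x)%:C) by exact: sqi_mul_integrable.
have fin0 (u : 'rV[R]_d -> R) : lambda.-integrable setT (EFin \o u) ->
    fine (\int[lambda]_x (u x)%:E) = 0 -> (\int[lambda]_x (u x)%:E = 0)%E.
  by move=> iu u0; rewrite -[LHS]fineK ?u0//; exact: integrable_fin_num.
have aeR : {ae lambda, forall x, Re (f x) = 0}.
  apply: ae0 => [//|v /fi[]|a b n]; first by rewrite ReE.
  have [ir _] := fi _ (test_function_sqi (box_bump_test_function a b n)).
  rewrite ReE in ir; apply: (fin0 (fun x => Re (f x) * box_bump a b n x)) => //.
  have /(congr1 Re) /= := bump0 a b n.
  rewrite -[RHS]/(0 : R) => <-; congr fine; apply: eq_integral => x _.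
  by rewrite ReM /= mulr0 subr0.
have aeI : {ae lambda, forall x, Im (f x) = 0}.
  apply: ae0 => [//|v /fi[]|a b n]; first by rewrite ImE.
  have [_ ir] := fi _ (test_function_sqi (box_bump_test_function a b n)).
  rewrite ImE in ir; apply: (fin0 (fun x => Im (f x) * box_bump a b n x)) => //.
  have /(congr1 Im) /= := bump0 a b n.
  rewrite -[RHS]/(0 : R) => <-; congr fine; apply: eq_integral => x _.
  by rewrite ImM /= mulr0 add0r.
apply: L2norm_eq0P; apply/eqP; rewrite -sqrf_eq0; apply/eqP; apply: EFin_inj.
rewrite sqr_L2normE (ae_eq_integral (cst 0%E)) ?integral0//.
  by apply/measurable_EFinP; apply: measurable_funX; exact: measurable_normc.
apply: filterS2 aeR aeI => x /= r0 i0 _; congr EFin.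
by rewrite sqr_normcE r0 i0 !expr0n addr0.
Unshelve. all: by end_near.
Qed.

(** Density of test functions in disguise: the functional <., f> on test functions has a
    representing vector h of norm at most K, and f - h is orthogonal to all test functions, so f =
    h. *)
Lemma test_function_dual_norm f (K : R) : 0 <= K ->
  (forall phi, test_function phi -> normc (inner f (cls phi)) <= K * nrm (cls phi)) ->
  nrm f <= K.
Proof.
move=> K0 fK.
pose P (u : H) (c : C) := exists2 phi, test_function phi & u = cls phi /\ c = inner u f.
have t0 := @test_function0 R d.
have [//|||u c [phi tp [-> ->]]|h hK hP] := @riesz_minimization _ _ _ lambda P K.
- by exists (fun=> 0) => //; rewrite L2_class0 inner0l.
- move=> a u c v e [phi tp [-> ->]] [psi ts [-> ->]].
  exists (fun x => a * phi x + 1 * psi x); first exact: test_function_lin.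
  have [sp ss] := (test_function_sqi tp, test_function_sqi ts).
  split; first by rewrite (L2_classD (sqiZ a sp) (sqiZ 1 ss)) !L2_classZ// scale1r.
  by rewrite innerDl innerZl.
- by rewrite normc_innerC; exact: fK.
suff -> : f = h by [].
apply/eqP; rewrite -subr_eq0; apply/eqP; apply: test_functions_total => phi tp.
have E := hP (cls phi) _ (ex_intro2 _ _ phi tp (conj erefl erefl)).
by rewrite innerBl (innerC (cls phi)) E -innerC subrr.
Qed.

Lemma H1_translation_lipschitz f : H1 f ->
  forall i, exists K : R, forall t, nrm (tf_shift (trans_axis i t) f - f) <= K * `|t|.
Proof.
move=> f1 i; have [h fh] := f1 i; exists (nrm h) => t.
apply: test_function_dual_norm => [|phi tp]; first by rewrite mulr_ge0 ?L2norm_ge0.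
by rewrite [nrm h * _]mulrC; exact: derivative_translation_weak.
Qed.

End TestFunctionsTotal.

(** * Transfer of the function spaces and conclusion *)

Lemma window_transfer {R : realType} {d : nat} (V : set (L2Rd R d)) (g f : L2Rd R d) (K : R) :
  [\/ V = @H1 R d, V = @L2_weighted R d | V = @HH1 R d] -> V g ->
  (forall z, L2norm (tf_shift z f - f) <= K * L2norm (tf_shift z g - g)) -> V f.
Proof.
move=> hV Vg fK.
have lip (l : R -> 'rV[R]_(d + d)) :
    (exists M : R, forall t, L2norm (tf_shift (l t) g - g) <= M * `|t|) ->
    exists M : R, forall t, L2norm (tf_shift (l t) f - f) <= M * `|t|.
  (* The absolute value, because [K] carries no sign. *)
  move=> [M gM]; exists (`|K| * M) => t; rewrite -mulrA.
  apply: le_trans (fK _) _; apply: (@le_trans _ _ (`|K| * L2norm (tf_shift (l t) g - g))).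
    by rewrite ler_wpM2r ?L2norm_ge0// ler_norm.
  by rewrite ler_wpM2l.
have h1 : H1 g -> H1 f.
  move=> /H1_translation_lipschitz gl; apply: translation_lipschitz_H1 => i.
  exact: lip (gl i).
have hw : L2_weighted g -> L2_weighted f.
  move=> /weighted_modulation_lipschitz gl; apply: modulation_lipschitz_weighted => i.
  exact: lip (gl i).
by case: hV Vg => ->; [exact: h1|exact: hw|move=> [/h1 ? /hw ?]].
Qed.

Theorem theorem1p1 (R : realType) (d : nat) (hd : (0 < d)%N)
    (V : set (L2Rd R d))
    (hV : [\/ V = @H1 R d, V = @L2_weighted R d | V = @HH1 R d])
    (g : L2Rd R d) (hg : V g)
    (L : set 'rV[R]_(d + d)) (hL : is_lattice L) (hgL : gabor_frame g L) :
  let frame_op := frame_operator g L in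
  let S_inv := inverse_operator frame_op in
  let S_inv_sqrt := sqrt_operator S_inv in
  V (S_inv g) /\
  (parseval_gabor_frame (S_inv_sqrt g) L /\ V (S_inv_sqrt g)).
Proof.
have [A [B [A0 AB gAB]]] := hgL.
have [K1 hK1] := dual_window_tf_shift hL A0 AB gAB.
have [K2 hK2] := parseval_window_tf_shift hL A0 AB gAB.
split; first exact: window_transfer hV hg hK1.
split; first exact (parseval_window hL A0 AB gAB).
exact: window_transfer hV hg hK2.
Qed.
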